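(* Let $k\ge 2$ and $r\ge 2$ be fixed integers and let $d=\gcd(k,r)$. There exists a constant $C>0$ such that the following holds. Let $p=p(n)$ satisfy $C\log(n)/n < p < 1$ for every $n\ge 1$, and $n^{r-1}p(1-p)\to\infty$ as $n\to\infty$. Then asymptotically almost surely the random hypergraph $H_{n,p,r}$ satisfies: (i) if $n\equiv 0 \pmod d$, then $\chi_k'(H_{n,p,r})=k$; (ii) if $n\not\equiv 0 \pmod d$, then $\max(k,r)\le \chi_k'(H_{n,p,r})\le k+r+1$.
   Context: For integers $n\ge1$, $r\ge 2$ and $p\in[0,1]$, $\mathbf{H}(n,p,r)$ is the probability space of $r$-uniform hypergraphs on vertex set $[n]=\{1,\dots,n\}$ in which each $r$-subset of $[n]$ is a hyperedge independently with probability $p$; $H_{n,p,r}$ denotes a random hypergraph sampled from it. A property holds asymptotically almost surely (a.a.s.) if the probability that $H_{n,p,r}$ has it tends to $1$ as $n\to\infty$. The degree of a vertex is the number of hyperedges containing it. For an integer $k\ge 2$, a hypergraph is a $1_k$-hypergraph if every vertex has degree either $0$ or congruent to $1$ modulo $k$. The modular $k$-chromatic index $\chi_k'(H)$ of a hypergraph $H$ is the minimum number of edge-disjoint $1_k$-subhypergraphs of $H$ whose union covers all hyperedges of $H$ (equivalently, the minimum number of parts in a partition of $E(H)$ such that each part, viewed as a hypergraph, is a $1_k$-hypergraph). *)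

(* Defs.v *)
From HB Require Import structures.
From mathcomp Require Import all_boot all_order all_algebra.

Set Implicit Arguments.
Unset Strict Implicit.
Unset Printing Implicit Defensive.

Import Order.TTheory GRing.Theory Num.Theory.

(* A hypergraph is identified with its set of hyperedges; the vertex set is the
   whole type V, so subhypergraphs are sets of hyperedges (isolated vertices
   have degree 0 and play no role in the definitions below). *)
Notation hypergraph V := {set {set V}}.

Section Hypergraph.
Variables (V : finType) (k : nat).
Implicit Type H : hypergraph V.

Definition hdegree H (v : V) : nat := #|[set e in H | v \in e]|.

Definition uniform (r : nat) H : bool := [forall e in H, #|e| == r].

Definition one_mod_hypergraph H : bool :=
  [forall v : V, (hdegree H v == 0%N) || (hdegree H v == 1 %[mod k])].

Definition one_mod_decomposition H (P : {set hypergraph V}) : bool :=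
  partition P H && [forall F in P, one_mod_hypergraph F].

Definition one_mod_decomposable H (m : nat) : bool :=
  [exists P : {set hypergraph V}, one_mod_decomposition H P && (#|P| == m)].

(* The partition of H into single hyperedges witnesses that the minimum below
   ranges over a nonempty set. *)
Lemma one_mod_decomposable_ex H : exists m, one_mod_decomposable H m.
Proof.
exists #|[set [set e] | e in H]|; apply/existsP.
exists [set [set e] | e in H]; rewrite eqxx andbT.
apply/andP; split.
  apply/and3P; split.
  - rewrite cover_imset; apply/eqP/setP => e; apply/bigcupP/idP.
      by case=> f fH; rewrite inE => /eqP ->.
    by move=> eH; exists e; rewrite ?inE.
  - apply/trivIsetP => _ _ /imsetP[e _ ->] /imsetP[f _ ->] ef.
    rewrite disjoints1 inE; apply: contra ef => /eqP ->.
    by rewrite eqxx.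
  - by apply/imsetP => -[e _] /setP/(_ e); rewrite !inE eqxx.
apply/forall_inP => _ /imsetP[e _ ->]; apply/forallP => v; rewrite /hdegree.
have [ve|ve] := boolP (v \in e).
  have -> : [set f in [set e] | v \in f] = [set e].
    by apply/setP => f; rewrite !inE; case: eqP => // ->.
  by rewrite cards1 eqxx orbT.
have -> : [set f in [set e] | v \in f] = set0.
  by apply/setP => f; rewrite !inE; case: eqP => // ->; rewrite (negbTE ve).
by rewrite cards0.
Qed.

Definition mod_chromatic_index H : nat := ex_minn (one_mod_decomposable_ex H).

End Hypergraph.

(* Imported only here because the classical `partition` and set notations would
   shadow those of finset used above. *)
From mathcomp Require Import all_classical all_reals all_analysis.
Import numFieldNormedType.Exports.

Local Open Scope classical_set_scope.
Local Open Scope ring_scope.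

Section RandomHypergraph.
Variable R : realType.

(* Probability that H(n,p,r) equals the r-uniform hypergraph H: every r-subset
   of the vertex set is independently present with probability p. *)
Definition random_hypergraph_weight (n r : nat) (p : R)
    (H : hypergraph 'I_n) : R :=
  \prod_(e : {set 'I_n} | #|e| == r) (if e \in H then p else 1 - p).

Definition random_hypergraph_pr (n r : nat) (p : R)
    (A : pred (hypergraph 'I_n)) : R :=
  \sum_(H : hypergraph 'I_n | uniform r H && A H)
    random_hypergraph_weight r p H.

Definition aas (r : nat) (p : nat -> R)
    (A : forall n : nat, pred (hypergraph 'I_n)) : Prop :=
  (fun n : nat => random_hypergraph_pr r (p n) (A n)) @ \oo --> (1 : R).

End RandomHypergraph.

(* Main.v *)
(** Let d = gcd(k, r) and let d(v) be the degree of v.  A spanning 1_k-class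
    forces d | n, and when d does not divide n every class misses a vertex; as
    every set of r - 1 vertices lies in a hyperedge, fewer than r classes cannot
    cover.  A vertex of positive degree divisible by k forces k classes.

    For the upper bounds the basic step ("round") finds, inside a set V' with
    d | #|V'|, sparsely many hyperedges giving degree 1 mod k on V' and 0 outside.
    It uses hyperedges x |: g with g in a fixed family of disjoint (r-1)-sets: a
    vertex x is matched to a g, where g may receive any load 1 + k t, so all is
    reduced to Hall's theorem in a bipartite random graph between vertices and
    (r-1)-sets of density p >= C log n / n, whatever r is.

    If d | n, a vertex with d(v) = s mod k, 1 <= s <= k, is put into s - 1 of
    k - 1 rounds and what remains is the last class; vertices with s = k lie in
    every round, so the rounds may use the (r-1)-sets all of whose vertices have
    degree 0 mod k.  If d does not divide n, take disjoint sets W_0, ..., W_r of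
    size n mod d; every hyperedge avoids some W_j, and k rounds followed by
    exchanges between the r + 1 classes turn each class into one with degree
    1 mod k exactly outside W_j.

    The random hypergraph enters through upper and lower bounds on the number of
    hyperedges x |: g with x and g in given sets, and through the fact that every
    vertex, and every (r-1)-set, has many extensions by vertices of prescribed
    degree residue.  The latter holds because hyperedges into a reserved set R0
    randomise the residues independently: a binomial variable hits each residue
    class mod k with probability at least 8^-(k-1). *)
Require Import Defs.
From HB Require Import structures.
From mathcomp Require Import all_boot all_order all_algebra.
From mathcomp Require Import all_classical all_reals all_analysis.
From mathcomp Require Import zify ring lra.
From mathcomp Require Import fintype finset.

Set Implicit Arguments.
Unset Strict Implicit.
Unset Printing Implicit Defensive.

Import Order.TTheory GRing.Theory Num.Theory.
Import numFieldNormedType.Exports.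

(** * Finite combinatorics *)

(** A round must have bounded degree: the hyperedges spent so far then take only O(1) links from any
    vertex or group, while each has at least order log n of them, so the next round still exists in
    what is left. As the groups are disjoint and avoid the vertices matched to them, distinct pairs
    (x, g) are distinct potential hyperedges, and a union bound over vertex sets and families of
    groups costs only an exponential in n. Residues dictate which vertices a round contains, but its
    size must be divisible by d; vertices free to change rounds repair the sizes. A round also has
    to contain well-linked groups. Either residues put a common supply of groups into all rounds, or
    each round has a part reserved for it, whose vertices must then join at least one round; hence k
    rounds instead of k - 1 when d does not divide n. There, corrections use hyperedges with at most
    one vertex in the reservoir containing the W_j. Such a hyperedge meets at most one W_j, so
    unless already used it lies in class 0 or 1: repairing classes 2, ..., r and then class 1
    disturbs no repaired class, and the total degree settles class 0. *)

Section Hall.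
Variables (X Y : finType) (e : X -> Y -> bool).

Definition nbr (S : {set X}) : {set Y} := [set y | [exists x in S, e x y]].

Lemma nbrU (S T : {set X}) : nbr (S :|: T) = nbr S :|: nbr T.
Proof.
apply/setP => y; rewrite !inE; apply/exists_inP/orP.
  move=> [x]; rewrite inE => /orP[xS|xT] exy; [left|right]; apply/exists_inP;
    by exists x.
by move=> [] /exists_inP[x xS exy]; exists x; rewrite // inE xS ?orbT.
Qed.

(** Induction in the style of Halmos and Vaughan: a tight proper subset S uses up the capacity of
    its neighbours, so S and [A :\: S] separate; if none is tight, every proper subset has a unit to
    spare and x0 may take any neighbour with capacity left. [y0] is only a default value for empty
    A. *)
Lemma hall_load (y0 : Y) (A : {set X}) (b : Y -> nat) :
  (forall S : {set X}, S \subset A -> #|S| <= \sum_(y in nbr S) b y) ->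
  exists f : X -> Y, (forall x, x \in A -> e x (f x)) /\
    (forall y, #|[set x in A | f x == y]| <= b y).
Proof.
have [n] := ubnP #|A|; elim: n A b => // n IH A b leAn hallA.
have [->|[x0 x0A]] := set_0Vmem A.
  exists (fun=> y0); split=> [x|y]; first by rewrite inE.
  by rewrite (_ : [set _ in _ | _] = set0) ?cards0 //; apply/setP=> x; rewrite !inE.
have [/existsP[S /and4P[SA S0 SnA /eqP tight]]|notight] :=
  boolP [exists S : {set X}, [&& S \subset A, S != set0, S != A &
                   \sum_(y in nbr S) b y == #|S|]].
  have ltSA : #|S| < #|A| by apply: proper_card; rewrite properEneq SnA.
  have ltDA : #|A :\: S| < #|A|.
    by rewrite cardsD (setIidPr SA) -subn_gt0 subKn ?card_gt0 // subset_leq_card.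
  have [||f1 [f1e f1b]] := IH S b.
  - exact: leq_trans ltSA _.
  - by move=> S' S'S; apply: hallA; apply: subset_trans SA.
  pose b' y := if y \in nbr S then 0 else b y.
  have [||f2 [f2e f2b]] := IH (A :\: S) b'.
  - exact: leq_trans ltDA _.
  - move=> S' S'A; have dSS' : [disjoint S & S'].
      rewrite disjoint_sym disjoint_subset; apply/subsetP => x /(subsetP S'A).
      by rewrite !inE => /andP[].
    have := hallA (S :|: S'); rewrite nbrU.
    have -> : S :|: S' \subset A.
      rewrite subUset SA /=; apply: subset_trans S'A _; exact: subsetDl.
    move=> /(_ isT); rewrite cardsU disjoint_setI0 // cards0 subn0.
    rewrite (big_setID (nbr S)) /= setUK setDUl setDv set0U.
    rewrite tight leq_add2l => /leq_trans; apply.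
    rewrite [leqRHS](big_setID (nbr S)) /=; apply: leq_trans (leq_addl _ _).
    by apply: leq_sum => y; rewrite /b' inE => /andP[/negbTE ->].
  exists (fun x => if x \in S then f1 x else f2 x); split=> [x xA|y].
    by case: ifPn => xS; [apply: f1e | apply: f2e; rewrite inE xS].
  have := f2b y; rewrite /b'; case: ifPn => yS f2y.
    apply: leq_trans (f1b y); apply: subset_leq_card; apply/subsetP => x.
    rewrite !inE; case: ifPn => [xS /andP[_ ->] //|xS /andP[xA fx]].
    move: f2y; rewrite leqn0 cards_eq0 => /eqP/setP/(_ x).
    by rewrite !inE xS xA fx.
  apply: leq_trans f2y; apply: subset_leq_card; apply/subsetP => x.
  rewrite !inE; case: ifPn => [xS /andP[_ /eqP fx]|xS /andP[-> ->] //].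
  case/negP: yS; rewrite inE; apply/exists_inP; exists x => //.
  by rewrite -fx; apply: f1e.
have lt_hall (S : {set X}) : S \subset A -> S != set0 -> S != A ->
    #|S| < \sum_(y in nbr S) b y.
  move=> SA S0 SnA; rewrite ltn_neqAle hallA // andbT.
  by apply: contra notight => tS; apply/existsP; exists S; rewrite SA S0 SnA eq_sym.
have [y1 ex0 by1] : exists2 y, e x0 y & 0 < b y.
  have := hallA [set x0]; rewrite sub1set x0A cards1 => /(_ isT).
  case: (pickP (fun y => e x0 y && (0 < b y))) => [y /andP[? ?]|none]; first by exists y.
  rewrite big1 // => y; rewrite inE => /exists_inP[x]; rewrite inE => /eqP -> ey.
  by have := none y; rewrite ey lt0n => /negbT; rewrite negbK => /eqP.
pose b' y := b y - (y == y1).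
have [||f [fe fb]] := IH (A :\ x0) b'.
- by move: leAn; rewrite (cardsD1 x0) x0A.
- move=> S SA.
  have [->|Sn0] := eqVneq S set0; first by rewrite cards0.
  have SA' : S \subset A by apply: subset_trans SA (subsetDl _ _).
  have SnA : S != A.
    by apply: contraL SA => /eqP ->; apply/negP => /subsetP/(_ _ x0A); rewrite !inE eqxx.
  have := lt_hall S SA' Sn0 SnA.
  have le1 : \sum_(y in nbr S) b y <= (\sum_(y in nbr S) b' y) + 1.
    apply: (@leq_trans (\sum_(y in nbr S) (b' y + (y == y1)))).
      by apply: leq_sum => y _; rewrite /b'; lia.
    rewrite big_split leq_add2l /= (eq_bigr (fun y => if y == y1 then 1 else 0)).
      rewrite -big_mkcondr /= sum1_card -[leqRHS](card1 y1).
      by apply: subset_leq_card; apply/subsetP => y /andP[].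
    by move=> y _; case: eqP.
  by move=> /leq_trans/(_ le1); rewrite addn1 ltnS.
exists (fun x => if x == x0 then y1 else f x); split=> [x xA|y].
  by case: eqVneq => [->//|xn]; apply: fe; rewrite !inE xn.
apply: (@leq_trans ((y == y1) + #|[set x in A :\ x0 | f x == y]|)).
  rewrite (cardsD1 x0) !inE x0A eqxx /= eq_sym leq_add2l.
  apply: subset_leq_card; apply/subsetP => x.
  by rewrite !inE; case: eqVneq.
by have := fb y; rewrite /b'; case: eqVneq => [->|_] /=; lia.
Qed.

End Hall.

(** * Subsets of prescribed size and balancing of class sizes *)

Section Subsets.
Variable V : finType.
Implicit Types (A B L : {set V}).

Lemma subset_of_card A n : n <= #|A| -> exists2 B : {set V}, B \subset A & #|B| = n.
Proof.
move=> /card_geqP[s [us <- sA]]; exists [set x in s].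
  by apply/subsetP => x; rewrite inE => /sA.
by rewrite cardsE; apply/card_uniqP.
Qed.

Lemma superset_of_card A n : #|A| <= n <= #|V| ->
  exists2 B : {set V}, A \subset B & #|B| = n.
Proof.
move=> /andP[An nV]; have [|B BA cB] := @subset_of_card (~: A) (n - #|A|).
  by have := cardsC A; lia.
exists (A :|: B); first exact: subsetUl.
have /disjoint_setI0 AB0 : [disjoint A & B].
  by rewrite disjoint_sym disjoint_subset; apply/subsetP => x /(subsetP BA); rewrite !inE.
by rewrite cardsU AB0 cards0 cB; lia.
Qed.

Lemma disjoint_subsets L N (a : nat -> nat) : \sum_(j < N) a j <= #|L| ->
  exists Lj : nat -> {set V},
    [/\ forall j, j < N -> Lj j \subset L, forall j, j < N -> #|Lj j| = a j &
        forall i j v, i < N -> j < N -> v \in Lj i -> v \in Lj j -> i = j].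
Proof.
elim: N L => [|N IH] L; first by exists (fun=> set0); split.
rewrite big_ord_recr /= => le_aL.
have [|B BL cB] := @subset_of_card L (a N); first by lia.
have [|Lj [LjL cLj dLj]] := IH (L :\: B).
  by rewrite cardsD (setIidPr BL) cB -(leq_add2r (a N)) subnK //; lia.
exists (fun j => if j == N then B else Lj j); split=> [j|j|i j v].
- rewrite ltnS leq_eqVlt; case: eqVneq => // _ /= jN.
  by apply: subset_trans (LjL _ jN) (subsetDl _ _).
- by rewrite ltnS leq_eqVlt; case: eqVneq => [->|_] //= /cLj.
- rewrite !ltnS (leq_eqVlt i) (leq_eqVlt j).
  case: (eqVneq i N) => [->|_]; case: (eqVneq j N) => [->|_] //=.
  + by move=> _ jN vB /(subsetP (LjL _ jN)); rewrite inE vB.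
  + by move=> iN _ /(subsetP (LjL _ iN)); rewrite inE => /andP[/negP].
  + exact: dLj.
Qed.

End Subsets.

Section Balance.
Variables (V : finType) (T d : nat).

Lemma card_set_memE (S : V -> {set 'I_T}) (t : 'I_T) :
  #|[set v | t \in S v]| = \sum_v (t \in S v).
Proof. by rewrite -sum1_card big_mkcond /=; apply: eq_bigr => v _; rewrite inE; case: (t \in S v). Qed.

Lemma sum_card_set_mem (S : V -> {set 'I_T}) :
  \sum_t #|[set v | t \in S v]| = \sum_v #|S v|.
Proof.
under eq_bigr do rewrite card_set_memE.
rewrite exchange_big /=; apply: eq_bigr => v _.
by rewrite -sum1_card [RHS]big_mkcond /=; apply: eq_bigr => t _; case: (t \in S v).
Qed.

End Balance.

(* For every t below the last index, d vertices of L receive a set that contains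
   the last index but not t; trading the last index for t in some of them adjusts
   the size of the t-th class alone.  The last class is settled by the sum. *)
Lemma balance (V : finType) (T d : nat) (S0 : V -> {set 'I_T}) (L : {set V}) :
  (0 < d) -> (forall v, v \in L -> 0 < #|S0 v| < T) -> T.-1 * d <= #|L| ->
  d %| \sum_v #|S0 v| ->
  exists S : V -> {set 'I_T}, [/\ forall v, #|S v| = #|S0 v|,
    forall v, v \notin L -> S v = S0 v & forall t, d %| #|[set v | t \in S v]|].
Proof.
move=> d0; case: T S0 => [|T] S0 LS leL dS; first by exists S0; split=> // -[].
have [|Lj [LjL cLj dLj]] := @disjoint_subsets V L T (fun=> d).
  by rewrite sum_nat_const card_ord.
pose io (j : 'I_T) : 'I_T.+1 := lift ord_max j.
have ioN j : io j != ord_max by rewrite eq_sym neq_lift.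
have /fin_all_exists[B HB] : forall v, exists B : {set 'I_T.+1},
    [/\ #|B| = #|S0 v|, v \notin L -> B = S0 v &
     forall j : 'I_T, v \in Lj j -> ord_max \in B /\ io j \notin B].
  move=> v; case: (pickP (fun j : 'I_T => v \in Lj j)) => [j vj|none]; last first.
    by exists (S0 v); split=> // j; rewrite none.
  have vL : v \in L by apply: (subsetP (LjL j (ltn_ord j))).
  have [|C CS cC] := @subset_of_card _ (~: [set ord_max; io j]) #|S0 v|.-1.
    have := cardsC [set ord_max; io j]; rewrite cards2 card_ord eq_sym ioN.
    by have := LS v vL; lia.
  have mC : ord_max \notin C.
    by apply/negP => /(subsetP CS); rewrite !inE eqxx.
  exists (ord_max |: C); split=> [|/negP//|j' vj'].
    by rewrite cardsU1 mC cC; have := LS v vL; lia.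
  have -> : j' = j by apply: val_inj; apply: (dLj _ _ v) => //; apply: ltn_ord.
  rewrite !inE eqxx (negbTE (ioN j)); split=> //.
  by apply/negP => /(subsetP CS); rewrite !inE eqxx orbT.
(* The number of trades that lifts the size of class j to a multiple of d; it is below d, so [Lj j]
   suffices. *)
pose a (j : 'I_T) := (d - #|[set v | io j \in B v]| %% d) %% d.
have /fin_all_exists[A HA] : forall j : 'I_T, exists A : {set V},
    A \subset Lj j /\ #|A| = a j.
  move=> j; have [|A AL cA] := @subset_of_card _ (Lj j) (a j); last by exists A.
  by rewrite cLj // ltnW // ltn_mod.
have Auniq i j v : v \in A i -> v \in A j -> i = j.
  move=> /(subsetP (HA i).1) vi /(subsetP (HA j).1) vj.
  by apply: val_inj; apply: (dLj _ _ v) => //; apply: ltn_ord.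
pose S v := if [pick j : 'I_T | v \in A j] is Some j
            then io j |: (B v :\ ord_max) else B v.
have SA j v : v \in A j -> S v = io j |: (B v :\ ord_max).
  move=> vj; rewrite /S; case: pickP => [j' vj'|/(_ j)]; last by rewrite vj.
  by rewrite (Auniq _ _ _ vj vj').
have SN v : (forall j, v \notin A j) -> S v = B v.
  by move=> nv; rewrite /S; case: pickP => // j; rewrite (negbTE (nv j)).
have cS v : #|S v| = #|S0 v|.
  have [cB _ HBj] := HB v; rewrite -cB /S; case: pickP => // j vj.
  have [mB jB] := HBj j (subsetP (HA j).1 _ vj).
  rewrite cardsU1 !inE (negbTE jB) andbF /= (cardsD1 ord_max (B v)) mB //.
have dio j : d %| #|[set v | io j \in S v]|.
  have -> : [set v | io j \in S v] = [set v | io j \in B v] :|: A j.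
    apply/setP => v; rewrite !inE.
    have [vj|nvj] := boolP (v \in A j).
      by rewrite (SA _ _ vj) !inE eqxx orbT.
    rewrite orbF; case: (pickP (fun j' => v \in A j')) => [j' vj'|none].
      rewrite (SA _ _ vj') !inE (negbTE (ioN j)) /= (inj_eq lift_inj).
      by case: eqVneq => //= jj'; rewrite jj' vj' in nvj.
    by rewrite SN // => j'; rewrite none.
  rewrite cardsU (_ : _ :&: _ = set0) ?cards0 ?subn0.
    rewrite (HA j).2 /a /dvdn modnDmr -modnDml subnKC ?modnn //.
    by rewrite ltnW // ltn_mod.
  apply/setP => v; rewrite !inE; apply/negP => /andP[jB vj].
  have [_ _ HBj] := HB v.
  by have [_ /negP[]] := HBj j (subsetP (HA j).1 _ vj).
exists S; split=> // [v vL|t].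
  have [_ BS _] := HB v; rewrite SN ?BS // => j; apply: contra vL => vj.
  exact: (subsetP (LjL j (ltn_ord j))) (subsetP (HA j).1 _ vj).
have [j ->|->] := unliftP ord_max t; first exact: dio.
have := dS; rewrite -(eq_bigr _ (fun v _ => cS v)) -sum_card_set_mem big_ord_recr /=.
rewrite dvdn_addr // dvdn_sum // => i _.
have -> : widen_ord (leqnSn T) i = io i; last exact: dio.
by apply: val_inj; rewrite /= /bump leqNgt ltn_ord.
Qed.

(** * Degrees and elementary bounds on the modular chromatic index *)

Section Index.
Variables (V : finType) (k : nat).
Implicit Types (H F : hypergraph V) (P : {set hypergraph V}).

Lemma hdegreeE H v : hdegree H v = \sum_(e in H) (v \in e).
Proof.
rewrite /hdegree -sum1_card big_mkcond [RHS]big_mkcond /=.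
by apply: eq_bigr => e _; rewrite inE; case: (e \in H); case: (v \in e).
Qed.

Lemma hdegree_sum r H : uniform r H -> \sum_v hdegree H v = r * #|H|.
Proof.
move=> /forall_inP uH; under eq_bigr do rewrite hdegreeE.
rewrite exchange_big /= mulnC -sum_nat_const; apply: eq_bigr => e eH.
rewrite -(eqP (uH e eH)) -sum1_card [RHS]big_mkcond /=.
by apply: eq_bigr => v _; case: (v \in e).
Qed.

Lemma hdegree_set0 v : hdegree (set0 : hypergraph V) v = 0.
Proof. by rewrite hdegreeE big_set0. Qed.

Lemma hdegree_eq0 H v : (hdegree H v == 0) = [forall e in H, v \notin e].
Proof.
rewrite cards_eq0; apply/eqP/forall_inP => [H0 e eH|H0].
  by have /setP/(_ e) := H0; rewrite !inE eH /= => ->.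
by apply/setP => e; rewrite !inE; apply/negP => /andP[/H0/negP].
Qed.

Lemma hdegreeU H F v : [disjoint H & F] ->
  hdegree (H :|: F) v = hdegree H v + hdegree F v.
Proof.
by move=> dHF; rewrite !hdegreeE -bigU //=; apply: eq_bigl => e; rewrite !inE.
Qed.

Lemma hdegreeD H F v : F \subset H ->
  hdegree H v = hdegree (H :\: F) v + hdegree F v.
Proof.
move=> FH; rewrite -hdegreeU; first by rewrite setUC -{1}(setIidPr FH) setID.
by rewrite disjoint_subset; apply/subsetP=> e; rewrite !inE => /andP[].
Qed.

Lemma hdegree_sub H F v : F \subset H -> hdegree F v <= hdegree H v.
Proof. by move=> FH; rewrite (hdegreeD v FH) leq_addl. Qed.

Lemma hdegree_partition H P v : partition P H ->
  hdegree H v = \sum_(F in P) hdegree F v.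
Proof.
move=> /and3P[/eqP <- tP _]; rewrite hdegreeE (big_trivIset _ tP) /=.
by apply: eq_bigr => F _; rewrite hdegreeE.
Qed.

(** The classes [F i] may be empty, whereas a partition may not contain [set0]; dropping the empty
    ones can only lower the count. *)
Lemma chromatic_index_le H N (F : nat -> hypergraph V) :
  (forall i, i < N -> F i \subset H) ->
  (forall e, e \in H -> exists2 i, i < N & e \in F i) ->
  (forall i j e, i < N -> j < N -> e \in F i -> e \in F j -> i = j) ->
  (forall i, i < N -> one_mod_hypergraph k (F i)) ->
  mod_chromatic_index k H <= N.
Proof.
move=> FH HF dF oF; pose P := [set F i | i : 'I_N] :\ set0.
have cP : #|P| <= N.
  apply: (@leq_trans #|[set F i | i : 'I_N]|); first exact/subset_leq_card/subsetDl.
  by rewrite -[leqRHS]card_ord; apply: leq_imset_card.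
apply: leq_trans cP; rewrite /mod_chromatic_index; case: ex_minnP => m _; apply.
apply/existsP; exists P; rewrite eqxx andbT; apply/andP; split; last first.
  by apply/forall_inP => _ /setD1P[_ /imsetP[i _ ->]]; apply: oF.
apply/and3P; split; last by rewrite !inE eqxx.
- apply/eqP/setP => e; apply/bigcupP/idP => [[_ /setD1P[_ /imsetP[i _ ->]]]|eH].
    exact: (subsetP (FH i (ltn_ord i))).
  have [i iN ei] := HF e eH; exists (F i) => //; rewrite !inE.
  rewrite (imset_f (fun i : 'I_N => F i) (isT : Ordinal iN \in 'I_N)) andbT.
  by apply/set0Pn; exists e.
- apply/trivIsetP => _ _ /setD1P[_ /imsetP[i _ ->]] /setD1P[_ /imsetP[j _ ->]] nij.
  rewrite disjoint_subset; apply/subsetP => e ei; rewrite !inE.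
  by apply: contra nij => ej; rewrite (dF i j e).
Qed.

Lemma chromatic_index_ge H m :
  (forall P, one_mod_decomposition k H P -> m <= #|P|) ->
  m <= mod_chromatic_index k H.
Proof.
move=> Hm; rewrite /mod_chromatic_index; case: ex_minnP => _ /existsP[P /andP[oP /eqP <-]] _.
exact: Hm.
Qed.

(** Every class that meets v contributes 1 modulo k to its degree, so the number of these classes is
    a positive multiple of k. *)
Lemma chromatic_index_ge_mod H v : 0 < hdegree H v -> k %| hdegree H v ->
  k <= mod_chromatic_index k H.
Proof.
move=> Hv0 kHv; apply: chromatic_index_ge => P /andP[pP /forall_inP oP].
pose Pv := [set F in P | hdegree F v != 0].
have degPv : hdegree H v = \sum_(F in Pv) hdegree F v.
  rewrite (hdegree_partition v pP) (bigID (fun F => hdegree F v != 0)) /=.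
  rewrite [X in _ + X]big1 ?addn0 => [|F /andP[_]]; last by rewrite negbK => /eqP.
  by apply: eq_bigl => F; rewrite inE.
have Pv0 : 0 < #|Pv|.
  rewrite card_gt0; apply: contraTneq Hv0 => Pv0.
  by rewrite degPv Pv0 big_set0.
have : k %| #|Pv|.
  rewrite /dvdn -sum1_card -modn_summ.
  rewrite (eq_bigr (fun F => hdegree F v %% k)); first by rewrite modn_summ -degPv.
  move=> F; rewrite inE => /andP[FP Fv].
  by have /forallP/(_ v) := oP F FP; rewrite (negbTE Fv) => /eqP.
move=> /(dvdn_leq Pv0) kPv; apply: leq_trans kPv _.
by apply/subset_leq_card/subsetP => F; rewrite inE => /andP[].
Qed.

Lemma chromatic_index_ge_uniform r H : uniform r H ->
  ~~ (gcdn k r %| #|V|) -> r.-1 <= #|V| ->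
  (forall J : {set V}, #|J| = r.-1 -> exists2 e, e \in H & J \subset e) ->
  r <= mod_chromatic_index k H.
Proof.
move=> uH ndV leV extH; apply: chromatic_index_ge => P /andP[pP /forall_inP oP].
have [/and3P[/eqP coverP _ _]] := pP.
rewrite leqNgt; apply/negP => ltPr.
(* A class F meeting every vertex would have degree sum [r * #|F|], divisible by d, and also
   congruent to [#|V|] modulo d. *)
have /fin_all_exists[u Hu] : forall F, exists v : V, F \in P -> hdegree F v = 0.
  move=> F; have [FP|_] := boolP (F \in P); last first.
    case: (pickP (fun v : V => true)) => [v _|V0]; first by exists v.
    by case/negP: ndV; rewrite (eq_card V0) card0.
  have [/existsP[v /eqP Fv]|nF] := boolP [exists v, hdegree F v == 0]; first by exists v.
  case/negP: ndV; have uF : uniform r F.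
    apply/forall_inP => e eF; apply: (forall_inP uH).
    by rewrite -coverP; apply/bigcupP; exists F.
  have: gcdn k r %| \sum_v hdegree F v.
    by rewrite (hdegree_sum uF) dvdn_mulr // dvdn_gcdr.
  rewrite /dvdn -modn_summ (eq_bigr (fun=> 1 %% gcdn k r)).
    by rewrite modn_summ sum1_card.
  move=> v _; rewrite -(modn_dvdm _ (dvdn_gcdl k r)).
  have /forallP/(_ v)/orP[Fv|/eqP->] := oP F FP; last by rewrite modn_dvdm // dvdn_gcdl.
  by case/existsP: nF; exists v.
(* The missed vertices, one per class, fit into r - 1 vertices; a hyperedge containing all of them
   can belong to no class. *)
have [|J subJ cJ] := @superset_of_card V (u @: P) r.-1.
  rewrite leV andbT; apply: leq_trans (leq_imset_card _ _) _.
  by case: r ltPr {uH ndV leV extH}.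
have [e eH Je] := extH J cJ.
have [F FP eF] : exists2 F, F \in P & e \in F.
  by move: eH; rewrite -coverP => /bigcupP[F]; exists F.
have /eqP := Hu F FP; rewrite hdegree_eq0 => /forall_inP/(_ e eF)/negP; apply.
by apply: (subsetP Je); apply: (subsetP subJ); apply: imset_f.
Qed.

End Index.

(** By Bezout a is a multiple of r modulo k, which prescribes M modulo k; discarding i < k out of N
    objects reaches this residue. *)
Lemma linear_congruence k r a N : 0 < k -> gcdn k r %| a ->
  exists2 i, i < k & forall M, M + i = N -> r * M = a %[mod k].
Proof.
move=> k0 /dvdnP[q aE].
have [u _ /dvdnP[w ku]] := Bezoutr r k0.
have [y [c1 [c2 ry]]] : exists y c1 c2, c1 * k + r * y = c2 * k + a.
  exists ((k - 1) * (u * q)), (w * q), (q * u * r); rewrite mulnAC -ku aE gcdnC.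
  by case: k k0 {ku aE} => // k _; rewrite subn1 /=; nia.
exists ((N + (k - 1) * y) %% k); first by rewrite ltn_mod.
move=> M MN; rewrite -(modnMDl c2 a) -ry modnMDl -(modnMDl (r * y) (r * M)).
rewrite -(modnMDl (r * ((N + (k - 1) * y) %/ k)) (r * y)).
congr (_ %% _); have := divn_eq (N + (k - 1) * y) k.
move: MN; move: (_ %/ k) (_ %% k) => s i <-.
by case: k k0 {ku aE ry} => // k _; rewrite subn1 /=; nia.
Qed.

(** Take any s cells of a grid with rows indexed by A and q columns; the loads are the row counts,
    at most q. *)
Lemma balanced_loads (T : finType) (A : {set T}) s : 0 < #|A| ->
  exists t : T -> nat, \sum_(x in A) t x = s /\ forall x, t x <= s %/ #|A| + 1.
Proof.
move=> A0; set q := s %/ #|A| + 1.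
pose D := [set z : T * 'I_q | z.1 \in A].
have cD : #|D| = #|A| * q.
  rewrite -[q in RHS]card_ord -cardsT -cardsX; apply: eq_card => z.
  by rewrite !inE andbT.
have [|J JD cJ] := @subset_of_card _ D s.
  by rewrite cD mulnDr muln1 mulnC {1}(divn_eq s #|A|) leq_add2l ltnW // ltn_mod.
exists (fun x => #|[set j : 'I_q | (x, j) \in J]|); split=> [|x]; last first.
  by rewrite -[leqRHS](card_ord q) max_card.
under eq_bigr do rewrite -sum1_card.
rewrite pair_big_dep /= sum1_card -cJ; apply: eq_card => -[x j].
rewrite unfold_in /= inE andb_idl // => /(subsetP JD).
by rewrite inE.
Qed.

(** * Counting hyperedges formed by a vertex and a group *)

Section Pairs.
Variables (V : finType).
Implicit Types (S : {set V}) (T : {set {set V}}) (F : hypergraph V).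

Definition pairs F S T : nat :=
  #|[set q : V * {set V} | [&& q.1 \in S, q.2 \in T & q.1 |: q.2 \in F]]|.

Lemma pairs_suml F S T :
  pairs F S T = \sum_(x in S) #|[set g in T | x |: g \in F]|.
Proof.
under eq_bigr do rewrite -sum1_card.
rewrite pair_big_dep sum1_card; apply: eq_card => -[x g].
by rewrite [RHS]unfold_in /= !inE.
Qed.

Lemma pairs_sumr F S T :
  pairs F S T = \sum_(g in T) #|[set x in S | x |: g \in F]|.
Proof.
under eq_bigr do rewrite -sum1_card.
rewrite pairs_suml; under eq_bigr do rewrite -sum1_card.
under eq_bigr => x _ do under eq_bigl => g do rewrite inE.
under [RHS]eq_bigr => x _ do under eq_bigl => g do rewrite inE.
rewrite (exchange_big_dep (mem T)) /=; last by move=> x g _ /andP[].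
by apply: eq_bigr => g gT; apply: eq_bigl => x; rewrite gT.
Qed.

Lemma setU1_injl x (g g' : {set V}) : x \notin g -> x \notin g' ->
  x |: g = x |: g' -> g = g'.
Proof. by move=> xg xg' eg; rewrite -(setU1K xg) eg setU1K. Qed.

Lemma setU1_injr x x' (g : {set V}) : x \notin g -> x' \notin g ->
  x |: g = x' |: g -> x = x'.
Proof.
move=> xg xg' /setP/(_ x); rewrite !inE eqxx /= (negbTE xg) orbF.
by move=> /esym/eqP.
Qed.

Lemma card_links_le F x T : x \notin cover T ->
  #|[set g in T | x |: g \in F]| <= hdegree F x.
Proof.
move=> xT; have xg g : g \in T -> x \notin g.
  by move=> gT; apply: contra xT => xg; apply/bigcupP; exists g.
rewrite -(card_in_imset (f := fun g => x |: g)).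
  apply/subset_leq_card/subsetP => _ /imsetP[g + ->].
  by rewrite !inE eqxx => /andP[_ ->].
move=> g g'; rewrite !inE => /andP[gT _] /andP[g'T _].
by apply: setU1_injl; apply: xg.
Qed.

Lemma card_colinks_le F (g : {set V}) v S : v \in g -> [disjoint S & g] ->
  #|[set x in S | x |: g \in F]| <= hdegree F v.
Proof.
move=> vg dSg; have xg x : x \in S -> x \notin g by move=> xS; rewrite (disjointFr dSg xS).
rewrite -(card_in_imset (f := fun x => x |: g)).
  apply/subset_leq_card/subsetP => _ /imsetP[x + ->].
  by rewrite !inE vg orbT => /andP[_ ->].
move=> x x'; rewrite !inE => /andP[xS _] /andP[x'S _].
by apply: setU1_injr; apply: xg.
Qed.

Lemma card_cover_uniform (G : {set {set V}}) c : trivIset G ->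
  (forall g, g \in G -> #|g| = c) -> #|cover G| = #|G| * c.
Proof.
move=> tG Gc; rewrite -(eqP tG) -sum_nat_const; exact: eq_bigr.
Qed.

End Pairs.

(** * Rounds *)

Section Round.
Variables (R : realFieldType) (V : finType) (k r m Q K : nat).
Variables (H : hypergraph V) (GG : {set {set V}}) (p lam eta gam : R).
Hypotheses (k_gt1 : 1 < k) (r_gt1 : 1 < r).
Hypotheses (tGG : trivIset GG) (cGG : forall g, g \in GG -> #|g| = r.-1).

Local Open Scope ring_scope.

Hypothesis pairs_ub : forall (S : {set V}) (T : {set {set V}}),
  T \subset GG -> [disjoint S & cover T] ->
  (pairs H S T)%:R <= 3 * p * #|S|%:R * #|T|%:R + 3 * (#|S|%:R + #|T|%:R) * lam.
Hypothesis pairs_lb : forall (S : {set V}) (T : {set {set V}}),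
  T \subset GG -> [disjoint S & cover T] ->
  p * #|S|%:R * #|T|%:R / 2 - 3 * #|V|%:R <= (pairs H S T)%:R.

Hypotheses (p_gt0 : 0 < p) (m_gt0 : (0 < m)%N) (lam_ge0 : 0 <= lam)
  (eta_gt0 : 0 < eta) (eta_le1 : eta <= 1) (gam_ge0 : 0 <= gam).
Hypothesis (V_le : #|V|%:R <= gam * m%:R).
Hypothesis (K_ge : 6 * gam / eta + k%:R + 1 <= K%:R).
Hypothesis (pm_ge1 : k%:R + Q%:R + 6 * lam < eta * p * m%:R / 2).
Hypothesis (pm_ge2 : Q%:R + 36 * (Q%:R + 3) * gam / eta * K%:R
                       + 3 * (K%:R + 1) * lam < 8 * p * m%:R).

Variables (U0 : hypergraph V) (V' : {set V}) (G : {set {set V}}).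
Hypotheses (GGG : G \subset GG) (cG : (#|G| <= m)%N) (GV' : cover G \subset V').
Hypothesis (dV' : (gcdn k r %| #|V'|)%N).
Hypothesis (U0_deg : forall v, (hdegree U0 v <= Q)%N).
Hypothesis links_ge : forall x,
  eta * p * m%:R <= #|[set g in G | (x \notin g) && (x |: g \in H)]|%:R.
Hypothesis colinks_ge : forall g, g \in G ->
  8 * p * m%:R <= #|[set x in V' :\: cover G | x |: g \in H]|%:R.

(** The remainder X of V' is mapped to groups: x in X gets degree 1 and the vertices of g get its
    load, so all is right once loads of the form [1 + k * t g] add up to [#|X|]. [U0] collects the
    hyperedges already spent, of degree at most Q; the cap K on the loads keeps this round cheap for
    later ones. *)
Lemma round (x0 : V) : exists M : hypergraph V,
  [/\ M \subset H :\: U0, forall v, v \in V' -> hdegree M v = 1 %[mod k],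
      forall v, v \notin V' -> hdegree M v = 0%N,
      forall v, (hdegree M v <= K)%N &
      forall e, e \in M -> exists x, e \subset x |: cover GG].
Proof.
have [pm1 pm2 lam0 p0 eta0] := And5 pm_ge1 pm_ge2 lam_ge0 p_gt0 eta_gt0.
have k_gt0 : (0 < k)%N by apply: ltnW.
have pm_gt0 : 0 < p * m%:R by rewrite mulr_gt0 // ltr0n.
have epm : eta * p * m%:R <= p * m%:R.
  by rewrite -mulrA ler_piMl // ltW.
have kG : (k <= #|G|)%N.
  rewrite -(ler_nat R); have := links_ge x0.
  have : (#|[set g in G | (x0 \notin g) && (x0 |: g \in H)]| <= #|G|)%N.
    by apply/subset_leq_card/subsetP => g; rewrite inE => /andP[].
  rewrite -(ler_nat R); have : 0 <= Q%:R :> R by rewrite ler0n.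
  have := ler0n R k; move: pm_ge1 lam_ge0; lra.
(* The loads are 1 modulo k, so [#|X|] must be congruent to [#|G'|]; as
   [#|X| = #|V'| - #|G'| * r.-1], this says that [r * #|G'|] is congruent to [#|V'|]. Fewer than k
   groups are dropped to achieve it. *)
have [i ik Hi] := linear_congruence #|G| k_gt0 dV'.
have [|G' G'G cG'] := @subset_of_card _ G (#|G| - i); first by rewrite leq_subr.
have {Hi} G'mod : (r * #|G'| = #|V'| %[mod k])%N.
  by apply: Hi; rewrite cG' subnK // (leq_trans (ltnW ik)).
have G'GG : G' \subset GG := subset_trans G'G GGG.
have tG' : trivIset G' by apply: trivIsetS tGG.
have G'V' : cover G' \subset V'.
  apply: subset_trans GV'; apply/subsetP => v /bigcupP[g gG' vg].
  by apply/bigcupP; exists g => //; apply: (subsetP G'G).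
have G'G_card : (#|G :\: G'| <= k)%N.
  by rewrite cardsD (setIidPr G'G) cG' subKn ?(leq_trans (ltnW ik)) // ltnW.
set X := V' :\: cover G'.
have cV' : (#|V'| = #|X| + #|G'| * r.-1)%N.
  rewrite -(@card_cover_uniform _ G' r.-1) //.
    by rewrite cardsD (setIidPr G'V') subnK // subset_leq_card.
  by move=> g /(subsetP G'GG); apply: cGG.
have XG' (T : {set {set V}}) : T \subset G' -> [disjoint X & cover T].
  move=> TG'; rewrite disjoint_subset; apply/subsetP => v.
  rewrite !inE => /andP[vG' _]; apply: contra vG' => /bigcupP[g gT vg].
  by apply/bigcupP; exists g => //; apply: (subsetP TG').
have XnG' x : x \in X -> x \notin cover G' by rewrite inE => /andP[].
pose rel (x : V) (g : {set V}) := (g \in G') && (x |: g \in H :\: U0).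
have degX x : x \in X ->
    eta * p * m%:R - k%:R - Q%:R <= #|[set g in G' | rel x g]|%:R.
  move=> xX; have := links_ge x.
  have : (#|[set g in G | (x \notin g) && (x |: g \in H)]| <=
          #|[set g in G' | rel x g]| + k + Q)%N.
    have xU0 := leq_trans (card_links_le U0 (XnG' x xX)) (U0_deg x).
    apply: leq_trans (leq_add (leq_add (leqnn _) G'G_card) xU0).
    apply: leq_trans (leq_add (leq_card_setU _ _).1 (leqnn _)).
    apply: leq_trans (leq_card_setU _ _).1.
    apply/subset_leq_card/subsetP => g; rewrite !inE /rel !inE => /and3P[-> _ ->].
    by case: (g \in G') => //=; rewrite andbT; case: (_ \in U0).
  by rewrite -(ler_nat R) !natrD; nra.
have degG g : g \in G' -> 8 * p * m%:R - Q%:R <= #|[set x in X | rel x g]|%:R.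
  move=> gG'; have := colinks_ge (subsetP G'G _ gG').
  have : (#|[set x in V' :\: cover G | x |: g \in H]| <=
          #|[set x in X | rel x g]| + Q)%N.
    have [v vg] : exists v, v \in g.
      by apply/set0Pn; rewrite -card_gt0 cGG ?(subsetP G'GG) // -subn1 subn_gt0.
    have Xg : [disjoint X & g].
      rewrite disjoint_subset; apply/subsetP => x /XnG'; apply: contra => xg.
      by apply/bigcupP; exists g.
    have xU0 := leq_trans (card_colinks_le U0 vg Xg) (U0_deg v).
    apply: leq_trans (leq_add (leqnn _) xU0).
    apply: leq_trans (leq_card_setU _ _).1.
    apply/subset_leq_card/subsetP => x; rewrite !inE /rel !inE gG' /=.
    move=> /andP[/andP[xG ->] ->]; rewrite andbT.
    have -> : x \notin cover G'.
      apply: contra xG => /bigcupP[g' g'G' xg']; apply/bigcupP; exists g' => //.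
      exact: (subsetP G'G).
    by case: (_ \in U0).
  by rewrite -(ler_nat R) natrD; nra.
have G'_gt0 : (0 < #|G'|)%N by rewrite cG' subn_gt0 (leq_trans ik).
have G'm : #|G'|%:R <= m%:R :> R.
  by rewrite ler_nat (leq_trans _ cG) // subset_leq_card.
have pairs_geS (S : {set V}) (T : {set {set V}}) (D : R) : (forall x, x \in S ->
    D <= #|[set g in T | x |: g \in H]|%:R) -> #|S|%:R * D <= (pairs H S T)%:R.
  by move=> SD; rewrite pairs_suml natr_sum mulr_natl -sumr_const ler_sum.
have pairs_geT (S : {set V}) (T : {set {set V}}) (D : R) : (forall g, g \in T ->
    D <= #|[set x in S | x |: g \in H]|%:R) -> #|T|%:R * D <= (pairs H S T)%:R.
  by move=> TD; rewrite pairs_sumr natr_sum mulr_natl -sumr_const ler_sum.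
(* Otherwise X and G' have at most m elements each, and the upper bound leaves a group about 3 p m
   links on average, against the 8 p m it has. *)
have le_G'X : (#|G'| <= #|X|)%N.
  rewrite leqNgt; apply/negP => ltXG'.
  have lo : #|G'|%:R * (8 * p * m%:R - Q%:R) <= (pairs H X G')%:R.
    apply: pairs_geT => g gG'; apply: le_trans (degG g gG') _.
    rewrite ler_nat; apply/subset_leq_card/subsetP => x.
    by rewrite !inE /rel !inE => /and4P[-> _ _ ->].
  have := le_trans lo (pairs_ub G'GG (XG' _ (subxx _))).
  have t0 : 0 < #|G'|%:R :> R by rewrite ltr0n.
  have st : #|X|%:R <= #|G'|%:R :> R by rewrite ler_nat ltnW.
  have : p * #|X|%:R * #|G'|%:R <= p * m%:R * #|G'|%:R.
    by rewrite ler_wpM2r ?ler_wpM2l ?(ltW t0) ?(ltW p_gt0) // (le_trans st).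
  have : #|X|%:R * lam <= #|G'|%:R * lam by rewrite ler_wpM2r.
  have : 0 < #|G'|%:R * (8 * p * m%:R - Q%:R - 3 * (p * m%:R) - 6 * lam).
    by rewrite mulr_gt0 //; have := ler0n R k; lra.
  nra.
(* A set N no larger than S that absorbs all neighbours of S has linear size: below eta m / 6, the
   upper bound allows a vertex of S on average only eta p m / 2 + 6 lam links into N. *)
have N_ge (S : {set V}) (N : {set {set V}}) :
    S \subset X -> (0 < #|S|)%N -> N \subset G' -> (#|N| <= #|S|)%N ->
    (forall x g, x \in S -> rel x g -> g \in N) -> eta * m%:R / 6 <= #|N|%:R.
  move=> SX S0 NG' NS SN.
  have lo : #|S|%:R * (eta * p * m%:R - k%:R - Q%:R) <= (pairs H S N)%:R.
    apply: pairs_geS => x xS; apply: le_trans (degX x (subsetP SX _ xS)) _.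
    rewrite ler_nat; apply/subset_leq_card/subsetP => g.
    rewrite !inE => /andP[_ xg]; rewrite (SN x) //.
    by move: xg; rewrite /rel !inE => /and3P[].
  have dSN : [disjoint S & cover N] := disjointWl SX (XG' _ NG').
  have := le_trans lo (pairs_ub (subset_trans NG' G'GG) dSN).
  have s0 : 0 < #|S|%:R :> R by rewrite ltr0n.
  have : #|N|%:R * lam <= #|S|%:R * lam by rewrite ler_wpM2r // ler_nat.
  move=> h1 h2; rewrite leNgt; apply/negP => Nlt.
  have : 0 < p * (eta * m%:R / 6 - #|N|%:R) by rewrite mulr_gt0 // subr_gt0.
  move=> pN.
  have : 0 < #|S|%:R * (eta * p * m%:R - k%:R - Q%:R - 3 * (p * #|N|%:R) - 6 * lam).
    by rewrite mulr_gt0 //; lra.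
  nra.
have X_gt0 := leq_trans G'_gt0 le_G'X.
have G'_ge : eta * m%:R / 6 <= #|G'|%:R.
  by apply: (N_ge X) => // x g _ /andP[].
have [tau Xtau] : exists tau, (#|X| = #|G'| + k * tau)%N.
  have : (k %| #|X| - #|G'|)%N.
    rewrite -eqn_mod_dvd // -(eqn_modDr (#|G'| * r.-1)) -cV' -G'mod.
    by rewrite -mulnS prednK 1?ltnW // mulnC.
  by move=> /dvdnP[tau Et]; exists tau; rewrite mulnC -Et subnKC.
have [t [sum_t t_le]] := balanced_loads tau G'_gt0.
pose b g := if g \in G' then (1 + k * t g)%N else 0%N.
have sum_b : (\sum_(g in G') b g = #|X|)%N.
  rewrite (eq_bigr (fun g => 1 + k * t g)%N); last by move=> g; rewrite /b => ->.
  by rewrite big_split /= sum1_card -big_distrr /= sum_t Xtau.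
(* The average load is at most [#|V|] over [#|G'|], hence at most 6 gam / eta; rounding to the form
   [1 + k * t g] costs at most k + 1. *)
have b_le g : (b g <= K)%N.
  rewrite /b; case: ifP => // _; rewrite -(ler_nat R); apply: le_trans K_ge.
  have : (k * (tau %/ #|G'|) * #|G'| <= #|V|)%N.
    apply: leq_trans (max_card X); rewrite Xtau -mulnA.
    by rewrite (leq_trans _ (leq_addl _ _)) // leq_mul2l leq_trunc_div orbT.
  rewrite -(ler_nat R) natrM => le1.
  have le2 : (k * (tau %/ #|G'|))%:R <= 6 * gam / eta.
    have em : 0 < eta * m%:R / 6 by rewrite !mulr_gt0 ?invr_gt0 ?ltr0n.
    rewrite -(ler_pM2r em); apply: le_trans (_ : gam * m%:R <= _).
      by apply: le_trans (le_trans le1 V_le); rewrite ler_wpM2l.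
    by rewrite le_eqVlt; apply/orP; left; apply/eqP; field; rewrite gt_eqF.
  have : (1 + k * t g <= k * (tau %/ #|G'|) + k + 1)%N.
    by rewrite addnC leq_add2r -mulnSr leq_mul2l -addn1 t_le orbT.
  by rewrite -(ler_nat R) => /le_trans; apply; rewrite !natrD; lra.
(* Hall's condition for S.  If S had fewer than #|S| neighbours, the upper bound
   on pairs would make S of linear size; the lower bound then leaves at most
   O(1 / p) groups T without a neighbour in S, and again by the upper bound those
   groups have more than their total load of neighbours outside S. *)
have [|f [f_rel f_load]] := hall_load (e := rel) set0 (A := X) (b := b).
  move=> S SX; move EN : (nbr _ _) => N; rewrite leqNgt; apply/negP => ltNS.
  have NG' : N \subset G'.
    by apply/subsetP => g; rewrite -EN inE => /exists_inP[x _ /andP[]].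
  have SN x g : x \in S -> rel x g -> g \in N.
    by move=> xS xg; rewrite -EN inE; apply/exists_inP; exists x.
  have leNb : (#|N| <= \sum_(g in N) b g)%N.
    by rewrite -sum1_card; apply: leq_sum => g /(subsetP NG'); rewrite /b => ->.
  have N_S := leq_ltn_trans leNb ltNS.
  have S0 : (0 < #|S|)%N by apply: leq_ltn_trans N_S.
  have Nge := N_ge S N SX S0 NG' (ltnW N_S) SN.
  set T := G' :\: N; set Y := X :\: S.
  have TG' : T \subset G' := subsetDl _ _.
  have YT : (#|Y| < K * #|T|)%N.
    have : (\sum_(g in T) b g <= K * #|T|)%N.
      by rewrite mulnC -sum_nat_const leq_sum.
    move: sum_b; rewrite (big_setID N) /= (setIidPr NG') -/T => sb.
    have cY : #|Y| = (#|X| - #|S|)%N by rewrite cardsD (setIidPr SX).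
    move: (subset_leq_card SX) sb cY ltNS; clear.
    by move: (\sum_(g in N) b g)%N (\sum_(g in T) b g)%N => sN sT; lia.
  have T0 : 0 < #|T|%:R :> R.
    by rewrite ltr0n lt0n; apply: contraTneq YT => ->; rewrite muln0.
  have TGG := subset_trans TG' G'GG.
  (* Groups outside N have no available link to S, so every hyperedge counted here was spent in
     [U0]. *)
  have hi1 : (pairs H S T <= Q * #|S|)%N.
    rewrite pairs_suml mulnC -sum_nat_const; apply: leq_sum => x xS.
    have xT : x \notin cover T.
      by rewrite (disjointFr (XG' T TG')) ?(subsetP SX).
    apply: leq_trans (leq_trans (card_links_le U0 xT) (U0_deg x)).
    apply/subset_leq_card/subsetP => g; rewrite !inE => /andP[/andP[gN gG'] xg].
    rewrite gG' gN /=; apply: contraR gN => xgU; apply: (SN x g xS).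
    by rewrite /rel gG' inE xgU.
  have lo1 := pairs_lb TGG (disjointWl SX (XG' T TG')).
  have pT : p * #|T|%:R <= 12 * (Q%:R + 3) * gam / eta.
    have em : 0 < eta * m%:R / 6 by rewrite !mulr_gt0 ?invr_gt0 ?ltr0n.
    have SV : #|S|%:R <= #|V|%:R :> R by rewrite ler_nat max_card.
    have : (pairs H S T)%:R <= Q%:R * #|V|%:R :> R.
      apply: le_trans (_ : Q%:R * #|S|%:R <= _); first by rewrite -natrM ler_nat.
      by rewrite ler_wpM2l.
    move=> hi; have := le_trans lo1 hi => pST.
    rewrite -(ler_pM2r em); apply: le_trans (_ : 2 * (Q%:R + 3) * #|V|%:R <= _).
      apply: le_trans (_ : p * #|T|%:R * #|S|%:R <= _); last by lra.
      rewrite ler_wpM2l ?mulr_ge0 ?(ltW p_gt0) //.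
      by apply: le_trans Nge _; rewrite ler_nat ltnW.
    apply: le_trans (_ : 2 * (Q%:R + 3) * (gam * m%:R) <= _).
      by rewrite ler_wpM2l // mulr_ge0 // addr_ge0.
    by rewrite le_eqVlt; apply/orP; left; apply/eqP; field; rewrite gt_eqF.
  have lo2 : #|T|%:R * (8 * p * m%:R - Q%:R) <= (pairs H Y T)%:R.
    apply: pairs_geT => g gT; have gG' := subsetP TG' _ gT.
    apply: le_trans (degG g gG') _; rewrite ler_nat.
    apply/subset_leq_card/subsetP => x; rewrite inE => /andP[xX xg].
    have -> : x \in [set x in Y | x |: g \in H] = (x \notin S) && (x |: g \in H).
      by rewrite in_set in_setD xX andbT.
    have -> : x |: g \in H by move: xg; rewrite /rel !inE => /and3P[].
    rewrite andbT; apply/negP => xS; have := SN x g xS xg.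
    by move: gT; rewrite inE => /andP[/negP].
  have dYT : [disjoint Y & cover T] := disjointWl (subsetDl _ _) (XG' T TG').
  have := le_trans lo2 (pairs_ub TGG dYT).
  have YTR : #|Y|%:R <= K%:R * #|T|%:R :> R by rewrite -natrM ler_nat ltnW.
  have e1 : p * #|Y|%:R * #|T|%:R <= K%:R * (12 * (Q%:R + 3) * gam / eta) * #|T|%:R.
    rewrite ler_wpM2r ?(ltW T0) //.
    apply: le_trans (_ : p * (K%:R * #|T|%:R) <= _); first by rewrite ler_wpM2l // ltW.
    by rewrite mulrCA ler_wpM2l.
  have e2 : #|Y|%:R * lam <= K%:R * #|T|%:R * lam by rewrite ler_wpM2r.
  have : 0 < #|T|%:R * (8 * p * m%:R - Q%:R - 3 * (K%:R * (12 * (Q%:R + 3) * gam / eta))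
              - 3 * (K%:R + 1) * lam).
    by rewrite mulr_gt0 //; move: pm_ge2; lra.
  move: e1 e2; set c := 12 * _ * _ / _; nra.
have fG' x : x \in X -> f x \in G' by move=> /f_rel/andP[].
have f_notin x x' : x \in X -> x' \in X -> x \notin f x'.
  move=> xX /fG' fx'; apply: contra (XnG' x xX) => xf.
  by apply/bigcupP; exists (f x').
(* Actual loads and caps have the same sum [#|X|], so every cap is attained. *)
have load g : g \in G' -> #|[set x in X | f x == g]| = b g.
  have sum_f : (\sum_(g in G') #|[set x in X | f x == g]| = #|X|)%N.
    rewrite -[RHS]sum1_card (partition_big f (mem G')) //=.
    by apply: eq_bigr => h _; rewrite -sum1_card; apply: eq_bigl => x; rewrite inE.
  have /leqif_sum[_] : forall g, g \in G' -> (#|[set x in X | f x == g]| <= b g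
      ?= iff (#|[set x in X | f x == g]| == b g))%N.
    by move=> h _; apply: leqif_eq.
  by rewrite sum_f sum_b eqxx => /esym/forall_inP eqb /eqb/eqP.
have degM1 v : v \in X -> hdegree [set x |: f x | x in X] v = 1%N.
  move=> vX; rewrite /hdegree (_ : [set e in _ | _] = [set v |: f v]) ?cards1 //.
  apply/setP => e; rewrite !inE; apply/andP/eqP => [[/imsetP[x xX ->]]|->].
    rewrite !inE (negbTE (f_notin v x vX xX)) orbF.
    by move=> /eqP ->.
  by split; [apply: imset_f | rewrite !inE eqxx].
have degM2 v : v \in cover G' ->
    exists2 g, g \in G' & hdegree [set x |: f x | x in X] v = b g.
  move=> vcG'; have [g gG' vg] := bigcupP vcG'; exists g => //.
  rewrite -(load g gG') -(card_in_imset (f := fun x => x |: g)); last first.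
    move=> x x'; rewrite !inE => /andP[xX /eqP fx] /andP[x'X /eqP fx'].
    by apply: setU1_injr; [rewrite -fx|rewrite -fx']; apply: f_notin; rewrite inE.
  apply: eq_card => e; rewrite inE; apply/andP/imsetP => [[/imsetP[x xX ->]]|].
    rewrite !inE => /orP[/eqP vx|vfx].
      by have := XnG' x xX; rewrite -vx vcG'.
    have -> : g = f x.
      apply/eqP/negPn/negP => ngf.
      have := trivIsetP tG' _ _ gG' (fG' x xX) ngf.
      by move=> /disjointFr/(_ vg); rewrite vfx.
    by exists x => //; rewrite inE xX eqxx.
  move=> [x]; rewrite inE => /andP[xX /eqP fx] ->; split; last by rewrite !inE vg orbT.
  by apply/imsetP; exists x; rewrite ?fx.
have inV' v : v \in V' -> v \notin cover G' -> v \in X by rewrite inE => -> ->.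
exists [set x |: f x | x in X]; split.
- by apply/subsetP => _ /imsetP[x /f_rel/andP[_ ?] ->].
- move=> v vV'; have [/degM2[g gG' ->]|/(inV' v vV')/degM1 -> //] := boolP (v \in cover G').
  by rewrite /b gG' addnC mulnC modnMDl.
- move=> v nvV'; apply/eqP; rewrite hdegree_eq0; apply/forall_inP => _ /imsetP[x xX ->].
  rewrite !inE negb_or; apply/andP; split.
    by apply: contra nvV' => /eqP ->; move: xX; rewrite inE => /andP[].
  apply: contra nvV' => vfx; apply: (subsetP G'V').
  by apply/bigcupP; exists (f x) => //; apply: fG'.
- move=> v; have [/degM2[g _ ->]|nvG'] := boolP (v \in cover G'); first exact: b_le.
  have [vX|nvX] := boolP (v \in X).
    rewrite degM1 // -(ler_nat R); apply: le_trans K_ge.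
    by rewrite lerDr addr_ge0 // divr_ge0 ?(ltW eta0) // mulr_ge0.
  rewrite (_ : hdegree _ v = 0%N) //; apply/eqP; rewrite hdegree_eq0.
  apply/forall_inP => _ /imsetP[x xX ->]; rewrite !inE negb_or.
  rewrite (contraNneq _ nvX) => [|->//]; apply: contra nvG' => vfx.
  by apply/bigcupP; exists (f x) => //; apply: fG'.
- move=> _ /imsetP[x xX ->]; exists x; apply: setUS.
  by apply: bigcup_sup; rewrite (subsetP G'GG) // fG'.
Qed.

End Round.

(** * Deterministic bounds on the index *)

Section Unions.
Variable V : finType.
Implicit Types (H F : hypergraph V).

Definition hunion (M : nat -> hypergraph V) T : hypergraph V := \bigcup_(i < T) M i.

Lemma hunionP (M : nat -> hypergraph V) T e :
  reflect (exists2 i, i < T & e \in M i) (e \in hunion M T).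
Proof.
apply: (iffP bigcupP) => [[i _ ei]|[i iT ei]]; first by exists i.
by exists (Ordinal iT).
Qed.

Lemma hunionS (M : nat -> hypergraph V) T : hunion M T.+1 = hunion M T :|: M T.
Proof. by rewrite /hunion big_ord_recr. Qed.

Lemma hdegree_hunion (M : nat -> hypergraph V) T v :
  (forall i j e, i < T -> j < T -> e \in M i -> e \in M j -> i = j) ->
  hdegree (hunion M T) v = \sum_(i < T) hdegree (M i) v.
Proof.
elim: T => [|T IH] dM; first by rewrite /hunion !big_ord0 hdegree_set0.
rewrite hunionS big_ord_recr hdegreeU /= ?IH // => [i j e iT jT|].
  by apply: dM; apply: ltnW.
rewrite disjoint_subset; apply/subsetP => e /hunionP[i iT ei]; rewrite !inE.
by apply/negP => /(dM i T e (ltnW iT) (ltnSn T) ei) iT'; rewrite iT' ltnn in iT.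
Qed.

Lemma hdegreeU_le H F v : hdegree (H :|: F) v <= hdegree H v + hdegree F v.
Proof.
apply: leq_trans (leq_card_setU _ _).1; apply/subset_leq_card/subsetP => e.
by rewrite !inE andb_orl.
Qed.

Lemma hdegree_hunion_le (M : nat -> hypergraph V) T c v :
  (forall i, i < T -> hdegree (M i) v <= c) -> hdegree (hunion M T) v <= T * c.
Proof.
elim: T => [|T IH] Mc; first by rewrite /hunion big_ord0 hdegree_set0.
rewrite hunionS (leq_trans (hdegreeU_le _ _ _)) // mulSnr leq_add ?Mc //.
by apply: IH => i iT; apply: Mc; apply: ltnW.
Qed.

End Unions.

Section Modular.
Variable k : nat.
Hypothesis k_gt1 : 1 < k.

(** Differences of degrees are computed in the ring ['Z_k], which represents the integers modulo k
    only for k > 1. *)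
Lemma eqmodZ a b : a = b %[mod k] <-> (a%:R = b%:R :> 'Z_k)%R.
Proof.
split=> [ab|/(congr1 val)]; last by rewrite /= !val_Zp_nat.
by apply: val_inj; rewrite /= !val_Zp_nat.
Qed.

Lemma natZ0 : (k%:R = 0 :> 'Z_k)%R.
Proof. by apply/(eqmodZ k 0); rewrite modnn mod0n. Qed.

Lemma natZ_pred : ((k - 1)%:R = -1 :> 'Z_k)%R.
Proof. by rewrite natrB ?natZ0 ?sub0r // ltnW. Qed.

Lemma eqmod_sum (I : finType) d (f g : I -> nat) : d %| k ->
  (forall i, f i = g i %[mod k]) -> (d %| \sum_i f i) = (d %| \sum_i g i).
Proof.
move=> dk fg; rewrite /dvdn -modn_summ -[in RHS]modn_summ.
by under eq_bigr => i _ do rewrite -(modn_dvdm _ dk) fg modn_dvdm //.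
Qed.

End Modular.

(** [must v] lists the rounds that have to contain v, and [c v] is the number of rounds v joins.
    Only the vertices of L, which have no obligation, are moved to make all sizes divisible by d. *)
Lemma assign_rounds (V : finType) (T d : nat) (c : V -> nat)
    (must : V -> {set 'I_T}) (L : {set V}) :
  0 < d -> (forall v, #|must v| <= c v <= T) ->
  (forall v, v \in L -> 0 < c v < T /\ must v = set0) -> T.-1 * d <= #|L| ->
  d %| \sum_v c v ->
  exists S : V -> {set 'I_T}, [/\ forall v, #|S v| = c v,
    forall v, must v \subset S v & forall t, d %| #|[set v | t \in S v]|].
Proof.
move=> d0 mc Lc cL dc.
have /fin_all_exists[S0 S0P] : forall v, exists S : {set 'I_T},
    must v \subset S /\ #|S| = c v.
  move=> v; have [|S mS cS] := @superset_of_card _ (must v) (c v).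
    by rewrite card_ord mc.
  by exists S.
have cS0 v : #|S0 v| = c v by case: (S0P v).
have [v /Lc[]|||S [cS SL dS]] := @balance V T d S0 L d0.
- by rewrite cS0.
- exact: cL.
- by under eq_bigr => v _ do rewrite cS0.
exists S; split=> // [v|v]; first by rewrite cS.
have [vL|/SL->] := boolP (v \in L); first by rewrite (Lc v vL).2 sub0set.
by case: (S0P v).
Qed.

(** Degrees being natural numbers, [(k - 1) * a] plays the role of minus a modulo k, here and in all
    degree corrections. *)
Lemma addn_pred_mod k a b : 0 < k -> a + (b + (k - 1) * a) = b %[mod k].
Proof.
case: k => // k _; rewrite subn1 /= addnCA -mulSn addnC.
by rewrite mulnC modnMDl.
Qed.

Lemma sum_ord_split2 n (F : nat -> nat) : 0 < n ->
  \sum_(j < n.+1) F j = F 0 + (F 1 + \sum_(j < n - 1) F j.+2).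
Proof. by case: n => // n _; rewrite !big_ord_recl subn1. Qed.

(** * Layout of the vertex set and pseudorandomness *)

Section Layout.
Variables (V : finType) (k r m L : nat).
Variables (G : nat -> {set {set V}}) (B : nat -> {set V}) (R0 : {set V}).

Definition groups : {set {set V}} := \bigcup_(t < k.+2) G t.
Definition part t : {set V} := cover (G t) :|: B t.

(* A part t consists of groups G t, of size r - 1, and of vertices B t meant to be
   matched to them.  There are k + 2 parts: one for each of up to k + 1 rounds and
   a spare one of flexible vertices; R0 is the reservoir of randomness. *)
Record layout : Prop := Layout {
  layout_triv : trivIset groups;
  layout_size : forall g, g \in groups -> #|g| = r.-1;
  layout_cardG : forall t, t < k.+2 -> #|G t| = m;
  layout_cardB : forall t, t < k.+2 -> #|B t| = m * L;
  layout_BG : forall t, t < k.+2 -> [disjoint B t & cover groups];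
  layout_part : forall t t' v, t < k.+2 -> t' < k.+2 ->
    v \in part t -> v \in part t' -> t = t';
  layout_rest : forall t, t < k.+2 -> [disjoint R0 & part t] }.

Definition residue (H : hypergraph V) rho : {set V} :=
  [set v | hdegree H v == rho %[mod k]].

(** The first two fields give Hall's condition for large sets, the last two minimum degrees.
    Prescribed residues in the links supply both the groups inside residue 0 and the flexible
    vertices. The colinks concern all (r-1)-sets h, not only groups, because the lower bound r needs
    an extension of each of them. *)
Record pseudorandom (R : realFieldType) (p lam eta : R) (H : hypergraph V) : Prop :=
  Pseudorandom {
  pr_pairs_ub : forall (S : {set V}) (T : {set {set V}}),
    T \subset groups -> [disjoint S & cover T] ->
    ((pairs H S T)%:R <= 3 * p * #|S|%:R * #|T|%:R
                          + 3 * (#|S|%:R + #|T|%:R) * lam)%R;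
  pr_pairs_lb : forall (S : {set V}) (T : {set {set V}}),
    T \subset groups -> [disjoint S & cover T] ->
    (p * #|S|%:R * #|T|%:R / 2 - 3 * #|V|%:R <= (pairs H S T)%:R)%R;
  pr_links : forall x t rho, t < k.+2 -> rho < k ->
    (eta * p * m%:R <= #|[set g in G t | [&& x \notin g, x |: g \in H
                             & g \subset residue H rho]]|%:R)%R;
  pr_colinks : forall (h : {set V}) t rho, #|h| = r.-1 -> t < k.+2 -> rho < k ->
    (8 * p * m%:R <= #|[set x in B t | [&& x \notin h, x |: h \in H
                             & x \in residue H rho]]|%:R)%R }.

End Layout.

(** * From pseudorandomness to the index *)

Section Deterministic.
Variables (R : realFieldType) (V : finType) (k r m L Q K : nat).
Variables (G : nat -> {set {set V}}) (B : nat -> {set V}) (R0 : {set V}).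
Variables (p lam eta gam : R) (H : hypergraph V).
Hypotheses (k_gt1 : 1 < k) (r_gt1 : 1 < r).
Hypothesis lay : layout k r m L G B R0.
Hypotheses (uH : uniform r H) (psr : pseudorandom k r m G B p lam eta H).

Hypotheses (p_gt0 : (0 < p)%R) (m_gt0 : 0 < m) (lam_ge0 : (0 <= lam)%R)
  (eta_gt0 : (0 < eta)%R) (eta_le1 : (eta <= 1)%R) (gam_ge0 : (0 <= gam)%R).
Hypothesis (V_le : (#|V|%:R <= gam * m%:R)%R).
Hypothesis (K_ge : (6 * gam / eta + k%:R + 1 <= K%:R)%R).
Hypothesis (Q_ge : (k + r * k.+1) * K <= Q).
Hypothesis (pm_ge1 : (k%:R + Q%:R + 6 * lam < eta * p * m%:R / 2)%R).
Hypothesis (pm_ge2 : (Q%:R + 36 * (Q%:R + 3) * gam / eta * K%:R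
                       + 3 * (K%:R + 1) * lam < 8 * p * m%:R)%R).
Hypothesis (pm_ge3 : ((k * k)%:R <= eta * p * m%:R)%R).
Hypothesis (R0_ge : r.+1 * r <= #|R0|).

Let GG := groups k G.
Let P := part G B.
Let d := gcdn k r.
Let k_gt0 : 0 < k. Proof. exact: ltnW. Qed.
Let d_gt0 : 0 < d. Proof. by rewrite gcdn_gt0 k_gt0. Qed.
Let dk : d %| k. Proof. exact: dvdn_gcdl. Qed.
Let dr : d %| r. Proof. exact: dvdn_gcdr. Qed.

Lemma group_sub t : t < k.+2 -> G t \subset GG.
Proof. by move=> tk; apply: (bigcup_sup (Ordinal tk)). Qed.

Lemma point_exists : exists x : V, true.
Proof.
have /card_gt0P[g gG] : 0 < #|G 0| by rewrite (layout_cardG lay).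
have : 0 < #|g|.
  by rewrite (layout_size lay) ?(subsetP (group_sub _) _ gG) // -subn1 subn_gt0.
by move=> /card_gt0P[x _]; exists x.
Qed.

Definition admissible (V' : {set V}) (G' : {set {set V}}) : Prop :=
  [/\ G' \subset GG, #|G'| <= m, cover G' \subset V', d %| #|V'| &
   (forall x, (eta * p * m%:R <=
     #|[set g in G' | (x \notin g) && (x |: g \in H)]|%:R)%R) /\
   (forall g, g \in G' -> (8 * p * m%:R <=
     #|[set x in V' :\: cover G' | x |: g \in H]|%:R)%R)].

Lemma notin_cover_sub t (G' : {set {set V}}) x : t < k.+2 -> G' \subset GG ->
  x \in B t -> x \notin cover G'.
Proof.
move=> tk G'G xB; have := layout_BG lay tk; rewrite disjoint_subset => /subsetP/(_ _ xB).
rewrite !inE; apply: contra => /bigcupP[g gG' xg]; apply/bigcupP; exists g => //.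
exact: (subsetP G'G).
Qed.

Lemma admissible_part (V' : {set V}) t : t < k.+2 -> P t \subset V' -> d %| #|V'| ->
  admissible V' (G t).
Proof.
move=> tk PV' dV'; split=> //; first exact: group_sub.
- by rewrite (layout_cardG lay).
- by apply: subset_trans PV'; apply: subsetUl.
split=> [x|g gG].
  apply: le_trans (pr_links psr x tk k_gt0) _; rewrite ler_nat.
  by apply/subset_leq_card/subsetP => g; rewrite !inE => /and4P[-> -> ->].
have cg : #|g| = r.-1 by rewrite (layout_size lay) // (subsetP (group_sub tk)).
apply: le_trans (pr_colinks psr cg tk k_gt0) _; rewrite ler_nat.
apply/subset_leq_card/subsetP => x; rewrite !inE => /and4P[xB _ -> _].
rewrite (notin_cover_sub tk (group_sub tk) xB) (subsetP PV') //.
by rewrite inE xB orbT.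
Qed.

Lemma admissible_residue (V' : {set V}) : residue k H 0 \subset V' -> d %| #|V'| ->
  admissible V' [set g in G 0 | g \subset residue k H 0].
Proof.
set G' := [set g in _ | _] => ZV' dV'.
have G'G : G' \subset G 0 by apply/subsetP => g; rewrite inE => /andP[].
have G'GG := subset_trans G'G (group_sub (ltn0Sn _)).
split=> //.
- by rewrite -(layout_cardG lay (ltn0Sn _)) subset_leq_card.
- apply: subset_trans ZV'; apply/bigcupsP => g; by rewrite inE => /andP[].
split=> [x|g gG].
  apply: le_trans (pr_links psr x (ltn0Sn _) k_gt0) _; rewrite ler_nat.
  by apply/subset_leq_card/subsetP => g; rewrite !inE => /and4P[-> -> -> ->].
have cg : #|g| = r.-1 by rewrite (layout_size lay) // (subsetP G'GG).
apply: le_trans (pr_colinks psr cg (ltn0Sn _) k_gt0) _; rewrite ler_nat.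
apply/subset_leq_card/subsetP => x; rewrite inE => /and4P[xB _ xgH xZ].
rewrite inE xgH andbT inE (notin_cover_sub (ltn0Sn _) G'GG xB) /=.
exact: (subsetP ZV').
Qed.

Definition is_round (M : hypergraph V) (V' : {set V}) : Prop :=
  [/\ forall v, v \in V' -> hdegree M v = 1 %[mod k],
      forall v, v \notin V' -> hdegree M v = 0,
      forall v, hdegree M v <= K &
      forall e, e \in M -> exists x, e \subset x |: cover GG].

Lemma is_round_mod M (V' : {set V}) v : is_round M V' -> hdegree M v = (v \in V') %[mod k].
Proof.
move=> [M1 M0 _ _]; have [/M1//|/M0->//] := boolP (v \in V').
Qed.

(** Greedy choice: each round avoids [U0] and the earlier rounds, whose total degree stays at most q
    + T K, within the damage Q that a round tolerates. *)
Lemma rounds T (Vt : nat -> {set V}) (Gt : nat -> {set {set V}}) U0 q :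
  (forall v, hdegree U0 v <= q) -> q + T * K <= Q ->
  (forall i, i < T -> admissible (Vt i) (Gt i)) ->
  exists M : nat -> hypergraph V,
    [/\ forall i, i < T -> M i \subset H :\: U0,
        forall i, i < T -> is_round (M i) (Vt i) &
        forall i j e, i < T -> j < T -> e \in M i -> e \in M j -> i = j].
Proof.
move=> Uq; elim: T => [|T IH] qQ adm; first by exists (fun=> set0); split.
have [||M [MH Mr Md]] := IH.
- by apply: leq_trans qQ; rewrite leq_add2l leq_mul2r leqnSn orbT.
- by move=> i iT; apply: adm; apply: ltnW.
have [GGt cGt GV dV [lk clk]] := adm T (ltnSn T).
have U_le v : hdegree (U0 :|: hunion M T) v <= Q.
  apply: leq_trans (hdegreeU_le _ _ _) (leq_trans _ qQ).
  rewrite leq_add // (leq_trans (hdegree_hunion_le (c := K) _)) //.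
    by move=> i /Mr[].
  by rewrite leq_mul2r leqnSn orbT.
have [x0 _] := point_exists.
have [M' [M'H M'1 M'0 M'K M'e]] := round k_gt1 r_gt1 (layout_triv lay) (@layout_size _ _ _ _ _ _ _ _ lay)
  (pr_pairs_ub psr) (pr_pairs_lb psr) p_gt0 m_gt0 lam_ge0 eta_gt0 eta_le1 gam_ge0
  V_le K_ge pm_ge1 pm_ge2 GGt cGt GV dV U_le lk clk x0.
exists (fun i => if i == T then M' else M i); split=> [i|i|i j e].
- rewrite ltnS leq_eqVlt; case: eqVneq => [_ _|_] //=; last exact: MH.
  by apply: subset_trans M'H _; rewrite setDS // subsetUl.
- rewrite ltnS leq_eqVlt; case: eqVneq => [-> _|_] //=; last exact: Mr.
- have dis i' : i' < T -> e \in M' -> e \in M i' -> False.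
    move=> iT /(subsetP M'H); rewrite !inE negb_or => /andP[/andP[_ /negP nM] _] ei.
    by apply: nM; apply/hunionP; exists i'.
  rewrite !ltnS (leq_eqVlt i) (leq_eqVlt j).
  case: (eqVneq i T) => [->|_]; case: (eqVneq j T) => [->|_] //=.
  + by move=> _ jT e' /(dis j jT e').
  + by move=> iT _ ei e'; case: (dis i iT e' ei).
  + exact: Md.
Qed.

(** The links of one arbitrary vertex already exhibit that many groups lying inside the residue
    class. The bound k * k covers the [T.-1 * d] flexible vertices of every use, since T <= k + 1
    and d <= k. *)
Lemma residue_many t rho : t < k.+2 -> rho < k ->
  k * k <= #|[set v in cover (G t) | hdegree H v == rho %[mod k]]|.
Proof.
move=> tk rk; have [x0 _] := point_exists.
have := le_trans pm_ge3 (pr_links psr x0 tk rk); rewrite ler_nat => /leq_trans; apply.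
set G' := [set g in _ | _].
have G'GG : G' \subset GG.
  by apply: subset_trans (group_sub tk); apply/subsetP => g; rewrite inE => /andP[].
apply: (@leq_trans (#|G'| * r.-1)); first by rewrite leq_pmulr // -subn1 subn_gt0.
rewrite -(@card_cover_uniform _ G').
- apply/subset_leq_card/subsetP => v /bigcupP[g]; rewrite [g \in _]inE => /and4P[gG _ _ gZ] vg.
  rewrite inE; apply/andP; split; first by apply/bigcupP; exists g.
  by have := subsetP gZ v vg; rewrite inE.
- exact: trivIsetS (layout_triv lay).
- by move=> g /(subsetP G'GG); apply: (layout_size lay).
Qed.

Lemma card_parts_le1 T v : T <= k.+2 -> #|[set t : 'I_T | v \in P t]| <= 1.
Proof.
move=> Tk; apply/card_le1_eqP => t t'; rewrite !inE => vt vt'.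
have partE i : (v \in cover (G i)) || (v \in B i) = (v \in part G B i) by rewrite in_setU.
rewrite !partE in vt vt'; apply: val_inj.
by apply: (layout_part lay _ _ vt' vt); apply: leq_trans (ltn_ord _) Tk.
Qed.

Lemma sum_hdegree (F : hypergraph V) : F \subset H -> \sum_v hdegree F v = r * #|F|.
Proof.
move=> FH; apply: hdegree_sum; apply/forall_inP => e /(subsetP FH).
exact: (forall_inP uH).
Qed.

(** A link to a group inside residue 0 yields vertices of positive degree divisible by k. *)
Lemma chromatic_index_ge_k : k <= mod_chromatic_index k H.
Proof.
have [x0 _] := point_exists.
have := le_trans pm_ge3 (pr_links psr x0 (ltn0Sn _) k_gt0); rewrite ler_nat.
move=> /(leq_trans (_ : 0 < _)); rewrite muln_gt0 k_gt0 => /(_ isT)/card_gt0P[g].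
rewrite inE => /and4P[gG _ xgH gZ].
have : 0 < #|g|.
  by rewrite (layout_size lay) ?(subsetP (group_sub _) _ gG) // -subn1 subn_gt0.
move=> /card_gt0P[v vg]; apply: (@chromatic_index_ge_mod _ _ _ v).
  by rewrite lt0n hdegree_eq0; apply/forall_inP => /(_ _ xgH); rewrite !inE vg orbT.
by have := subsetP gZ v vg; rewrite inE mod0n.
Qed.

Lemma chromatic_index_ge_r : ~~ (d %| #|V|) -> r <= mod_chromatic_index k H.
Proof.
move=> ndV; apply: (chromatic_index_ge_uniform uH ndV).
  apply: leq_trans (max_card R0); apply: leq_trans R0_ge.
  by rewrite (leq_trans (leq_pred r)) // leq_pmull.
move=> J cJ; have := pr_colinks psr cJ (ltn0Sn _) k_gt0.
set A := [set x in _ | _] => Age.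
have : 0 < #|A|.
  rewrite -(ltr_nat R); apply: lt_le_trans Age.
  by rewrite !mulr_gt0 // ltr0n.
move=> /card_gt0P[x]; rewrite inE => /and4P[_ _ xJ _].
by exists (x |: J) => //; apply: subsetUr.
Qed.

(** Indexed by a natural number because families of rounds are; empty for i >= T. *)
Definition slot T (S : V -> {set 'I_T}) (i : nat) : {set V} :=
  [set v | [exists t : 'I_T, (val t == i) && (t \in S v)]].

Lemma slotE T (S : V -> {set 'I_T}) (t : 'I_T) v : (v \in slot S t) = (t \in S v).
Proof.
rewrite inE; apply/existsP/idP => [[t' /andP[/eqP/val_inj->//]]|tS].
by exists t; rewrite eqxx.
Qed.

Lemma slot_dvd T (S : V -> {set 'I_T}) : (forall t, d %| #|[set v | t \in S v]|) ->
  forall i, i < T -> d %| #|slot S i|.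
Proof.
move=> dS i iT; rewrite (_ : slot S i = [set v | Ordinal iT \in S v]) //.
by apply/setP => v; rewrite [RHS]inE -slotE.
Qed.

Lemma hdegree_rounds T (S : V -> {set 'I_T}) M v :
  (forall i, i < T -> is_round (M i) (slot S i)) ->
  (forall i j e, i < T -> j < T -> e \in M i -> e \in M j -> i = j) ->
  hdegree (hunion M T) v = #|S v| %[mod k].
Proof.
move=> Mr Md; rewrite hdegree_hunion // -modn_summ.
under eq_bigr => i _ do rewrite (is_round_mod v (Mr i (ltn_ord i))) slotE.
rewrite modn_summ -sum1_card [in RHS]big_mkcond /=.
by congr (_ %% _); apply: eq_bigr => t _; case: (t \in S v).
Qed.

(** The exact 0 on reservoir vertices matters: a vertex of [W j] has to be absent from class j, not
    merely of degree divisible by k there. The last clause leaves each hyperedge at most one vertex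
    outside the groups. *)
Definition is_fix (M : hypergraph V) (f : V -> nat) : Prop :=
  [/\ forall v, hdegree M v = f v %[mod k],
      forall v, v \in R0 -> k %| f v -> hdegree M v = 0,
      forall v, hdegree M v <= k.+1 * K &
      forall e, e \in M -> exists x, e \subset x |: cover GG].

Lemma rest_notin_part t v : t < k.+2 -> v \in R0 -> v \notin P t.
Proof. by move=> tk vR; rewrite (disjointFr (layout_rest lay tk) vR). Qed.

(* Here the rounds may be merged, so k+1 of them are affordable: every vertex
   outside R0 then has a required number of rounds between 1 and k, and the
   vertices of the spare part k+1 are flexible. *)
Lemma fix_degrees (f : V -> nat) U0 q :
  (forall v, hdegree U0 v <= q) -> q + k.+1 * K <= Q -> d %| \sum_v f v ->
  exists2 M : hypergraph V, M \subset H :\: U0 & is_fix M f.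
Proof.
move=> Uq qQ df.
(* Residue 0 is represented by k, so that vertices of every part join at least one round and can
   honour [must]; only reservoir vertices may join none. *)
pose c v := if (v \in R0) && (k %| f v) then 0 else (f v + (k - 1)) %% k + 1.
have c_mod v : c v = f v %[mod k].
  rewrite /c; case: ifP => [/andP[_ /eqP->]|_]; first by rewrite mod0n.
  by rewrite modnDml -addnA subnK // modnDr.
have c_notR v : v \notin R0 -> 0 < c v <= k.
  by rewrite /c => /negbTE -> /=; rewrite addn1 ltn_mod.
pose must v : {set 'I_k.+1} := [set t : 'I_k.+1 | v \in P t].
have must0 v : v \in R0 -> must v = set0.
  move=> vR; apply/setP => t; rewrite in_set in_set0; apply/negbTE/rest_notin_part => //.
  exact: leqW (ltn_ord t).
have GkR v : v \in cover (G k.+1) -> v \notin R0.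
  move=> vG; apply/negP => /(rest_notin_part (ltnSn k.+1)).
  by rewrite in_setU vG.
have [||||S [cS mS dS]] := @assign_rounds V k.+1 d c must (cover (G k.+1)) d_gt0.
- move=> v; have [vR|vR] := boolP (v \in R0).
    rewrite must0 // cards0 /= /c; case: ifP => // _.
    by rewrite addn1 ltnS ltnW // ltn_mod.
  have /andP[c1 ck] := c_notR v vR.
  by rewrite (leq_trans (card_parts_le1 _ (leqnSn _))) //= leqW.
- move=> v vG; have /andP[c1 ck] := c_notR v (GkR v vG); split; first by rewrite c1 ltnS.
  apply/setP => t; rewrite in_set in_set0; apply/negbTE/negP => vt.
  have vk : v \in P k.+1 by rewrite in_setU vG.
  have tk := layout_part lay (leqW (ltn_ord t)) (ltnSn k.+1) vt vk.
  by have := ltn_ord t; rewrite tk ltnn.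
- apply: leq_trans (leq_trans (residue_many (ltnSn k.+1) k_gt0) _).
    by rewrite leq_mul2l (dvdn_leq k_gt0 dk) orbT.
  by apply/subset_leq_card/subsetP => v; rewrite inE => /andP[].
- by rewrite (eqmod_sum dk c_mod).
have [i ik|M [MH Mr Md]] := rounds (T := k.+1) (Vt := slot S) (Gt := G) Uq qQ.
  apply: admissible_part; [exact: leqW| |exact: slot_dvd].
  apply/subsetP => v vi; rewrite (slotE S (Ordinal ik)); apply: (subsetP (mS v)).
  by rewrite in_set.
exists (hunion M k.+1).
  by apply/subsetP => e /hunionP[i ik]; apply: (subsetP (MH i ik)).
split=> [v|v vR kf|v|e /hunionP[i ik]].
- by rewrite (hdegree_rounds v Mr Md) cS c_mod.
- have S0 : S v = set0.
    by apply/eqP; rewrite -cards_eq0 cS /c vR kf.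
  rewrite hdegree_hunion // big1 // => i _.
  by have [_ -> //] := Mr i (ltn_ord i); rewrite slotE S0 inE.
- by apply: hdegree_hunion_le => i /Mr[].
- by have [_ _ _] := Mr i ik; apply.
Qed.

Lemma fix_degrees_seq N (f : nat -> V -> nat) U0 q :
  (forall v, hdegree U0 v <= q) -> q + N * (k.+1 * K) <= Q ->
  (forall j, j < N -> d %| \sum_v f j v) ->
  exists M : nat -> hypergraph V,
    [/\ forall j, j < N -> M j \subset H :\: U0,
        forall j, j < N -> is_fix (M j) (f j) &
        forall i j e, i < N -> j < N -> e \in M i -> e \in M j -> i = j].
Proof.
move=> Uq; elim: N => [|N IH] qQ df; first by exists (fun=> set0); split.
have qN : q + N * (k.+1 * K) <= Q.
  by apply: leq_trans qQ; rewrite leq_add2l leq_mul2r leqnSn orbT.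
have [|M [MH Mf Md]] := IH qN; first by move=> j jN; apply: df; apply: ltnW.
have [|||M' M'H M'f] := @fix_degrees (f N) (U0 :|: hunion M N) (q + N * (k.+1 * K)).
- move=> v; apply: leq_trans (hdegreeU_le _ _ _) _; apply: leq_add => //.
  by apply: hdegree_hunion_le => i /Mf[].
- by rewrite -addnA -mulSnr.
- exact: df.
exists (fun i => if i == N then M' else M i); split=> [i|i|i j e].
- rewrite ltnS leq_eqVlt; case: eqVneq => [_ _|_] //=; last exact: MH.
  by apply: subset_trans M'H _; rewrite setDS // subsetUl.
- rewrite ltnS leq_eqVlt; case: eqVneq => [-> _|_] //=; last exact: Mf.
- have dis i' : i' < N -> e \in M' -> e \in M i' -> False.
    move=> iN /(subsetP M'H); rewrite !inE negb_or => /andP[/andP[_ /negP nM] _] ei.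
    by apply: nM; apply/hunionP; exists i'.
  rewrite !ltnS (leq_eqVlt i) (leq_eqVlt j).
  case: (eqVneq i N) => [->|_]; case: (eqVneq j N) => [->|_] //=.
  + by move=> _ jN e' /(dis j jN e').
  + by move=> iN _ ei e'; case: (dis i iN e' ei).
  + exact: Md.
Qed.

Lemma one_mod_of (F : hypergraph V) (A : {set V}) :
  (forall v, v \in A -> hdegree F v = 1 %[mod k]) ->
  (forall v, v \notin A -> hdegree F v = 0) -> one_mod_hypergraph k F.
Proof.
move=> F1 F0; apply/forallP => v.
by have [/F1->|/F0->] := boolP (v \in A); rewrite eqxx ?orbT.
Qed.

Lemma chromatic_index_dvd : d %| #|V| -> mod_chromatic_index k H = k.
Proof.
move=> dV; apply/eqP; rewrite eqn_leq chromatic_index_ge_k andbT.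
pose c v := (hdegree H v + (k - 1)) %% k.
have ck v : c v <= k - 1 by rewrite -ltnS -[(k - 1).+1]addn1 subnK // ltn_mod.
(* Degree 2 modulo k gives [c v = 1], strictly between 0 and k - 1 when k > 2. For k = 2 there is a
   single round, its size is settled by the sum, and no flexible vertex is required. *)
pose L' := if k == 2 then set0 else [set v | hdegree H v == 2 %[mod k]].
have [||||S [cS _ dS]] := @assign_rounds V (k - 1) d c (fun=> set0) L' d_gt0.
- by move=> v; rewrite cards0 ck.
- move=> v; rewrite /L'; case: eqVneq => [_|k2]; first by rewrite inE.
  rewrite inE /c => /eqP hv; split=> //; rewrite -modnDml hv modnDml.
  have -> : 2 + (k - 1) = 1 + k by clear -k_gt1; lia.
  by rewrite modnDr modn_small //; move: k2; clear -k_gt1; lia.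
- rewrite /L'; case: eqVneq => [->//|k2].
  apply: leq_trans (leq_trans (residue_many (ltn0Sn _) (_ : 2 < k)) _).
  + by apply: leq_mul; [clear; lia | apply: dvdn_leq].
  + by move: k2; clear -k_gt1; lia.
  + by apply/subset_leq_card/subsetP => v; rewrite !inE => /andP[].
- rewrite (eqmod_sum dk (g := fun v => hdegree H v + (k - 1))).
    rewrite big_split /= sum_hdegree // sum_nat_const.
    by rewrite dvdn_add ?(dvdn_mulr _ dr) // dvdn_mulr.
  by move=> v; rewrite modn_mod.
have [v|||M [MH Mr Md]] := rounds (T := k - 1) (Vt := slot S) (U0 := set0) (q := 0)
    (Gt := fun=> [set g in G 0 | g \subset residue k H 0]).
- by rewrite hdegree_set0.
- apply: leq_trans Q_ge; rewrite add0n leq_mul2r.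
  by apply/orP; right; apply: leq_trans (leq_subr _ _) (leq_addr _ _).
- move=> i ik; apply: admissible_residue; last exact: slot_dvd.
  apply/subsetP => v; rewrite inE mod0n => /eqP hv.
  rewrite (slotE S (Ordinal ik)) (_ : S v = setT) ?inE //.
  apply/eqP; rewrite eqEcard subsetT cardsT card_ord cS /c -modnDml hv add0n.
  by rewrite modn_small //; clear -k_gt1; lia.
set U := hunion M (k - 1).
have UH : U \subset H.
  by apply/subsetP => e /hunionP[i ik] /(subsetP (MH i ik)); rewrite !inE.
apply: (@chromatic_index_le _ _ _ _ (fun i => if i < k - 1 then M i else H :\: U)).
- move=> i _; case: ifP => [/MH Mi|_]; last exact: subsetDl.
  by apply: subset_trans Mi (subsetDl _ _).
- move=> e eH; have [/hunionP[i ik ei]|nU] := boolP (e \in U).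
    by exists i; rewrite ?ik // (leq_trans ik) // leq_subr.
  by exists (k - 1); rewrite ?ltnn ?inE ?nU //; clear -k_gt1; lia.
- have dis i e : i < k - 1 -> e \in M i -> e \in H :\: U -> False.
    by move=> ik ei; rewrite inE => /andP[/negP nU _]; apply: nU; apply/hunionP; exists i.
  move=> i j e ik jk; case: ifP => [ik1|ik1]; case: ifP => [jk1|jk1].
  + exact: Md.
  + by move=> ei e'; case: (dis i e).
  + by move=> e' ej; case: (dis j e).
  + by move=> _ _; move: ik jk ik1 jk1; clear; lia.
- move=> i _; case: ifP => [/Mr[M1 M0 _ _]|_]; first exact: one_mod_of M1 M0.
  apply: (@one_mod_of _ setT) => v; last by rewrite inE.
  move=> _; have := hdegree_rounds v Mr Md; rewrite -/U cS /c modn_mod.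
  move=> /(eqmodZ k_gt1) Uv; apply/(eqmodZ k_gt1).
  have := congr1 (fun a : nat => a%:R : 'Z_k)%R (hdegreeD v UH).
  rewrite /= natrD Uv natrD (natZ_pred k_gt1) => /(congr1 (fun a => a - (hdegree H v)%:R + 1)%R).
  by rewrite subrr add0r => E; apply: etrans (esym E); ring.
Qed.

(** * The upper bound when d does not divide the number of vertices *)

Section NonDivisible.
Variable W : nat -> {set V}.
Hypothesis WR : forall j, j < r.+1 -> W j \subset R0.
Hypothesis cardW : forall j, j < r.+1 -> #|W j| = #|V| %% d.
Hypothesis disjW : forall i j v, i < r.+1 -> j < r.+1 ->
  v \in W i -> v \in W j -> i = j.

Let big v := \sum_(j < r.+1) (v \notin W j).

Lemma sum_notinW j : j < r.+1 -> d %| \sum_v (v \notin W j).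
Proof.
move=> jr; have -> : \sum_v (v \notin W j) = #|~: W j|.
  rewrite -sum1_card [RHS]big_mkcond /=; apply: eq_bigr => v _.
  by rewrite inE; case: (v \in W j).
by rewrite cardsCs setCK cardW // {1}(divn_eq #|V| d) addnK dvdn_mull.
Qed.

Lemma big_out v : (forall j, j < r.+1 -> v \notin W j) -> big v = r.+1.
Proof.
move=> vW; rewrite /big (eq_bigr (fun=> 1)) ?sum1_card ?card_ord // => j _.
by rewrite vW.
Qed.

(* After these k classes every degree is already, modulo k, the number of the
   remaining classes that are meant to contain the vertex. *)
Lemma reduce_degrees : exists M : nat -> hypergraph V,
  [/\ forall i, i < k -> M i \subset H,
      forall i, i < k -> exists V', is_round (M i) V',
      forall i j e, i < k -> j < k -> e \in M i -> e \in M j -> i = j &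
      forall v, hdegree (H :\: hunion M k) v = big v %[mod k]].
Proof.
(* Modulo k this is [hdegree H v - big v], the degree the k rounds have to remove; [c v] is its
   representative in 1..k, so that each part can be kept inside its own round. *)
pose a v := hdegree H v + (k - 1) * big v.
pose c v := (a v + (k - 1)) %% k + 1.
have c_mod v : c v = a v %[mod k].
  by rewrite /c modnDml -addnA subnK // modnDr.
have ck v : 0 < c v <= k by rewrite /c addn1 ltn_mod.
pose must v : {set 'I_k} := [set t : 'I_k | v \in P t].
(* Part k belongs to none of the rounds 0, ..., k - 1. Its vertices avoid every [W j], so
   [big v = r.+1], and degree r + 2 modulo k makes [c v = 1 < k]. *)
pose L' := [set v in cover (G k) | hdegree H v == r.+2 %% k %[mod k]].
have [||||S [cS mS dS]] := @assign_rounds V k d c must L' d_gt0.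
- move=> v; have /andP[c1 ck1] := ck v.
  by rewrite (leq_trans (card_parts_le1 _ _)) // leqW // leqnSn.
- move=> v; rewrite inE modn_mod => /andP[vG /eqP hv].
  have vk : v \in P k by rewrite in_setU vG.
  split; last first.
    apply/setP => t; rewrite in_set in_set0; apply/negbTE/negP => vt.
    have tk := layout_part lay (leqW (leqW (ltn_ord t))) (leqnSn k.+1) vt vk.
    by have := ltn_ord t; rewrite tk ltnn.
  rewrite /c /a big_out; last first.
    move=> j jr; apply: contraL vk => /(subsetP (WR jr)).
    exact: rest_notin_part.
  rewrite -addnA -modnDml hv modnDml.
  have -> : r.+2 + ((k - 1) * r.+1 + (k - 1)) = r.+2 * k.
    by clear -k_gt1; case: k k_gt1 => // k' _; rewrite subn1 /=; nia.
  by rewrite modnMl.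
- apply: leq_trans (residue_many (leqnSn k.+1) (ltn_pmod r.+2 k_gt0)).
  by apply: leq_mul; [apply: leq_pred | apply: dvdn_leq].
- rewrite (eqmod_sum dk c_mod) big_split /= sum_hdegree // -big_distrr /=.
  rewrite dvdn_add ?(dvdn_mulr _ dr) // dvdn_mull // exchange_big /=.
  by apply: dvdn_sum => j _; apply: sum_notinW.
have [v|||M [MH Mr Md]] := rounds (T := k) (Vt := slot S) (Gt := G) (U0 := set0) (q := 0).
- by rewrite hdegree_set0.
- by apply: leq_trans Q_ge; rewrite add0n leq_mul2r leq_addr orbT.
- move=> i ik; apply: admissible_part; [exact: leqW (leqW ik)| |exact: slot_dvd].
  apply/subsetP => v vi; rewrite (slotE S (Ordinal ik)); apply: (subsetP (mS v)).
  by rewrite in_set.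
have MH' i : i < k -> M i \subset H.
  by move=> /MH Mi; apply: subset_trans Mi (subsetDl _ _).
exists M; split=> // [i ik|v]; first by exists (slot S i); apply: Mr.
have UH : hunion M k \subset H.
  by apply/subsetP => e /hunionP[i ik]; apply: (subsetP (MH' i ik)).
have := hdegree_rounds v Mr Md; rewrite cS c_mod /a.
move=> /(eqmodZ k_gt1) Uv; apply/(eqmodZ k_gt1).
have := congr1 (fun a : nat => a%:R : 'Z_k)%R (hdegreeD v UH).
rewrite /= natrD Uv natrD natrM (natZ_pred k_gt1).
move=> /(congr1 (fun a => a - (hdegree H v)%:R + (big v)%:R)%R).
by rewrite subrr add0r => E; apply: etrans (esym E); ring.
Qed.

(** The groups are disjoint from the reservoir, so x is the only vertex of e that can lie in any
    [W j]. *)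
Lemma one_hit (e : {set V}) x i j : e \subset x |: cover GG -> i < r.+1 -> j < r.+1 ->
  ~~ [disjoint e & W i] -> ~~ [disjoint e & W j] -> i = j.
Proof.
move=> ex.
have hit l : l < r.+1 -> ~~ [disjoint e & W l] -> x \in W l.
  move=> lr; rewrite -setI_eq0 => /set0Pn[v]; rewrite inE => /andP[ve vW].
  have := subsetP ex v ve; rewrite !inE => /orP[/eqP<- //|/bigcupP[g gGG vg]].
  have [t _ gt] := bigcupP gGG.
  have := rest_notin_part (ltn_ord t) (subsetP (WR lr) v vW).
  by rewrite in_setU negb_or => /andP[/bigcupP[]]; exists g.
by move=> ir jr /(hit i ir) xi /(hit j jr) xj; apply: disjW xi xj.
Qed.

(* An edge belongs to C j when W j is the first of the sets it avoids; each C j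
   with j > 0 is then corrected by edges taken from C 0 and C 1. *)
Lemma chromatic_index_le_upper : mod_chromatic_index k H <= k + r + 1.
Proof.
have [Mh [MhH Mhr Mhd Hbig]] := reduce_degrees.
set HM := hunion Mh k in Hbig; set H' := H :\: HM in Hbig.
have H'H : H' \subset H := subsetDl _ _.
(* The degree budget: k rounds, then r corrections of at most k + 1 rounds each, every round of
   degree at most K. *)
have Kle : (k + r * k.+1) * K <= Q := Q_ge.
have rE : r = (r - 2).+2 by clear -r_gt1; lia.
pose C j : hypergraph V := [set e in H' | [disjoint e & W j] &&
   [forall i : 'I_j, ~~ [disjoint e & W i]]].
have CH' j : C j \subset H' by apply/subsetP => e; rewrite inE => /andP[].
have Cdis j (e : {set V}) v : e \in C j -> v \in W j -> v \notin e.
  by rewrite inE => /and3P[_ ej _] vW; apply/negP => /(disjointFr ej); rewrite vW.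
have C_lt i j (e : {set V}) : i < j -> e \in C i -> e \notin C j.
  move=> ij; rewrite !inE => /and3P[_ ei _]; apply/negP => /and3P[_ _ /forallP].
  by move=> /(_ (Ordinal ij)); rewrite ei.
have C_uniq i j (e : {set V}) : e \in C i -> e \in C j -> i = j.
  move=> ei ej; case: (ltngtP i j) => // ij.
    by have := C_lt i j e ij ei; rewrite ej.
  by have := C_lt j i e ij ej; rewrite ei.
have C_cover (e : {set V}) : e \in H' -> exists2 j, j < r.+1 & e \in C j.
  move=> eH'; have ce : #|e| = r.
    by apply/eqP; apply: (forall_inP uH); apply: (subsetP H'H).
  have [j0 j0r ej0] : exists2 j, j < r.+1 & [disjoint e & W j].
    case: (pickP (fun j : 'I_r.+1 => [disjoint e & W j])) => [j ej|none]; first by exists j.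
    have /fin_all_exists[h Hh] : forall j : 'I_r.+1, exists v, v \in e :&: W j.
      by move=> j; apply/set0Pn; rewrite setI_eq0 none.
    have he : h @: setT \subset e.
      by apply/subsetP => _ /imsetP[j _ ->]; have := Hh j; rewrite inE => /andP[].
    have := subset_leq_card he; rewrite card_imset ?cardsT ?card_ord ?ce ?ltnn //.
    move=> i j hij; apply: val_inj; apply: (disjW (v := h i)); try exact: ltn_ord.
      by have := Hh i; rewrite inE => /andP[].
    by rewrite hij; have := Hh j; rewrite inE => /andP[].
  have ex : exists j, [disjoint e & W j] by exists j0.
  exists (ex_minn ex).
    by case: ex_minnP => j _ /(_ _ ej0) /leq_ltn_trans; apply.
  case: ex_minnP => j ej jmin; rewrite inE eH' ej /=; apply/forallP => i.
  by apply/negP => /jmin; rewrite leqNgt ltn_ord.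
have HMk v : hdegree HM v <= k * K.
  by apply: hdegree_hunion_le => i /Mhr[V' []].
have dsum j (F : hypergraph V) : j < r.+1 -> F \subset H ->
    d %| \sum_v ((v \notin W j) + (k - 1) * hdegree F v).
  move=> jr FH; rewrite big_split /= dvdn_add ?sum_notinW // -big_distrr /=.
  by rewrite sum_hdegree // dvdn_mull // dvdn_mulr.
(* The desired degree minus the present one, modulo k. It vanishes on [W j.+2], so the corrected
   class still misses this set. *)
pose f j v := (v \notin W j.+2) + (k - 1) * hdegree (C j.+2) v.
have [||M [MH Mf Md]] := @fix_degrees_seq (r - 1) f HM (k * K) HMk.
- apply: leq_trans Kle; rewrite mulnDl leq_add2l -mulnA leq_mul2r leq_subr orbT.
  by [].
- move=> j jr; apply: dsum; last exact: subset_trans (CH' _) H'H.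
  by move: jr; clear -r_gt1; lia.
set MM := hunion M (r - 1).
have MH' j : j < r - 1 -> M j \subset H'.
  by move=> /MH Mj; apply: subset_trans Mj (setSD _ _).
(* To lie in a class of index at least 2, a correcting hyperedge would have to meet both [W 0] and
   [W 1], which [one_hit] excludes. Hence corrections take only from [C 0] and [C 1]. *)
have M_C i j (e : {set V}) : i < r - 1 -> j.+2 < r.+1 -> e \in M i -> e \notin C j.+2.
  move=> ir jr ei; apply/negP; rewrite inE => /and3P[_ _ /forallP hit].
  have [_ _ _ /(_ e ei)[x ex]] := Mf i ir.
  have h0 := hit (Ordinal (ltn0Sn j.+1)).
  have h1 := hit (Ordinal (isT : 1 < j.+2)).
  by have := one_hit ex (ltn0Sn r) (leqW r_gt1) h0 h1.
have E2r j : j < r - 1 -> j.+2 < r.+1 by clear -r_gt1; lia.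
have M_lt i j (e : {set V}) : i < r - 1 -> j < r - 1 -> e \in M i -> e \in C j.+2 -> False.
  by move=> ir jr ei ej; have := M_C i j e ir (E2r j jr) ei; rewrite ej.
pose A0 := C 0 :\: MM; pose C1 := C 1 :\: MM.
pose E2 j := C j.+2 :|: M j.
have E2_deg j v : j < r - 1 -> hdegree (E2 j) v = (v \notin W j.+2) %[mod k].
  move=> jr; rewrite hdegreeU; last first.
    by rewrite disjoint_subset; apply/subsetP => e ec; apply/negP => em; exact: (M_lt j j e jr jr em ec).
  have [Mfj _ _ _] := Mf j jr; rewrite -modnDmr Mfj modnDmr /f.
  exact: addn_pred_mod.
have E2_deg0 j v : j < r - 1 -> v \in W j.+2 -> hdegree (E2 j) v = 0.
  move=> jr vW; have [_ Mf0 _ _] := Mf j jr.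
  have c0 : hdegree (C j.+2) v = 0.
    by apply/eqP; rewrite hdegree_eq0; apply/forall_inP => e ec; apply: (Cdis j.+2).
  apply/eqP; rewrite -leqn0; apply: leq_trans (hdegreeU_le _ _ _) _.
  rewrite c0 Mf0 //; first exact: subsetP (WR (E2r j jr)) v vW.
  by rewrite /f vW c0 muln0.
have E2_disj i j (e : {set V}) : i < r - 1 -> j < r - 1 -> e \in E2 i -> e \in E2 j -> i = j.
  move=> ir jr; rewrite !in_setU => /orP[ei|ei] /orP[ej|ej].
  - by have [] := C_uniq _ _ _ ei ej.
  - by case: (M_lt j i e jr ir ej ei).
  - by case: (M_lt i j e ir jr ei ej).
  - exact: Md ir jr ei ej.
have E2_sub j : j < r - 1 -> E2 j \subset H' by move=> jr; rewrite subUset CH' MH'.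
pose EE := hunion E2 (r - 1).
have H'E : H' = (A0 :|: C1) :|: EE.
  apply/setP => e; apply/idP/idP => [eH|].
    rewrite !in_setU; have [/hunionP[j jr ej]|nM] := boolP (e \in MM).
      apply/orP; right; apply/hunionP; exists j => //.
      by rewrite in_setU ej orbT.
    have [[|[|j]] jr ej] := C_cover e eH; first by rewrite in_setD nM ej.
      by rewrite !in_setD nM ej orbT.
    apply/orP; right; apply/hunionP; exists j; last by rewrite in_setU ej.
    by move: jr; clear; lia.
  move=> /setUP[/setUP[/setDP[e0 _]|/setDP[e1 _]]|/hunionP[j jr ej]].
  - exact: (subsetP (CH' 0) e e0).
  - exact: (subsetP (CH' 1) e e1).
  - exact: (subsetP (E2_sub j jr) e ej).
have EE_C i (e : {set V}) : i < 2 -> e \in EE -> e \in C i :\: MM -> False.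
  move=> i2 /hunionP[j jr]; rewrite in_setU in_setD => /orP[ej|ej] /andP[nM ei].
    by move: i2; rewrite (C_uniq _ _ _ ei ej).
  by case/negP: nM; apply/hunionP; exists j.
have A0_C1 (e : {set V}) : e \in A0 -> e \in C1 -> False.
  by rewrite !in_setD => /andP[_ e0] /andP[_ /(C_uniq _ _ _ e0)].
have H'deg v : hdegree H' v = hdegree A0 v + hdegree C1 v + \sum_(j < r - 1) hdegree (E2 j) v.
  rewrite {1}H'E hdegreeU; last first.
    rewrite disjoint_subset; apply/subsetP => e eA; apply/negP => eE.
    move: eA; rewrite in_setU => /orP[].
      exact: (EE_C 0).
    exact: (EE_C 1).
  rewrite hdegreeU ?hdegree_hunion //.
  by rewrite disjoint_subset; apply/subsetP => e eA; apply/negP => /(A0_C1 e eA).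
have E2sum v : \sum_(j < r - 1) hdegree (E2 j) v = \sum_(j < r - 1) (v \notin W j.+2) %[mod k].
  rewrite -modn_summ -[RHS]modn_summ; congr (_ %% _).
  by apply: eq_bigr => j _; rewrite E2_deg.
have bigE v : big v = (v \notin W 0) + ((v \notin W 1) + \sum_(j < r - 1) (v \notin W j.+2)).
  by apply: (sum_ord_split2 (fun j => (v \notin W j) : nat)); apply: ltnW.
have A0_deg0 v : v \in W 0 -> hdegree A0 v = 0.
  move=> vW; apply/eqP; rewrite hdegree_eq0; apply/forall_inP => e.
  by rewrite in_setD => /andP[_ ec]; apply: (Cdis 0).
have C1_deg0 v : v \in W 1 -> hdegree C1 v = 0.
  move=> vW; apply/eqP; rewrite hdegree_eq0; apply/forall_inP => e.
  by rewrite in_setD => /andP[_ ec]; apply: (Cdis 1).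
have W01 v : v \in W 0 -> v \notin W 1.
  by move=> v0; apply/negP => /(disjW (ltn0Sn r) (leqW r_gt1) v0).
(* On [W 0] the class [A0] is empty and the classes of index at least 2 are already right, so the
   total [big v] forces degree 1 in [C1]. *)
have C1_deg v : v \in W 0 -> hdegree C1 v = 1 %[mod k].
  move=> v0; have := Hbig v; rewrite bigE v0 (W01 v v0) H'deg A0_deg0 // !add0n.
  move=> /eqP; rewrite -modnDmr E2sum modnDmr eqn_modDr => /eqP ->.
  by [].
have C1H : C1 \subset H by apply: subset_trans (subsetDl _ _) (subset_trans (CH' 1) H'H).
pose f1 v := (v \notin W 1) + (k - 1) * hdegree C1 v.
have [|||M1 M1H [M1f M1f0 _ _]] := @fix_degrees f1 (HM :|: MM) (k * K + (r - 1) * (k.+1 * K)).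
- move=> v; apply: leq_trans (hdegreeU_le _ _ _) _; apply: leq_add => //.
  by apply: hdegree_hunion_le => i /Mf[].
- rewrite -addnA -mulSnr (_ : (r - 1).+1 = r); last by clear -r_gt1; lia.
  by rewrite mulnA -mulnDl.
- exact: (dsum 1 C1 (leqW r_gt1) C1H).
(* By [C1_deg] the correction [f1] vanishes modulo k on [W 0], so [M1] avoids [W 0]; its hyperedges
   therefore belong to [C 0] and none is taken from [C1] itself. *)
have M1A0 : M1 \subset A0.
  apply/subsetP => e eM; have := subsetP M1H e eM.
  rewrite in_setD in_setU negb_or => /andP[/andP[nHM nMM] eH].
  rewrite in_setD nMM in_set in_setD nHM eH /=; apply/andP; split; last by apply/forallP => -[].
  rewrite disjoint_sym disjoint_subset; apply/subsetP => v v0.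
  have vR : v \in R0 := subsetP (WR (ltn0Sn r)) v v0.
  have : hdegree M1 v = 0.
    apply: M1f0 => //; rewrite /f1 (W01 v v0) /dvdn -modnDmr -modnMmr C1_deg // modnMmr modnDmr.
    by rewrite muln1 addnC subnK // modnn.
  by move=> /eqP; rewrite hdegree_eq0 => /forall_inP/(_ e eM).
pose E j := match j with 0 => A0 :\: M1 | 1 => C1 :|: M1 | j'.+2 => E2 j' end.
have C1_M1 (e : {set V}) : e \in C1 -> e \in M1 -> False.
  by move=> e1 /(subsetP M1A0) e0; apply: A0_C1 e0 e1.
have E1_deg v : hdegree (E 1) v = (v \notin W 1) %[mod k].
  rewrite hdegreeU; last first.
    by rewrite disjoint_subset; apply/subsetP => e ec; apply/negP => /(C1_M1 e ec).
  by rewrite -modnDmr M1f modnDmr; apply: addn_pred_mod.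
(* All other classes are right, so the total degree [big v] settles this one. *)
have E0_deg v : hdegree (E 0) v = (v \notin W 0) %[mod k].
  have := Hbig v; rewrite bigE H'deg (hdegreeD v M1A0).
  have -> : hdegree (A0 :\: M1) v + hdegree M1 v + hdegree C1 v + \sum_(j < r - 1) hdegree (E2 j) v
    = hdegree (E 0) v + hdegree (E 1) v + \sum_(j < r - 1) hdegree (E2 j) v.
    rewrite /= hdegreeU; first by rewrite -!addnA; congr (_ + _); rewrite addnCA.
    by rewrite disjoint_subset; apply/subsetP => e ec; apply/negP => /(C1_M1 e ec).
  move=> /eqP; rewrite -modnDmr E2sum modnDmr addnA eqn_modDr.
  by rewrite -modnDmr E1_deg modnDmr eqn_modDr => /eqP.
have E_sub j : j < r.+1 -> E j \subset H'.
  case: j => [|[|j]] jr.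
  - exact: subset_trans (subsetDl _ _) (subset_trans (subsetDl _ _) (CH' 0)).
  - rewrite subUset (subset_trans (subsetDl _ _) (CH' 1)).
    exact: subset_trans M1A0 (subset_trans (subsetDl _ _) (CH' 0)).
  - by apply: E2_sub; move: jr; clear; lia.
have E_EE j (e : {set V}) : j < 2 -> e \in E j -> e \notin EE.
  move=> j2 ej; apply/negP => eE; case: j j2 ej => [|[|//]] _ /=.
    by rewrite in_setD => /andP[_]; apply: EE_C.
  rewrite in_setU => /orP[|/(subsetP M1A0)]; exact: EE_C.
have E_E2 i j (e : {set V}) : i < 2 -> j.+2 < r.+1 -> e \in E i -> e \in E j.+2 -> False.
  move=> i2 jr ei ej; have := E_EE i e i2 ei; case/negP; apply/hunionP.
  by exists j => //; move: jr; clear; lia.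
have E01 (e : {set V}) : e \in E 0 -> e \in E 1 -> False.
  rewrite in_setD in_setU => /andP[nM e0] /orP[/(A0_C1 e e0)//|eM].
  by rewrite eM in nM.
have E_disj i j (e : {set V}) : i < r.+1 -> j < r.+1 -> e \in E i -> e \in E j -> i = j.
  case: i => [|[|i]]; case: j => [|[|j]] // ir jr ei ej.
  - by case: (E01 e).
  - by case: (E_E2 0 j e).
  - by case: (E01 e).
  - by case: (E_E2 1 j e).
  - by case: (E_E2 0 i e).
  - by case: (E_E2 1 i e).
  - congr _.+2; apply: (E2_disj i j e) => //; [move: ir|move: jr]; clear; lia.
have E_cover (e : {set V}) : e \in H' -> exists2 j, j < r.+1 & e \in E j.
  rewrite {1}H'E !in_setU => /orP[/orP[e0|e1]|/hunionP[j jr ej]].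
  - have [eM|nM] := boolP (e \in M1).
      by exists 1; [exact: leqW | rewrite in_setU eM orbT].
    by exists 0; rewrite // in_setD nM.
  - by exists 1; [exact: leqW | rewrite in_setU e1].
  - by exists j.+2; [apply: E2r |].
have E_one j : j < r.+1 -> one_mod_hypergraph k (E j).
  move=> jr; apply: (@one_mod_of _ (~: W j)) => v; rewrite inE => vW.
    case: j jr vW => [|[|j]] jr vW; [rewrite E0_deg|rewrite E1_deg|rewrite E2_deg].
    - by rewrite vW.
    - by rewrite vW.
    - by rewrite vW.
    - by move: jr; clear; lia.
  move: vW; rewrite negbK => vW; case: j jr vW => [|[|j]] jr vW.
  - by have := hdegree_sub v (subsetDl A0 M1); rewrite A0_deg0 // leqn0 => /eqP.
  - apply/eqP; rewrite -leqn0; apply: leq_trans (hdegreeU_le _ _ _) _.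
    rewrite C1_deg0 // M1f0 //; first exact: subsetP (WR jr) v vW.
    by rewrite /f1 vW C1_deg0 // muln0.
  - by apply: E2_deg0 => //; move: jr; clear; lia.
have Ek i : k <= i -> i < k + r + 1 -> i - k < r.+1.
  by clear; lia.
apply: (@chromatic_index_le _ _ _ _ (fun i => if i < k then Mh i else E (i - k))).
- move=> i iN; case: ltnP => [/MhH//|ki].
  exact: subset_trans (E_sub _ (Ek i ki iN)) H'H.
- move=> e eH; have [/hunionP[i ik ei]|nU] := boolP (e \in HM).
    by exists i; rewrite ?ik // -addnA (leq_trans ik) // leq_addr.
  have eH' : e \in H' by rewrite in_setD nU.
  have [j jr ej] := E_cover e eH'.
  exists (k + j); first by move: jr; clear; lia.
  by rewrite ltnNge leq_addr /= addKn.
- have dis i j (e : {set V}) : i < k -> j < r.+1 -> e \in Mh i -> e \in E j -> False.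
    move=> ik jr ei /(subsetP (E_sub j jr)); rewrite in_setD => /andP[/negP nU _].
    by apply: nU; apply/hunionP; exists i.
  move=> i j e iN jN; case: ltnP => [ik|ki]; case: ltnP => [jk|kj].
  + exact: Mhd.
  + by move=> ei ej; case: (dis i (j - k) e ik (Ek j kj jN) ei ej).
  + by move=> ei ej; case: (dis j (i - k) e jk (Ek i ki iN) ej ei).
  + move=> ei ej; have := E_disj _ _ e (Ek i ki iN) (Ek j kj jN) ei ej.
    by move: ki kj; clear; lia.
- move=> i iN; case: ltnP => [/Mhr[V' [M1' M0' _ _]]|ki].
    exact: one_mod_of M1' M0'.
  exact: E_one (Ek i ki iN).
Qed.
End NonDivisible.

Lemma chromatic_index_bounds :
  ((#|V| == 0 %[mod d]) ==> (mod_chromatic_index k H == k)) &&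
  ((#|V| != 0 %[mod d]) ==>
     (maxn k r <= mod_chromatic_index k H <= k + r + 1)).
Proof.
rewrite mod0n -/(d %| #|V|); apply/andP; split; apply/implyP => dV.
  by rewrite chromatic_index_dvd.
rewrite geq_max chromatic_index_ge_k chromatic_index_ge_r //=.
have [|W [WR cW dW]] := @disjoint_subsets V R0 r.+1 (fun=> #|V| %% d).
  rewrite sum_nat_const card_ord; apply: leq_trans R0_ge.
  rewrite leq_mul2l /= ltnW // (leq_trans (ltn_pmod _ d_gt0)) //.
  by apply: dvdn_leq dr; apply: ltnW.
exact: chromatic_index_le_upper WR cW dW.
Qed.

End Deterministic.

(** * Random sets *)

Local Open Scope ring_scope.

Lemma set_ind (I : finType) (P : {set I} -> Prop) :
  P set0 -> (forall x (D : {set I}), x \notin D -> P D -> P (x |: D)) -> forall D, P D.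
Proof.
move=> P0 PS D; have [n] := ubnP #|D|; elim: n D => // n IH D leDn.
have [->//|[x xD]] := set_0Vmem D.
rewrite -(setD1K xD); apply: PS; first by rewrite !inE eqxx.
by apply: IH; move: leDn; rewrite (cardsD1 x) xD.
Qed.

Section WeightedSums.
Variables (R : realType) (I : finType).
Implicit Types (D K L : {set I}) (f : {set I} -> R).

(* For a + b = 1 this is the expectation of f at a random subset of D whose
   elements are present independently with probability a. *)
Definition expect (a b : R) D f : R :=
  \sum_(K in powerset D) a ^+ #|K| * b ^+ #|D :\: K| * f K.

Lemma expectU a b D1 D2 f : [disjoint D1 & D2] ->
  expect a b (D1 :|: D2) f =
  expect a b D1 (fun K => expect a b D2 (fun L => f (K :|: L))).
Proof.
move=> dD; have D12 := disjoint_setI0 dD.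
rewrite /expect; under [RHS]eq_bigr do rewrite big_distrr /=.
rewrite pair_big /=.
rewrite (reindex_onto (fun q : {set I} * {set I} => q.1 :|: q.2)
  (fun M => (M :&: D1, M :&: D2))) /=; last first.
  by move=> M; rewrite !inE => MD; rewrite -setIUr (setIidPl MD).
have memq (K L : {set I}) : K \subset D1 -> L \subset D2 ->
    ((K :|: L) :&: D1 = K) * ((K :|: L) :&: D2 = L) *
    (K :&: L = set0) * ((D1 :|: D2) :\: (K :|: L) = (D1 :\: K) :|: (D2 :\: L)).
  move=> KD LD; have in12 v : ~~ ((v \in D1) && (v \in D2)).
    by have := in_set0 v; rewrite -D12 inE => ->.
  have inK v : (v \in K) ==> (v \in D1) by apply/implyP/(subsetP KD).
  have inL v : (v \in L) ==> (v \in D2) by apply/implyP/(subsetP LD).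
  by do 3?split; apply/setP => v; rewrite !inE; move: (inK v) (inL v) (in12 v);
    case: (v \in K); case: (v \in L); case: (v \in D1); case: (v \in D2).
apply: eq_big => [[K L]|[K L]] /=; rewrite !inE.
  apply/andP/andP => [[KL /eqP[<- <-]]|[KD LD]].
    by rewrite !subsetIr.
  by rewrite setUSS // !(memq _ _ KD LD) eqxx.
move=> /andP[KL /eqP[EK EL]].
have KD : K \subset D1 by rewrite -EK subsetIr.
have LD : L \subset D2 by rewrite -EL subsetIr.
rewrite !(memq _ _ KD LD) !cardsU !(memq _ _ KD LD) cards0 subn0.
have -> : (D1 :\: K) :&: (D2 :\: L) = set0.
  by apply/eqP; rewrite -subset0 -D12 setISS // subsetDl.
by rewrite cards0 subn0 !exprD; ring.
Qed.

Lemma expect_set0 a b f : expect a b set0 f = f set0.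
Proof.
by rewrite /expect powerset0 big_set1 setD0 cards0 !expr0 !mul1r.
Qed.

Lemma expect_set1 a b x f : expect a b [set x] f = a * f [set x] + b * f set0.
Proof.
rewrite /expect (bigD1 [set x]) ?inE ?subxx //= (bigD1 set0) /=; last first.
  by rewrite inE sub0set eq_sym -card_gt0 cards1.
rewrite big1 => [|K /andP[/andP[]]]; last first.
  by rewrite inE subset1 => /orP[->|->].
by rewrite setDv setD0 cards0 cards1 !expr0 !expr1 addr0 mulr1 mul1r.
Qed.

Lemma expectU1 a b x D f : x \notin D ->
  expect a b (x |: D) f =
  a * expect a b D (fun K => f (x |: K)) + b * expect a b D f.
Proof.
move=> xD; rewrite expectU ?disjoints1 // expect_set1.
by congr (_ * _ + _ * _); apply: eq_bigr => K _; rewrite set0U.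
Qed.

Lemma eq_expect a b D f g : (forall K, K \subset D -> f K = g K) ->
  expect a b D f = expect a b D g.
Proof. by move=> fg; apply: eq_bigr => K; rewrite inE => /fg ->. Qed.

Lemma expect_cst a b D c : expect a b D (fun=> c) = (a + b) ^+ #|D| * c.
Proof.
elim/set_ind: D => [|x D xD IH]; first by rewrite expect_set0 cards0 mul1r.
by rewrite expectU1 // IH cardsU1 xD exprS; ring.
Qed.

Lemma expectZ a b D c f : expect a b D (fun K => c * f K) = c * expect a b D f.
Proof. by rewrite /expect big_distrr /=; apply: eq_bigr => K _; ring. Qed.

Lemma expectD a b D f g :
  expect a b D (fun K => f K + g K) = expect a b D f + expect a b D g.
Proof. by rewrite /expect -big_split /=; apply: eq_bigr => K _; rewrite mulrDr. Qed.

Lemma expect_sum (J : finType) (P : pred J) a b D (f : J -> {set I} -> R) :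
  expect a b D (fun K => \sum_(j | P j) f j K) = \sum_(j | P j) expect a b D (f j).
Proof.
by rewrite /expect exchange_big /=; apply: eq_bigr => K _; rewrite big_distrr.
Qed.

Lemma le_expect a b D f g : 0 <= a -> 0 <= b ->
  (forall K, K \subset D -> f K <= g K) -> expect a b D f <= expect a b D g.
Proof.
move=> a0 b0 fg; apply: ler_sum => K; rewrite inE => /fg.
by apply: ler_wpM2l; rewrite mulr_ge0 ?exprn_ge0.
Qed.

(** Generating function of the number of present elements of F; z = e and z = 1/e lead to the two
    Chernoff bounds. *)
Lemma expect_exp_card a b D (F : {set I}) z : F \subset D ->
  expect a b D (fun K => z ^+ #|K :&: F|) =
  (a * z + b) ^+ #|F| * (a + b) ^+ #|D :\: F|.
Proof.
move=> FD; have {1}-> : D = F :|: (D :\: F) by rewrite setDE setUIr setUCr setIT (setUidPr FD).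
rewrite expectU; last by rewrite disjoint_sym disjoints_subset setDE subsetIr.
rewrite (@eq_expect _ _ _ _ (fun K => (a + b) ^+ #|D :\: F| * z ^+ #|K|)).
  rewrite expectZ mulrC; congr (_ * _).
  rewrite -[RHS]mulr1 -(@expect_cst (a * z) b F 1); apply: eq_bigr => K _.
  by rewrite exprMn; ring.
move=> K KF; rewrite -(expect_cst a b); apply: eq_expect => L LD.
rewrite setIUl (setIidPl KF) (_ : L :&: F = set0) ?setU0 //.
apply/setP => v; rewrite !inE; apply/negP => /andP[vL vF].
by have := subsetP LD v vL; rewrite inE vF.
Qed.

End WeightedSums.

(** * Products of conditionally bounded factors *)

Section Products.
Variables (R : realType) (I J : finType) (a b : R).
Hypotheses (a0 : 0 <= a) (b0 : 0 <= b).
Variables (D : J -> {set I}) (psi : J -> {set I} -> R) (t : R).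
Hypotheses (t0 : 0 <= t) (psi0 : forall j K, 0 <= psi j K).

(** The elements outside [D j] are fixed first: the other factors do not see [D j], and factor j is
    bounded by t uniformly in what was fixed; then j is removed. The relation is abstract so that
    upper and lower bounds share the argument. *)
Lemma expect_prod_bound (A : {set J}) (U : {set I}) (rel : R -> R -> bool) :
  (forall x, rel x x) -> (forall x y z, rel x y -> rel y z -> rel x z) ->
  (forall c x y, 0 <= c -> rel x y -> rel (c * x) (c * y)) ->
  (forall (W : {set I}) f g, (forall K : {set I}, K \subset W -> rel (f K) (g K)) ->
     rel (expect a b W f) (expect a b W g)) ->
  a + b = 1 ->
  (forall j, j \in A -> D j \subset U) ->
  (forall i j, i \in A -> j \in A -> i != j -> [disjoint D i & D j]) ->
  (forall i j (K L : {set I}), i \in A -> j \in A -> i != j -> L \subset D j ->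
     psi i (K :|: L) = psi i K) ->
  (forall j (K : {set I}), j \in A -> K \subset U :\: D j ->
     rel (expect a b (D j) (fun L => psi j (K :|: L))) t) ->
  rel (expect a b U (fun K => \prod_(j in A) psi j K)) (t ^+ #|A|).
Proof.
move=> relxx relT relM relE ab.
have [n] := ubnP #|A|; elim: n A U => // n IH A U leAn DU Ddis indep bnd.
have [->|[j jA]] := set_0Vmem A.
  rewrite cards0 (@eq_expect _ _ _ _ _ _ (fun=> 1)); last by move=> K _; rewrite big_set0.
  by rewrite expect_cst ab expr1n mulr1 expr0.
have UE : U = (U :\: D j) :|: D j by rewrite setUC -{1}(setIidPr (DU j jA)) setID.
have jD i : i \in A :\ j -> (i \in A) /\ i != j by rewrite !inE => /andP[-> ->].
rewrite UE expectU; last first.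
  by rewrite disjoint_subset; apply/subsetP => v; rewrite !inE => /andP[].
rewrite (@eq_expect _ _ _ _ _ _ (fun K => (\prod_(i in A :\ j) psi i K) *
    expect a b (D j) (fun L => psi j (K :|: L)))); last first.
  move=> K _; rewrite -expectZ; apply: eq_expect => L LD.
  rewrite (big_setD1 j) //= mulrC; congr (_ * _).
  by apply: eq_bigr => i /jD[iA ij]; rewrite (indep i j).
apply: (relT _ (expect a b (U :\: D j) (fun K => t * \prod_(i in A :\ j) psi i K))).
  apply: relE => K KU; rewrite [t * _]mulrC; apply: relM; last exact: bnd.
  by apply: prodr_ge0.
rewrite expectZ (cardsD1 j A) jA exprS; apply: relM => //; apply: IH.
- by move: leAn; rewrite (cardsD1 j A) jA.
- move=> i /jD[iA ij]; apply/subsetP => v vi; rewrite inE (subsetP (DU i iA)) // andbT.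
  by rewrite (disjointFr (Ddis i j iA jA ij) vi).
- by move=> i l /jD[iA _] /jD[lA _]; apply: Ddis.
- by move=> i l K L /jD[iA _] /jD[lA _]; apply: indep.
- move=> i K /jD[iA _] KU; apply: bnd => //.
  by apply: subset_trans KU _; apply/setSD/subsetDl.
Qed.

Lemma expect_prod_le (A : {set J}) (U : {set I}) : a + b = 1 ->
  (forall j, j \in A -> D j \subset U) ->
  (forall i j, i \in A -> j \in A -> i != j -> [disjoint D i & D j]) ->
  (forall i j (K L : {set I}), i \in A -> j \in A -> i != j -> L \subset D j ->
     psi i (K :|: L) = psi i K) ->
  (forall j (K : {set I}), j \in A -> K \subset U :\: D j ->
     expect a b (D j) (fun L => psi j (K :|: L)) <= t) ->
  expect a b U (fun K => \prod_(j in A) psi j K) <= t ^+ #|A|.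
Proof.
apply: (expect_prod_bound (rel := fun x y => x <= y)) => //.
- by move=> x y z; apply: le_trans.
- by move=> c x y c0; apply: ler_wpM2l.
- by move=> W f g; apply: le_expect.
Qed.

Lemma expect_prod_ge (A : {set J}) (U : {set I}) : a + b = 1 ->
  (forall j, j \in A -> D j \subset U) ->
  (forall i j, i \in A -> j \in A -> i != j -> [disjoint D i & D j]) ->
  (forall i j (K L : {set I}), i \in A -> j \in A -> i != j -> L \subset D j ->
     psi i (K :|: L) = psi i K) ->
  (forall j (K : {set I}), j \in A -> K \subset U :\: D j ->
     t <= expect a b (D j) (fun L => psi j (K :|: L))) ->
  t ^+ #|A| <= expect a b U (fun K => \prod_(j in A) psi j K).
Proof.
apply: (expect_prod_bound (rel := fun x y => y <= x)) => //.
- by move=> x y z yx zy; apply: le_trans zy yx.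
- by move=> c x y c0; apply: ler_wpM2l.
- by move=> W f g; apply: le_expect.
Qed.

End Products.

(** * Residues of binomial variables *)

Section Binomial.
Variable R : realType.
Implicit Types (a b p : R) (phi psi : nat -> R).

(** For a + b = 1, the expectation of phi at a binomial variable with N trials, by conditioning on
    one trial. *)
Fixpoint binom a b N phi : R :=
  if N is N'.+1 then a * binom a b N' (fun i => phi i.+1) + b * binom a b N' phi
  else phi 0%N.

Lemma expect_card (I : finType) a b (D : {set I}) phi :
  expect a b D (fun K => phi #|K|) = binom a b #|D| phi.
Proof.
elim/set_ind: D phi => [|x D xD IH] phi; first by rewrite expect_set0 cards0.
rewrite expectU1 // cardsU1 xD /= -!IH; congr (_ * _ + _).
apply: eq_expect => K KD; rewrite cardsU1.
by rewrite (contra (subsetP KD x)).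
Qed.

Lemma le_binom a b N phi psi : 0 <= a -> 0 <= b ->
  (forall i, phi i <= psi i) -> binom a b N phi <= binom a b N psi.
Proof.
move=> a0 b0; elim: N phi psi => [|N IH] phi psi le_pp //=.
by rewrite lerD // ler_wpM2l // IH.
Qed.

Lemma binom_add a b N M phi :
  binom a b (N + M) phi = binom a b N (fun i => binom a b M (fun j => phi (i + j)%N)).
Proof.
elim: N phi => [|N IH] phi //=.
by rewrite !IH; congr (_ * _ + _).
Qed.

Lemma binom_cst a b N c : binom a b N (fun=> c) = (a + b) ^+ N * c.
Proof. by elim: N => [|N IH] /=; rewrite ?mul1r // IH exprS; ring. Qed.

Lemma binom_rev a b N phi psi :
  (forall i, (i <= N)%N -> phi i = psi (N - i)%N) -> binom a b N phi = binom b a N psi.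
Proof.
elim: N phi psi => [|N IH] phi psi pp /=; first by rewrite pp.
rewrite addrC (IH phi (fun i => psi i.+1)); last first.
  by move=> i iN; rewrite pp ?subSn // leqW.
by rewrite (IH (fun i => phi i.+1) psi) // => i iN; rewrite pp // subSS.
Qed.

Lemma binom_ge01 a b n phi : 0 <= a -> 0 <= b -> (forall i, 0 <= phi i) ->
  b ^+ n * phi 0%N + n%:R * a * b ^+ n.-1 * phi 1%N <= binom a b n phi.
Proof.
move=> a0 b0; elim: n phi => [|n IH] phi p0 /=; first by rewrite mul1r !mul0r addr0.
have le1 := IH phi p0; have le2 := IH (fun i => phi i.+1) (fun i => p0 i.+1).
have e2 : b ^+ n * phi 1%N <= binom a b n (fun i => phi i.+1).
  by apply: le_trans le2; rewrite lerDl !mulr_ge0 ?exprn_ge0.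
apply: le_trans (_ : a * (b ^+ n * phi 1%N) +
    b * (b ^+ n * phi 0%N + n%:R * a * b ^+ n.-1 * phi 1%N) <= _); last first.
  by rewrite lerD // ler_wpM2l.
rewrite le_eqVlt; apply/orP; left; apply/eqP.
case: n {IH le1 le2 e2} => [|n]; first by rewrite !mul0r !expr0 expr1; ring.
by rewrite /= [n.+2%:R]mulrSr !exprS; ring.
Qed.

(* In a block of n trials with n p of constant order, both 0 and 1 successes
   have probability at least 1/8, so j blocks reach every value up to j. *)
Lemma binom_blocks p n j phi : 0 <= p <= 1 -> 1 / 4 <= n%:R * p <= 1 / 2 ->
  (forall i, 0 <= phi i) ->
  (1 / 8) ^+ j * \sum_(i < j.+1) phi i <= binom p (1 - p) (j * n) phi.
Proof.
move=> /andP[p0 p1] /andP[np1 np2]; have q0 : 0 <= 1 - p by rewrite subr_ge0.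
have bern l : 1 - l%:R * p <= (1 - p) ^+ l.
  elim: l => [|l IHl]; first by rewrite mul0r subr0 expr0.
  rewrite exprS; apply: le_trans (ler_wpM2l q0 IHl).
  have -> : (1 - p) * (1 - l%:R * p) = 1 - l.+1%:R * p + l%:R * p * p.
    by rewrite -natr1; ring.
  by rewrite lerDl !mulr_ge0.
have block psi : (forall i, 0 <= psi i) ->
    1 / 8 * (psi 0%N + psi 1%N) <= binom p (1 - p) n psi.
  move=> psi0; apply: le_trans (binom_ge01 n p0 q0 psi0).
  have b1 : 1 / 2 <= (1 - p) ^+ n by have := bern n; lra.
  have b2 : 1 / 2 <= (1 - p) ^+ n.-1.
    apply: le_trans b1 _; case: n {np1 np2} => [|l] /=; first by [].
    by rewrite exprS ler_piMl ?exprn_ge0 // lerBlDr lerDl.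
  rewrite mulrDr lerD // ler_wpM2r //; first by lra.
  apply: le_trans (_ : 1 / 4 * (1 / 2) <= _); first by lra.
  by rewrite ler_pM //; lra.
elim: j phi => [|j IH] phi phi0; first by rewrite big_ord1 expr0 mul1r mul0n.
rewrite mulSn binom_add.
have gt8 : 0 <= (1 / 8 : R) ^+ j by rewrite exprn_ge0.
have s0 (psi : nat -> R) l : (forall i, 0 <= psi i) -> 0 <= \sum_(i < l) psi i.
  by move=> psi0; apply: sumr_ge0.
have pos i : 0 <= binom p (1 - p) (j * n) (fun l => phi (i + l)%N).
  by apply: le_trans (IH _ (fun l => phi0 (i + l)%N)); rewrite mulr_ge0 // sumr_ge0.
apply: le_trans (block _ pos).
rewrite exprS -mulrA ler_wpM2l //.
apply: le_trans (_ : (1 / 8) ^+ j * (\sum_(i < j.+1) phi i + \sum_(i < j.+1) phi i.+1) <= _).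
  rewrite ler_wpM2l // big_ord_recl [\sum_(i < j.+1) phi i]big_ord_recl /=.
  by have := s0 (fun i => phi i.+1) j (fun i => phi0 i.+1); rewrite /bump /=; lra.
by rewrite mulrDr lerD // IH.
Qed.

End Binomial.

Section Residues.
Variable R : realType.
Implicit Types (p : R) (phi : nat -> R).

(** Taking n about 1 / (2 p) puts n p between 1/4 and 1/2. Whatever count i the trials outside k - 1
    blocks of length n produce, the blocks extend it to each of i, ..., i + k - 1 with probability
    at least 8^-(k-1), and phi has total weight at least 1 there. *)
Lemma binom_covering p N k phi : 0 < p <= 1 / 2 -> (0 < k)%N ->
  (forall i, 0 <= phi i) -> (forall i, 1 <= \sum_(j < k) phi (i + j)%N) ->
  k%:R <= N%:R * p -> (1 / 8) ^+ k.-1 <= binom p (1 - p) N phi.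
Proof.
move=> /andP[p0 p2] k0 phi0 cov kN; set n := Num.truncn (1 / (2 * p)).
have p2_gt0 : 0 < 2 * p by lra.
have /andP[n1 n2] : n%:R <= 1 / (2 * p) < n.+1%:R.
  by apply: truncn_itv; rewrite divr_ge0 // ltW.
have n3 : n%:R * p <= 1 / 2.
  by move: n1; rewrite ler_pdivlMr //; lra.
have n4 : 1 < n.+1%:R * (2 * p) by move: n2; rewrite ltr_pdivrMr.
have n0 : (0 < n)%N.
  by rewrite lt0n; apply/eqP => n0; move: n4; rewrite n0; lra.
have n5 : 1 / 4 <= n%:R * p.
  have : p <= n%:R * p by rewrite ler_peMl ?(ltW p0) // ler1n.
  by move: n4; rewrite -natr1; lra.
have leN : (k.-1 * n <= N)%N.
  rewrite -(ler_nat R) natrM -(ler_pM2r p0); apply: le_trans kN.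
  rewrite -mulrA; apply: le_trans (_ : k%:R * (n%:R * p) <= _).
    by rewrite ler_wpM2r ?ler_nat ?leq_pred //; lra.
  by rewrite ler_piMr //; lra.
rewrite -(subnK leN) binom_add.
have q0 : 0 <= 1 - p by lra.
apply: le_trans (_ : binom p (1 - p) (N - k.-1 * n) (fun=> (1 / 8) ^+ k.-1) <= _).
  by rewrite binom_cst subrKC expr1n [1 * _ ^+ _]mul1r.
apply: le_binom => [||i]; [exact: ltW|by []|].
apply: le_trans (@binom_blocks R p n k.-1 _ _ _ _); last 3 first.
- by apply/andP; split; lra.
- by apply/andP; split; lra.
- by [].
by rewrite prednK // ler_peMr // exprn_ge0.
Qed.

Lemma residue_covering k s t : (0 < k)%N ->
  1 <= \sum_(j < k) (s + j == t %[mod k])%N%:R :> R.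
Proof.
move=> k0; pose j := ((t + (k - 1) * s) %% k)%N.
have jk : (j < k)%N by rewrite ltn_mod.
rewrite (bigD1 (Ordinal jk)) //= (_ : (s + j == t %[mod k])%N).
  by rewrite lerDl sumr_ge0.
by rewrite /j modnDmr; apply/eqP/addn_pred_mod.
Qed.

Lemma binom_mod p N k s t : (0 < k)%N -> 0 < p < 1 ->
  k%:R <= N%:R * p * (1 - p) ->
  (1 / 8) ^+ k.-1 <= binom p (1 - p) N (fun i => (s + i == t %[mod k])%N%:R).
Proof.
move=> k0 /andP[p0 p1] kN; have Np : 0 <= N%:R * p by rewrite mulr_ge0 // ltW.
have [p2|p2] := leP p (1 / 2).
  apply: binom_covering; rewrite ?p0 //.
    by move=> i; under eq_bigr do rewrite addnA; apply: residue_covering.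
  by apply: le_trans kN _; rewrite ler_piMr //; lra.
(* For p > 1/2 the failures are counted instead, so that the success probability is again at most
   1/2. *)
rewrite (@binom_rev R p (1 - p) N _ (fun l => (t + l == s + N %[mod k])%N%:R)); last first.
  by move=> i iN; rewrite -(eqn_modDr (N - i)) -addnA subnKC // eq_sym.
rewrite -{2}[p](subKr 1); apply: binom_covering => //.
- by apply/andP; split; lra.
- by move=> i; under eq_bigr do rewrite addnA; apply: residue_covering.
- apply: le_trans kN _; rewrite mulrAC ler_piMr //; last by lra.
  by rewrite mulr_ge0 //; lra.
Qed.

End Residues.

Lemma prod_bool (R : realType) (J : finType) (A : {set J}) (P : pred J) :
  \prod_(j in A) (P j)%:R = [forall j in A, P j]%:R :> R.
Proof.
case: forall_inP => [AP|nAP]; first by rewrite big1 // => j /AP ->.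
have /exists_inP[j jA Pj] : [exists j in A, ~~ P j].
  by rewrite -negb_forall_in; apply/forall_inP.
by rewrite (bigD1 j) //= (negbTE Pj) mul0r.
Qed.

(** * Residues randomised through a reservoir *)

Section Good.
Variables (R : realType) (V J : finType) (k r : nat) (p : R).
Hypotheses (k0 : (0 < k)%N) (r0 : (0 < r)%N) (p01 : 0 < p < 1).

Definition rsets : {set {set V}} := [set e : {set V} | #|e| == r].

(** These hyperedges influence the degree of w and of no other vertex outside [R']; stars of
    distinct vertices outside [R'] are disjoint. *)
Definition star (R' : {set V}) (w : V) : {set {set V}} :=
  [set e : {set V} | [&& #|e| == r, w \in e & e :\ w \subset R']].

Variables (R' h : {set V}) (A : {set J}) (y : J -> {set V}) (rho : nat).

Lemma card_star w : w \notin R' -> #|star R' w| = 'C(#|R'|, r.-1).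
Proof.
move=> wR; rewrite -cards_draws -(card_in_imset (f := fun S => w |: S)).
  apply: eq_card => e; rewrite inE; apply/and3P/imsetP => [[/eqP ce we eR]|].
    exists (e :\ w); last by rewrite setD1K.
    by rewrite inE eR -ce (cardsD1 w e) we /=.
  move=> [S]; rewrite inE => /andP[SR /eqP cS] ->.
  have wS : w \notin S by apply: contra wR; apply: (subsetP SR).
  by rewrite cardsU1 wS cS add1n prednK // setU11 setU1K.
move=> S S'; rewrite !inE => /andP[SR _] /andP[S'R _].
by apply: setU1_injl; apply: contra wR; apply: subsetP.
Qed.

Hypothesis kR : k%:R <= 'C(#|R'|, r.-1)%:R * p * (1 - p).

(** Once the hyperedges outside the star are fixed, the degree of w is a constant plus a binomial
    variable. *)
Lemma expect_star_residue (K : hypergraph V) w : w \notin R' ->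
  [disjoint K & star R' w] ->
  (1 / 8) ^+ k.-1 <= expect p (1 - p) (star R' w)
    (fun L => (hdegree (K :|: L) w == rho %[mod k])%N%:R).
Proof.
move=> wR dK; rewrite (@eq_expect _ _ _ _ _ _
    (fun L => (hdegree K w + #|L| == rho %[mod k])%N%:R)).
  rewrite (expect_card _ _ _ (fun i => (hdegree K w + i == rho %[mod k])%N%:R)).
  by rewrite card_star //; apply: binom_mod.
move=> L LS; rewrite hdegreeU; last exact: disjointWr LS dK.
rewrite [hdegree L w](_ : _ = #|L|) //; apply: eq_card => e; rewrite inE.
by apply: andb_idr => /(subsetP LS); rewrite inE => /and3P[].
Qed.

Hypotheses (hn0 : h != set0) (hR : [disjoint h & R']).
Hypotheses (yn0 : forall j, j \in A -> y j != set0).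
Hypotheses (cyh : forall j, j \in A -> #|y j :|: h| = r).
Hypotheses (yh : forall j, j \in A -> [disjoint y j & h]).
Hypotheses (yR : forall j, j \in A -> [disjoint y j & R']).
Hypotheses (dy : forall i j, i \in A -> j \in A -> i != j -> [disjoint y i & y j]).

(* Whether j is good depends, apart from hyperedges outside every own set, only on
   own j, and these sets are disjoint. *)
Definition good j (H : hypergraph V) : bool :=
  (y j :|: h \in H) && (y j \subset residue k H rho).

Let own j := (y j :|: h) |: \bigcup_(w in y j) star R' w.
Let c : R := (1 / 8) ^+ k.-1.

Lemma star_mem w w' (e : {set V}) : e \in star R' w' -> w \in e -> w \notin R' -> w = w'.
Proof.
rewrite inE => /and3P[_ _ /subsetP eR] we; apply: contraNeq => ww.
by apply: eR; rewrite !inE ww.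
Qed.

Lemma yh_notin_star j w : w \notin h -> y j :|: h \notin star R' w.
Proof.
move=> wh; have /set0Pn[x xh] := hn0; apply/negP => st.
have := star_mem st (_ : x \in y j :|: h).
rewrite inE xh orbT (disjointFr hR xh) => /(_ isT isT) xw.
by rewrite -xw xh in wh.
Qed.

Lemma own_notin i j w (e : {set V}) : i \in A -> j \in A -> i != j -> w \in y i ->
  e \in own j -> w \notin e.
Proof.
move=> iA jA ij wi; rewrite in_setU1 => /orP[/eqP ->|/bigcupP[w' w'j st]].
  by rewrite inE (disjointFr (dy iA jA ij) wi) (disjointFr (yh iA) wi).
apply/negP => we; have := star_mem st we; rewrite (disjointFr (yR iA) wi).
by move=> /(_ isT) ww; have := disjointFr (dy iA jA ij) wi; rewrite ww w'j.
Qed.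

Lemma own_meet i (e : {set V}) : i \in A -> e \in own i -> exists2 w, w \in y i & w \in e.
Proof.
move=> iA; rewrite in_setU1 => /orP[/eqP ->|/bigcupP[w wi]].
  by have /set0Pn[w wi] := yn0 iA; exists w; rewrite // inE wi.
by rewrite inE => /and3P[_ we _]; exists w.
Qed.

Lemma own_disjoint i j : i \in A -> j \in A -> i != j -> [disjoint own i & own j].
Proof.
move=> iA jA ij; rewrite disjoint_subset; apply/subsetP => e ei; rewrite inE.
have [w wi we] := own_meet iA ei; apply/negP => ej.
by have := @own_notin i j w e iA jA ij wi ej; rewrite we.
Qed.

Lemma hdegreeU_notin (K L : hypergraph V) w : (forall e : {set V}, e \in L -> w \notin e) ->
  hdegree (K :|: L) w = hdegree K w.
Proof.
move=> Lw; apply: eq_card => e; rewrite !inE.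
by have [/Lw/negbTE->|_] := boolP (e \in L); rewrite ?andbF ?orbF.
Qed.

Lemma good_indep i j (K L : hypergraph V) : i \in A -> j \in A -> i != j ->
  L \subset own j -> good i (K :|: L) = good i K.
Proof.
move=> iA jA ij LD; congr (_ && _).
  rewrite inE; apply/orb_idr => /(subsetP LD) ej.
  have /set0Pn[w wi] := yn0 iA.
  by have := @own_notin i j w _ iA jA ij wi ej; rewrite inE wi.
have resE w : w \in y i -> (w \in residue k (K :|: L) rho) = (w \in residue k K rho).
  move=> wi; rewrite !in_set hdegreeU_notin // => e /(subsetP LD).
  exact: (@own_notin i j w e).
apply/subsetP/subsetP => sub w wi; first by rewrite -resE // sub.
by rewrite resE // sub.
Qed.

(** The hyperedge itself costs the factor p; given it, the disjoint stars of the vertices of [y j]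
    hit the residue independently, each at cost c. *)
Lemma good_prob j (K : hypergraph V) : j \in A -> [disjoint K & own j] ->
  p * c ^+ #|y j| <= expect p (1 - p) (own j) (fun L => (good j (K :|: L))%:R).
Proof.
move=> jA dK; have /andP[p0 p1] := p01.
have p0' := ltW p0; have q0 : 0 <= 1 - p by lra.
have wh w : w \in y j -> w \notin h by move=> wj; rewrite (disjointFr (yh jA) wj).
have wR w : w \in y j -> w \notin R' by move=> wj; rewrite (disjointFr (yR jA) wj).
set e0 := y j :|: h; set S := \bigcup_(w in y j) star R' w.
have e0S : e0 \notin S by apply/bigcupP => -[w /wh wnh]; apply/negP/yh_notin_star.
rewrite expectU1 //.
set X := expect _ _ S _; set Y := expect _ _ S _.
apply: (le_trans (y := p * X)); last first.
  by rewrite lerDl mulr_ge0 // /Y; apply: sumr_ge0 => L _; rewrite !mulr_ge0 ?exprn_ge0.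
rewrite ler_wpM2l //.
have K0S w : w \in y j -> [disjoint K :|: [set e0] & star R' w].
  move=> wj; rewrite disjoints_subset subUset -!disjoints_subset disjoints1.
  rewrite yh_notin_star ?wh // andbT; apply: disjointWr dK.
  by apply: subset_trans (bigcup_sup w wj) (subsetUr _ _).
rewrite {}/X (@eq_expect _ _ _ _ _ _ (fun L => \prod_(w in y j)
    (hdegree ((K :|: [set e0]) :|: L) w == rho %[mod k])%N%:R)); last first.
  move=> L _; rewrite prod_bool; congr (_%:R); rewrite setUA /good !inE eqxx orbT /=.
  congr nat_of_bool; apply/subsetP/forall_inP => yS w wj.
    by have := yS w wj; rewrite inE.
  by rewrite inE; apply: yS.
apply: (@expect_prod_ge R {set V} V p (1 - p) p0' q0 (star R')).
- by rewrite exprn_ge0.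
- by move=> w L; rewrite ler0n.
- by rewrite subrKC.
- by move=> w wj; apply: (bigcup_sup w wj).
- move=> w w' wj w'j ww; rewrite disjoint_subset; apply/subsetP => e ew; rewrite inE.
  apply: contra ww => ew'; apply/eqP; apply: (star_mem ew') (wR w wj).
  by move: ew; rewrite inE => /and3P[].
- move=> w w' L L' wj w'j ww L'S; rewrite setUA hdegreeU_notin // => e /(subsetP L'S) ew'.
  by apply: contra ww => we; apply/eqP; apply: (star_mem ew' we (wR w wj)).
- move=> w L wj LS; under eq_expect => L' _ do rewrite setUA.
  apply: expect_star_residue; first exact: wR.
  rewrite disjoints_subset subUset -!disjoints_subset K0S //=.
  rewrite disjoint_subset; apply/subsetP => e /(subsetP LS).
  by rewrite !inE => /andP[].
Qed.

(** Exponential moments: exp(-1) <= 1/2 bounds each conditional factor by 1 - q / 2 <= exp(-q / 2)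
    with [q = p * c ^+ s], and the bounds multiply over the own sets. This serves both h = {x} with
    groups [y j], and an (r-1)-set h with singletons [y j]. *)
Lemma few_good s a : (forall j, j \in A -> (#|y j| <= s)%N) ->
  expect p (1 - p) rsets
    (fun H => (#|[set j in A | good j H]|%:R < a)%R%:R) <=
  expR (a - p * c ^+ s / 2 * #|A|%:R).
Proof.
move=> ys; have /andP[p0 p1] := p01.
have p0' := ltW p0; have q0 : 0 <= 1 - p by lra.
have c0 : 0 <= c by rewrite exprn_ge0.
have c1 : c <= 1 by rewrite exprn_ile1 //; lra.
pose psi j (H : hypergraph V) : R := expR (- (good j H)%:R).
apply: le_trans (_ : expect p (1 - p) rsets (fun H => expR a * \prod_(j in A) psi j H) <= _).
  apply: le_expect => // H _; rewrite -expR_sum -expRD sumrN.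
  have -> : \sum_(j in A) (good j H)%:R = #|[set j in A | good j H]|%:R :> R.
    rewrite -natr_sum; congr (_%:R); rewrite -sum1_card big_mkcond [RHS]big_mkcond /=.
    by apply: eq_bigr => j _; rewrite inE; case: (j \in A); case: (good j H).
  case: ltP => [Xa|_]; last exact: expR_ge0.
  by rewrite (_ : true%:R = expR 0 :> R); [rewrite ler_expR subr_ge0 ltW|rewrite expR0].
rewrite expectZ expRD ler_wpM2l ?expR_ge0 // -mulNr mulrC expRM_natl.
have e2 : expR (-1) <= 1 / 2 :> R.
  rewrite expRN div1r lef_pV2 ?posrE ?expR_gt0 //.
  by have := expR_ge1Dx (1 : R); lra.
apply: (@expect_prod_le R {set V} J p (1 - p) p0' q0 own) => //.
- by move=> j H; apply: expR_ge0.
- by rewrite subrKC.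
- move=> j jA; apply/subsetP => e; rewrite in_setU1 inE => /orP[/eqP ->|/bigcupP[w _]].
    by rewrite cyh.
  by rewrite inE => /and3P[].
- exact: own_disjoint.
- by move=> i j K L iA jA ij LD; rewrite /psi (@good_indep i j).
- move=> j K jA KU; have dK : [disjoint K & own j].
    rewrite disjoint_subset; apply/subsetP => e /(subsetP KU).
    by rewrite inE => /andP[].
  apply: le_trans (_ : expect p (1 - p) (own j)
      (fun L => 1 + - (1 / 2) * (good j (K :|: L))%:R) <= _).
    apply: le_expect => // L _; rewrite /psi; case: (good _ _) => /=.
      by rewrite mulr1; apply: le_trans e2 _; lra.
    by rewrite oppr0 expR0 mulr0 addr0.
  rewrite expectD expectZ expect_cst subrKC expr1n mulr1.
  apply: le_trans (expR_ge1Dx _); rewrite lerD2l mulNr lerN2.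
  have := good_prob jA dK; set G := expect _ _ _ _ => Gge.
  have : p * c ^+ s <= p * c ^+ #|y j| by rewrite ler_wpM2l // ler_wiXn2l ?ys.
  lra.
Qed.

End Good.

(** * Tail bounds for the number of pairs *)

Section PairTails.
Variables (R : realType) (V : finType) (r : nat) (p : R).
Hypotheses (p01 : 0 < p < 1) (r1 : (1 < r)%N).
Variables (S : {set V}) (T : {set {set V}}).
Hypotheses (tT : trivIset T) (cT : forall g, g \in T -> #|g| = r.-1).
Hypothesis dST : [disjoint S & cover T].

Let F : {set {set V}} := [set q.1 |: q.2 | q in setX S T].

Let SnT x g : x \in S -> g \in T -> x \notin g.
Proof.
move=> xS gT; apply/negP => xg; have := disjointFr dST xS.
by move/negP; apply; apply/bigcupP; exists g.
Qed.

(** Injectivity turns [pairs] into a count of distinct potential hyperedges, hence into a binomial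
    variable. *)
Let injF : {in setX S T &, injective (fun q : V * {set V} => q.1 |: q.2)}.
Proof.
move=> [x g] [x' g']; rewrite !in_setX /= => /andP[xS gT] /andP[x'S g'T] e.
have gg' : g = g'.
  apply/eqP/negPn/negP => ngg; have dg := trivIsetP tT _ _ gT g'T ngg.
  have : (0 < #|g|)%N by rewrite cT // -subn1 subn_gt0.
  move=> /card_gt0P[v vg]; have : v \in x' |: g' by rewrite -e !inE vg orbT.
  rewrite !inE (disjointFr dg vg) orbF => /eqP vx.
  by have := SnT x'S gT; rewrite -vx vg.
by move: e; rewrite -gg' => e; rewrite (setU1_injr (SnT xS gT) (SnT x'S gT) e).
Qed.

Let cardF : #|F| = (#|S| * #|T|)%N.
Proof. by rewrite /F card_in_imset // cardsX. Qed.

Let F_rsets : F \subset rsets V r.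
Proof.
apply/subsetP => e /imsetP[[x g]]; rewrite in_setX /= => /andP[xS gT] ->.
by rewrite inE cardsU1 SnT // cT // add1n prednK // ltnW.
Qed.

Let pairsE H : pairs H S T = #|H :&: F|.
Proof.
rewrite /pairs -(card_in_imset (f := fun q : V * {set V} => q.1 |: q.2)).
  apply: eq_card => e; rewrite inE; apply/imsetP/andP.
    move=> [[x g]]; rewrite inE /= => /and3P[xS gT eH] ->; split=> //.
    by apply/imsetP; exists (x, g); rewrite // in_setX xS gT.
  move=> [eH /imsetP[[x g]]]; rewrite in_setX /= => /andP[xS gT] ee.
  by exists (x, g); rewrite // inE /= xS gT -ee.
move=> q q'; rewrite !inE => /and3P[q1 q2 _] /and3P[q1' q2' _].
by apply: injF; rewrite inE ?q1 ?q1'.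
Qed.

Lemma expR1_le4 : expR 1 <= 4 :> R.
Proof.
have -> : expR 1 = expR (1 / 2) * expR (1 / 2) :> R.
  by rewrite -expRD; congr expR; lra.
have := expR_ge1Dx (- (1 / 2) : R); rewrite expRN.
have e0 : 0 < expR (1 / 2) :> R by apply: expR_gt0.
rewrite -(ler_pM2l e0) mulfV ?gt_eqF // => h.
have h2 : expR (1 / 2) <= 2 :> R by lra.
by nra.
Qed.

(** The constant 3 comes from e <= 4: a single potential hyperedge has exponential moment 1 + (e -
    1) p <= exp(3 p). *)
Lemma pairs_upper_tail b :
  expect p (1 - p) (rsets V r) (fun H => (3 * p * #|S|%:R * #|T|%:R + b < (pairs H S T)%:R)%R%:R)
    <= expR (- b).
Proof.
have /andP[p0 p1] := p01; have p0' := ltW p0; have q0 : 0 <= 1 - p by lra.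
set a := 3 * p * _ * _ + b.
apply: le_trans (_ : expect p (1 - p) (rsets V r)
    (fun H => expR (- a) * expR 1 ^+ #|H :&: F|) <= _).
  apply: le_expect => // H _; rewrite pairsE -expRM_natr mul1r -expRD.
  case: ltP => [Xa|_]; last exact: expR_ge0.
  by rewrite (_ : true%:R = expR 0 :> R); [rewrite ler_expR addrC subr_ge0 ltW|rewrite expR0].
rewrite expectZ expect_exp_card // subrKC expr1n mulr1.
have -> : - b = - a + 3 * p * #|S|%:R * #|T|%:R by rewrite /a; ring.
rewrite expRD ler_wpM2l ?expR_ge0 // -mulrA -natrM -cardF expRM_natr lerXn2r ?nnegrE ?expR_ge0 //.
  by rewrite addr_ge0 // mulr_ge0 // expR_ge0.
apply: le_trans (expR_ge1Dx _); have := expR1_le4; nra.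
Qed.

(** The factor 1/2 comes from 1 - 1/e >= 1/2, so that the negative exponential moment is at most
    exp(-p / 2). *)
Lemma pairs_lower_tail b :
  expect p (1 - p) (rsets V r) (fun H => ((pairs H S T)%:R < p * #|S|%:R * #|T|%:R / 2 - b)%R%:R)
    <= expR (- b).
Proof.
have /andP[p0 p1] := p01; have p0' := ltW p0; have q0 : 0 <= 1 - p by lra.
set a := p * _ * _ / 2 - b.
apply: le_trans (_ : expect p (1 - p) (rsets V r)
    (fun H => expR a * expR (- 1) ^+ #|H :&: F|) <= _).
  apply: le_expect => // H _; rewrite pairsE -expRM_natr mulN1r -expRD.
  case: ltP => [Xa|_]; last exact: expR_ge0.
  by rewrite (_ : true%:R = expR 0 :> R); [rewrite ler_expR subr_ge0 ltW|rewrite expR0].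
rewrite expectZ expect_exp_card // subrKC expr1n mulr1.
have -> : - b = a + (- (p / 2)) * (#|S| * #|T|)%:R by rewrite /a natrM; field.
rewrite [X in _ <= X]expRD ler_wpM2l ?expR_ge0 // -cardF expRM_natr lerXn2r ?nnegrE ?expR_ge0 //.
  by rewrite addr_ge0 // mulr_ge0 // expR_ge0.
apply: le_trans (expR_ge1Dx _).
have e2 : expR (-1) <= 1 / 2 :> R.
  rewrite expRN div1r lef_pV2 ?posrE ?expR_gt0 //.
  by have := expR_ge1Dx (1 : R); lra.
nra.
Qed.

End PairTails.

(** * Choice of the parts and union bound *)

Local Open Scope nat_scope.

Section IntervalLayout.
Variables (n k r m L : nat).
Definition itv a b : {set 'I_n} := [set v : 'I_n | a <= v < b].

Lemma card_itv a b : b <= n -> #|itv a b| = b - a.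
Proof.
move=> bn; have lt (i : 'I_(b - a)) : a + i < n by have := ltn_ord i; lia.
have -> : itv a b = [set Ordinal (lt i) | i : 'I_(b - a)].
  apply/setP => v; rewrite inE; apply/andP/imsetP => [[av vb]|[i _ ->] /=].
    have vi : v - a < b - a by lia.
    by exists (Ordinal vi) => //; apply: val_inj => /=; rewrite subnKC.
  by have := ltn_ord i; split; lia.
rewrite card_imset ?card_ord // => i j /(congr1 val)/= /addnI; exact: val_inj.
Qed.

Lemma block_uniq a a' b (v : nat) : a * b <= v < a.+1 * b -> a' * b <= v < a'.+1 * b -> a = a'.
Proof.
move=> /andP[h1 h2] /andP[h3 h4]; have b0 : 0 < b by case: b h1 h2 {h3 h4} => //; lia.
have := leq_ltn_trans h1 h4; rewrite ltn_pmul2r // => aa'.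
have := leq_ltn_trans h3 h2; rewrite ltn_pmul2r // => a'a.
by lia.
Qed.

Hypotheses (r_gt1 : 1 < r) (m_gt0 : 0 < m).

(** Part t fills the interval from t M to (t + 1) M: m consecutive groups, then a block of m L
    single vertices. The reservoir is everything after the last part. *)
Let M := m * r.-1 + m * L.
Hypothesis nM : k.+2 * M <= n.

Definition igroup t i : {set 'I_n} :=
  itv (t * M + i * r.-1) (t * M + i.+1 * r.-1).
Definition igroups t : {set {set 'I_n}} := [set igroup t i | i : 'I_m].
Definition iblock t : {set 'I_n} := itv (t * M + m * r.-1) (t.+1 * M).
Definition irest : {set 'I_n} := itv (k.+2 * M) n.

Let r1 : 0 < r.-1. Proof. by rewrite -subn1 subn_gt0. Qed.

Lemma igroup_part t i v : i < m -> v \in igroup t i ->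
  t * M <= v < t * M + m * r.-1.
Proof.
rewrite inE => im /andP[h1 h2]; rewrite (leq_trans _ h1) ?leq_addr //=.
by apply: leq_trans h2 _; rewrite leq_add2l leq_mul2r im orbT.
Qed.

Lemma cover_igroups t v : v \in cover (igroups t) -> t * M <= v < t * M + m * r.-1.
Proof. by move=> /bigcupP[_ /imsetP[i _ ->]]; apply: igroup_part. Qed.

Lemma part_itv t v : v \in part igroups iblock t -> t * M <= v < t.+1 * M.
Proof.
rewrite in_setU mulSn => /orP[/cover_igroups|]; rewrite ?inE /M; lia.
Qed.

Lemma igroup_uniq t i t' i' v : i < m -> i' < m ->
  v \in igroup t i -> v \in igroup t' i' -> t = t' /\ i = i'.
Proof.
move=> im i'm vt vt'.
have tt : t = t'.
  apply: (@block_uniq _ _ M v); [have := igroup_part im vt | have := igroup_part i'm vt'];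
    by rewrite mulSn /M; lia.
split=> //; move: vt vt'; rewrite -tt !inE => h h'.
by apply: (@block_uniq _ _ r.-1 (v - t * M)); lia.
Qed.

Lemma igroup_card t i : t < k.+2 -> i < m -> #|igroup t i| = r.-1.
Proof.
move=> tk im; rewrite card_itv; first by rewrite subnDl mulSn addnK.
apply: leq_trans nM; apply: leq_trans (_ : t.+1 * M <= _); last by rewrite leq_mul2r tk orbT.
have : i.+1 * r.-1 <= m * r.-1 by rewrite leq_mul2r im orbT.
by rewrite mulSn /M; lia.
Qed.

Lemma in_groups g : g \in groups k igroups -> exists t i, [/\ t < k.+2, i < m & g = igroup t i].
Proof. by move=> /bigcupP[t _ /imsetP[i _ ->]]; exists t, i. Qed.

Lemma interval_layout : layout k r m L igroups iblock irest.
Proof.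
split.
- apply/trivIsetP => _ _ /in_groups[t [i [tk im ->]]] /in_groups[t' [i' [tk' im' ->]]] ng.
  rewrite disjoint_subset; apply/subsetP => v vg; rewrite inE.
  apply: contra ng => vg'; have [-> ->] := igroup_uniq im im' vg vg'.
  exact: eqxx.
- by move=> _ /in_groups[t [i [tk im ->]]]; apply: igroup_card.
- move=> t tk; rewrite /igroups card_imset ?card_ord // => i i' e.
  have : 0 < #|igroup t i| by rewrite igroup_card.
  move=> /card_gt0P[v vi]; apply: val_inj.
  by have [] := @igroup_uniq t i t i' v (ltn_ord i) (ltn_ord i') vi _; rewrite -?e.
- move=> t tk; rewrite card_itv.
    by rewrite mulSn /M; lia.
  by apply: leq_trans nM; rewrite leq_mul2r tk orbT.
- move=> t tk; rewrite disjoint_subset; apply/subsetP => v vB; rewrite inE.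
  apply/negP => /bigcupP[_ /in_groups[t' [i [tk' im ->]]] vg].
  have h := igroup_part im vg.
  have tt : t = t'.
    apply: (@block_uniq _ _ M v); last by move: h; rewrite mulSn /M; lia.
    by apply: part_itv; rewrite in_setU vB orbT.
  by move: vB h; rewrite inE tt; lia.
- by move=> t t' v tk tk' /part_itv h /part_itv; apply: block_uniq h.
- move=> t tk; rewrite disjoint_subset; apply/subsetP => v; rewrite inE => /andP[h _].
  rewrite inE; apply/negP => /part_itv /andP[_].
  rewrite ltnNge => /negP; apply; apply: leq_trans h.
  by rewrite leq_mul2r tk orbT.
Qed.

End IntervalLayout.

Local Open Scope ring_scope.

Lemma sum_indicator_lt1 (R : realType) (J : finType) (P : pred J) (b : J -> bool) :
  \sum_(j | P j) (b j)%:R < 1 :> R -> forall j, P j -> ~~ b j.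
Proof.
move=> lt1 j Pj; apply/negP => bj; move: lt1; rewrite (bigD1 j) //= bj ltNge.
by rewrite lerDl sumr_ge0.
Qed.

Lemma sum_powerset (R : realType) (I : finType) (D : {set I}) (z : R) :
  \sum_(K in powerset D) z ^+ #|K| = (1 + z) ^+ #|D|.
Proof.
rewrite addrC -[RHS]mulr1 -(expect_cst z 1 D 1); apply: eq_bigr => K _.
by rewrite expr1n !mulr1.
Qed.

(** * Union bound for pseudorandomness *)

Section UnionBound.
Variables (R : realType) (V : finType) (k r m L : nat).
Variables (G : nat -> {set {set V}}) (B : nat -> {set V}) (R0 : {set V}).
Variables (p lam eta : R).
Hypotheses (k_gt1 : (1 < k)%N) (r_gt1 : (1 < r)%N) (lay : layout k r m L G B R0).
Hypothesis p01 : 0 < p < 1.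
Hypothesis kR : k%:R <= 'C(#|R0| - r, r.-1)%:R * p * (1 - p).
Hypothesis etaE : eta = ((1 / 8) ^+ k.-1) ^+ r.-1 / 8.
Hypotheses (m_gt1 : (1 < m)%N) (L_ge : (2 * r <= L)%N) (L_eta : 8 <= eta * L%:R).

Let GG := groups k G.
Let N := #|V|.

Definition few_links (q : V * 'I_k.+2 * 'I_k) (H : hypergraph V) : bool :=
  #|[set g in G q.1.2 | [&& q.1.1 \notin g, q.1.1 |: g \in H
      & g \subset residue k H q.2]]|%:R < eta * p * m%:R.

Definition few_colinks (q : {set V} * 'I_k.+2 * 'I_k) (H : hypergraph V) : bool :=
  #|[set x in B q.1.2 | [&& x \notin q.1.1, x |: q.1.1 \in H
      & x \in residue k H q.2]]|%:R < 8 * p * m%:R.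

Let eta_gt0 : 0 < eta. Proof. by rewrite etaE !divr_gt0 ?exprn_gt0. Qed.
Let p0 : 0 < p. Proof. by case/andP: p01. Qed.
Let q0 : 0 <= 1 - p. Proof. by case/andP: p01 => _ ?; rewrite subr_ge0 ltW. Qed.
Let k_gt0 : (0 < k)%N. Proof. exact: ltnW. Qed.
Let r_gt0 : (0 < r)%N. Proof. exact: ltnW. Qed.
Let r1 : (0 < r.-1)%N. Proof. by rewrite -subn1 subn_gt0. Qed.

Lemma kR_sub (h : {set V}) : (#|h| <= r)%N ->
  k%:R <= 'C(#|R0 :\: h|, r.-1)%:R * p * (1 - p).
Proof.
move=> hr; apply: le_trans kR _; rewrite !ler_wpM2r ?(ltW p0) // ler_nat.
apply: leq_bin2l; rewrite cardsD leq_sub2l //.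
by apply: leq_trans hr; apply/subset_leq_card/subsetIr.
Qed.

Lemma group_in_GG t g : (t < k.+2)%N -> g \in G t -> g \in GG.
Proof. by move=> tk gG; apply/bigcupP; exists (Ordinal tk). Qed.

Lemma few_links_prob q :
  expect p (1 - p) (rsets V r) (fun H => (few_links q H)%:R) <= expR (- (eta * p * m%:R)).
Proof.
case: q => [[x t] rho]; pose A := [set g in G t | x \notin g].
have AG g : g \in A -> [/\ g \in G t, g \in GG & x \notin g].
  by rewrite inE => /andP[gG xg]; split=> //; apply: group_in_GG gG.
have gR g : g \in A -> [disjoint R0 & g].
  move=> /AG[gG _ _]; apply: disjointWr (layout_rest lay (ltn_ord t)).
  by apply: subset_trans (subsetUl _ _); apply: bigcup_sup.
have cA : (m.-1 <= #|A|)%N.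
  have : (#|G t :\: A| <= 1)%N.
    apply/card_le1_eqP => g g'; rewrite !inE.
    move=> /andP[+ gG] /andP[+ g'G]; rewrite gG g'G !negbK => xg xg'.
    apply/eqP/negPn/negP => ng; have := trivIsetP (layout_triv lay) _ _
      (group_in_GG (ltn_ord t) g'G) (group_in_GG (ltn_ord t) gG) ng.
    by move=> /disjointFr/(_ xg'); rewrite xg.
  have AGt : A \subset G t by apply/subsetP => g /AG[].
  rewrite cardsD (setIidPr AGt) (layout_cardG lay (ltn_ord t)).
  by clear; lia.
apply: le_trans (_ : expect p (1 - p) (rsets V r) (fun H => (#|[set g in A |
   good k [set x] (fun g => g) rho g H]|%:R < eta * p * m%:R)%R%:R) <= _).
  apply: le_expect => // [|H _]; first exact: ltW.
  rewrite /few_links /= (_ : [set g in G t | _] = [set g in A | good k [set x] (fun g => g) rho g H]) //.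
  by apply/setP => g; rewrite !inE /good setUC -!andbA.
apply: le_trans (_ : expR (eta * p * m%:R - p * ((1 / 8) ^+ k.-1) ^+ r.-1 / 2 * #|A|%:R) <= _).
  apply: (@few_good R V _ k r p k_gt0 r_gt0 p01 (R0 :\ x)).
  - by apply: kR_sub; rewrite cards1.
  - by rewrite -card_gt0 cards1.
  - by rewrite disjoints1 !inE eqxx.
  - move=> g /AG[_ gGG _]; rewrite -card_gt0 (layout_size lay gGG) //.
  - move=> g /AG[_ gGG xg]; rewrite setUC cardsU1 xg (layout_size lay gGG).
    by rewrite add1n prednK.
  - by move=> g /AG[_ _ xg]; rewrite disjoint_sym disjoints1.
  - move=> g gA; rewrite disjoint_sym; apply: disjointWl (gR g gA).
    exact: subsetDl.
  - by move=> g g' /AG[_ gGG _] /AG[_ g'GG _]; apply: (trivIsetP (layout_triv lay)).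
  - by move=> g /AG[_ gGG _]; rewrite (layout_size lay gGG).
(* Here lies the origin of the 1/8 in [eta]: as [#|A|] is at least m / 2, the exponent is at most
   eta p m - 2 eta p m. *)
rewrite ler_expR (_ : ((1 / 8) ^+ k.-1) ^+ r.-1 = 8 * eta); last by rewrite etaE; field.
have : m%:R <= 2 * #|A|%:R :> R.
  by rewrite -natrM ler_nat; move: cA m_gt1; clear; lia.
move=> mA; have : 0 <= (p * eta) * (2 * #|A|%:R - m%:R).
  by rewrite mulr_ge0 ?subr_ge0 // mulr_ge0 // ltW.
lra.
Qed.

Lemma few_colinks_prob (q : {set V} * 'I_k.+2 * 'I_k) : #|q.1.1| = r.-1 ->
  expect p (1 - p) (rsets V r) (fun H => (few_colinks q H)%:R) <= expR (- (eta * p * m%:R)).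
Proof.
case: q => [[h t] rho] /= ch; pose A := B t :\: h.
have cA : (m * L - r <= #|A|)%N.
  rewrite cardsD (layout_cardB lay (ltn_ord t)) leq_sub2l //.
  apply: leq_trans (subset_leq_card (subsetIr _ _)) _.
  by rewrite ch leq_pred.
apply: le_trans (_ : expect p (1 - p) (rsets V r) (fun H => (#|[set x in A |
   good k h (fun x => [set x]) rho x H]|%:R < 8 * p * m%:R)%R%:R) <= _).
  apply: le_expect => // [|H _]; first exact: ltW.
  rewrite /few_colinks /= (_ : [set g in B t | _] =
    [set x in A | good k h (fun x => [set x]) rho x H]) //.
  apply/setP => x; rewrite !inE /good sub1set inE.
  by case: (x \in B t); rewrite ?andbF ?andbT //= .
apply: le_trans (_ : expR (8 * p * m%:R - p * ((1 / 8) ^+ k.-1) ^+ r.-1 / 2 * #|A|%:R) <= _).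
  apply: (@few_good R V _ k r p k_gt0 r_gt0 p01 (R0 :\: h)).
  - by apply: kR_sub; rewrite ch leq_pred.
  - by rewrite -card_gt0 ch.
  - by rewrite disjoint_subset; apply/subsetP => v vh; rewrite !inE vh.
  - by move=> x _; rewrite -card_gt0 cards1.
  - by move=> x; rewrite inE => /andP[xh _]; rewrite cardsU1 xh ch add1n prednK.
  - by move=> x; rewrite inE => /andP[xh _]; rewrite disjoints1.
  - move=> x; rewrite inE => /andP[_ xB]; rewrite disjoints1 inE negb_and.
    apply/orP; right; have := layout_rest lay (ltn_ord t); rewrite disjoint_sym.
    by move=> /disjointFr -> //; rewrite in_setU xB orbT.
  - by move=> x x' _ _; rewrite disjoints1 inE.
  - by move=> x _; rewrite cards1.
(* The exponent r - 1 is kept although single vertices are moved, so that one [eta] serves both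
   tails. With [#|A|] at least m L / 2 and eta L >= 8 the exponent is at most 8 p m - 16 p m. *)
rewrite ler_expR (_ : ((1 / 8) ^+ k.-1) ^+ r.-1 = 8 * eta); last by rewrite etaE; field.
have cA2 : (m * L <= 2 * #|A|)%N.
  move: cA L_ge m_gt1; clear; nia.
have mLA : m%:R * L%:R <= 2 * #|A|%:R :> R by rewrite -!natrM ler_nat.
have : 0 <= (p * eta) * (2 * #|A|%:R - m%:R * L%:R).
  by rewrite mulr_ge0 ?subr_ge0 // mulr_ge0 // ltW.
have : 0 <= (p * m%:R) * (eta * L%:R - 8) by rewrite mulr_ge0 ?subr_ge0 // mulr_ge0 // ltW.
have eta1 : eta <= 1.
  have c1 : ((1 / 8 : R) ^+ k.-1) ^+ r.-1 <= 1 by rewrite !exprn_ile1 ?exprn_ge0 //; lra.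
  by rewrite etaE; lra.
have : 0 <= (p * m%:R) * (1 - eta) by rewrite mulr_ge0 ?subr_ge0 // mulr_ge0 // ltW.
have : 0 <= p * m%:R by rewrite mulr_ge0 // ltW.
lra.
Qed.

Lemma groups_le : (#|GG| <= N)%N.
Proof.
apply: (@leq_trans (#|GG| * r.-1)); first by rewrite leq_pmulr.
rewrite -(@card_cover_uniform _ GG) ?max_card //; first exact: layout_triv lay.
exact: layout_size lay.
Qed.

Let okST (q : {set V} * {set {set V}}) := (q.2 \subset GG) && [disjoint q.1 & cover q.2].

(** The pair of empty sets is excluded: its inequality is trivial, but its tail bound would be 1.
    This is the source of the - 1 in the final estimate. *)
Let tail1 (H : hypergraph V) : R :=
  \sum_(q | okST q && (q != (set0, set0)))
    (3 * p * #|q.1|%:R * #|q.2|%:R + 3 * (#|q.1|%:R + #|q.2|%:R) * lam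
       < (pairs H q.1 q.2)%:R)%R%:R.
Let tail2 (H : hypergraph V) : R :=
  \sum_(q | okST q)
    ((pairs H q.1 q.2)%:R < p * #|q.1|%:R * #|q.2|%:R / 2 - 3 * N%:R)%R%:R.
Let tail3 (H : hypergraph V) : R := \sum_q (few_links q H)%:R.
Let tail4 (H : hypergraph V) : R := 
  \sum_(q : {set V} * 'I_k.+2 * 'I_k | #|q.1.1| == r.-1) (few_colinks q H)%:R.

Lemma pseudorandom_of_tails H :
  tail1 H + tail2 H + tail3 H + tail4 H < 1 -> pseudorandom k r m G B p lam eta H.
Proof.
have t1 : 0 <= tail1 H by apply: sumr_ge0.
have t2 : 0 <= tail2 H by apply: sumr_ge0.
have t3 : 0 <= tail3 H by apply: sumr_ge0.
have t4 : 0 <= tail4 H by apply: sumr_ge0.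
move=> lt1.
have /sum_indicator_lt1 h1 : tail1 H < 1 by lra.
have /sum_indicator_lt1 h2 : tail2 H < 1 by lra.
have /sum_indicator_lt1 h3 : tail3 H < 1 by lra.
have /sum_indicator_lt1 h4 : tail4 H < 1 by lra.
split.
- move=> S T TG dST; have [[-> ->]|ne] := eqVneq (S, T) (set0, set0).
    by rewrite pairs_suml big_set0 !cards0; lra.
  by rewrite leNgt; apply: (h1 (S, T)); rewrite /okST TG dST.
- by move=> S T TG dST; rewrite leNgt; apply: (h2 (S, T)); rewrite /okST TG dST.
- move=> x t rho tk rk; rewrite leNgt.
  exact: (h3 (x, Ordinal tk, Ordinal rk) isT).
- move=> h t rho ch tk rk; rewrite leNgt.
  by apply: (h4 (h, Ordinal tk, Ordinal rk)); rewrite /= ch.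
Qed.

Lemma sum_pairs (z : R) : 0 <= z ->
  \sum_(q : {set V} * {set {set V}} | q.2 \subset GG) z ^+ (#|q.1| + #|q.2|)
    <= (1 + z) ^+ (2 * N).
Proof.
move=> z0; apply: (@le_trans _ _ ((1 + z) ^+ N * (1 + z) ^+ #|GG|)); last first.
  rewrite mul2n -addnn exprD ler_wpM2l ?exprn_ge0 ?addr_ge0 //.
  by rewrite ler_weXn2l ?groups_le // lerDl.
rewrite -[N]cardsT -!sum_powerset big_distrl /= le_eqVlt; apply/orP; left; apply/eqP.
under [RHS]eq_bigr do rewrite big_distrr.
rewrite pair_big /=; apply: eq_big => [q|q _]; first by rewrite !inE subsetT.
by rewrite exprD.
Qed.

(** The error terms are shaped for the union bound: an error proportional to [#|S| + #|T|] sums to a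
    binomial expansion, and the error 3 N outweighs the at most 4^N pairs (S, T) because e^3 > 4. *)
Lemma not_pseudorandom_prob :
  expect p (1 - p) (rsets V r)
    (fun H => (~~ `[< pseudorandom k r m G B p lam eta H >])%:R) <=
  ((1 + expR (- (3 * lam))) ^+ (2 * N) - 1) + 4 ^+ N * expR (- (3 * N%:R)) +
  (N + 'C(N, r.-1))%:R * (k.+2 * k)%:R * expR (- (eta * p * m%:R)).
Proof.
apply: (@le_trans _ _ (expect p (1 - p) (rsets V r)
    (fun H => (tail1 H + tail2 H) + (tail3 H + tail4 H)))).
  apply: le_expect => // [|H _]; first exact: ltW.
  case: asboolP => [_|npr] /=; first by rewrite !addr_ge0 // sumr_ge0.
  rewrite leNgt; apply/negP => lt1; apply: npr; apply: pseudorandom_of_tails.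
  by rewrite -addrA.
rewrite !expectD; apply: lerD; first apply: lerD.
- rewrite /tail1 expect_sum lerBrDr.
  apply: le_trans (sum_pairs (expR_ge0 _)).
  rewrite [X in _ <= X](bigD1 (set0, set0)) /=; last by rewrite sub0set.
  rewrite !cards0 expr0 [X in X <= _]addrC lerD2l.
  apply: le_trans (_ : \sum_(q | okST q && (q != (set0, set0)))
     expR (- (3 * lam)) ^+ (#|q.1| + #|q.2|) <= _).
    apply: ler_sum => -[S T] /andP[/andP[/= TG dST] _].
    have tT : trivIset T := trivIsetS TG (layout_triv lay).
    have cT g : g \in T -> #|g| = r.-1 by move=> /(subsetP TG); apply: layout_size lay _.
    apply: le_trans (pairs_upper_tail p01 r_gt1 tT cT dST _) _.
    by rewrite -expRM_natr natrD ler_expR; lra.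
  rewrite [X in X <= _]big_mkcond [X in _ <= X]big_mkcond; apply: ler_sum => q _.
  rewrite /okST; case: (q.2 \subset GG) => //=; case: ifP => [/andP[_ ->] //|_].
  by case: ifP => // _; rewrite exprn_ge0 ?expR_ge0.
- rewrite /tail2 expect_sum.
  apply: le_trans (_ : \sum_(q : {set V} * {set {set V}} | q.2 \subset GG)
      expR (- (3 * N%:R)) * 1 ^+ (#|q.1| + #|q.2|) <= _).
    rewrite big_mkcond [X in _ <= X]big_mkcond; apply: ler_sum => -[S T] _.
    rewrite /okST /=; case: ifP => [/andP[TG dST]|_]; last first.
      by case: ifP => // _; rewrite mulr_ge0 ?exprn_ge0 ?expR_ge0.
    have tT : trivIset T := trivIsetS TG (layout_triv lay).
    have cT g : g \in T -> #|g| = r.-1 by move=> /(subsetP TG); apply: layout_size lay _.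
    by rewrite TG expr1n mulr1; apply: (pairs_lower_tail p01 r_gt1 tT cT dST).
  rewrite -big_distrr /= mulrC ler_wpM2r ?expR_ge0 //.
  apply: le_trans (sum_pairs ler01) _; rewrite exprM.
  by rewrite (_ : (1 + 1) ^+ 2 = 4 :> R) //; ring.
- rewrite natrD !mulrDl; apply: lerD.
    rewrite /tail3 expect_sum.
    apply: le_trans (_ : \sum_(q : V * 'I_k.+2 * 'I_k) expR (- (eta * p * m%:R)) <= _).
      by apply: ler_sum => q _; apply: few_links_prob.
    by rewrite sumr_const -[_ *+ _]mulr_natl !card_prod !card_ord -mulnA !natrM.
  rewrite /tail4 expect_sum.
  apply: le_trans (_ : \sum_(q : {set V} * 'I_k.+2 * 'I_k | #|q.1.1| == r.-1)
      expR (- (eta * p * m%:R)) <= _).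
    by apply: ler_sum => q /eqP; apply: few_colinks_prob.
  rewrite sumr_const -[X in X <= _]mulr_natl ler_wpM2r ?expR_ge0 // -natrM ler_nat.
  pose Q := setX (setX [set h : {set V} | #|h| == r.-1] [set: 'I_k.+2]) [set: 'I_k].
  have -> : ('C(N, r.-1) * (k.+2 * k))%N = #|Q|.
    by rewrite /Q !cardsX !cardsT !card_ord card_draws mulnA.
  apply/subset_leq_card/subsetP => q; rewrite unfold_in => /eqP cq.
  by rewrite /Q !inE cq eqxx.
Qed.

End UnionBound.

(** * Numerical estimates and conclusion *)

Lemma random_hypergraph_prE (R : realType) n r (p : R) (A : pred (hypergraph 'I_n)) :
  random_hypergraph_pr r p A = expect p (1 - p) (rsets 'I_n r) (fun H => (A H)%:R).
Proof.
have unif (H : hypergraph 'I_n) : uniform r H = (H \in powerset (rsets 'I_n r)).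
  rewrite powersetE; apply/forall_inP/subsetP => hH e /hH; by rewrite inE.
rewrite /random_hypergraph_pr /expect (eq_bigl (fun H => (H \in powerset (rsets 'I_n r)) && A H)).
  rewrite big_mkcondr; apply: eq_bigr => H; rewrite powersetE => HD.
  case: (A H); rewrite ?mulr0 // mulr1 /random_hypergraph_weight.
  rewrite (bigID (mem H)) /=; congr (_ * _).
    rewrite (eq_bigr (fun=> p)) => [|e /andP[_ ->] //].
    rewrite prodr_const; congr (_ ^+ _); apply: eq_card => e.
    by rewrite unfold_in andbC; apply: andb_idr => /(subsetP HD); rewrite inE.
  rewrite (eq_bigr (fun=> 1 - p)) => [|e /andP[_ /negbTE ->] //].
  rewrite prodr_const; congr (_ ^+ _); apply: eq_card => e.
  by rewrite unfold_in !inE andbC.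
by move=> H; rewrite unif.
Qed.

Lemma ffact_ge a j : (j <= a)%N -> ((a - j) ^ j <= a ^_ j)%N.
Proof.
elim: j a => [|j IH] [|a] //= ja.
by rewrite ffactnS expnS subSS leq_mul ?IH // (leq_trans (leq_subr _ _)).
Qed.

Lemma bin_le_exp n j : ('C(n, j) <= n ^ j)%N.
Proof.
apply: (@leq_trans (n ^_ j)); first by rewrite -bin_ffact leq_pmulr // fact_gt0.
elim: j n => [|j IH] n //; rewrite ffactnS expnS leq_mul2l.
apply/orP; right; apply: leq_trans (IH _) _.
by case: j {IH} => // j; rewrite leq_exp2r // leq_pred.
Qed.

(** Converts the growth of n^(r-1) p (1 - p) into many expected star hyperedges, for a reservoir of
    about half of the vertices. *)
Lemma bin_ge (R : realType) (n a j : nat) : (j <= a)%N -> (n <= 4 * (a - j))%N ->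
  n%:R ^+ j <= 4 ^+ j * j`!%:R * 'C(a, j)%:R :> R.
Proof.
move=> ja na; rewrite -mulrA -natrM mulnC bin_ffact -!natrX -natrM ler_nat.
apply: leq_trans (_ : (4 * (a - j)) ^ j <= _)%N.
  by case: j {ja} na => // j na; rewrite leq_exp2r.
by rewrite expnMn leq_mul2l ffact_ge // orbT.
Qed.

(** With lam = ln n the first term is about 2 n times n^-3 and the second at most 2^-n; in the
    third, x >= (r + 1) ln n outweighs the at most 2 n^r choices of a vertex or an (r-1)-set. *)
Lemma failure_bound (R : realType) (k r n : nat) (x : R) :
  (1 < k)%N -> (1 < r)%N -> (4 <= n)%N -> r.+1%:R * ln n%:R <= x ->
  ((1 + expR (- (3 * ln n%:R))) ^+ (2 * n) - 1) + 4 ^+ n * expR (- (3 * n%:R)) +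
  (n + 'C(n, r.-1))%:R * (k.+2 * k)%:R * expR (- x) <=
  (5 + 2 * (k.+2 * k)%:R) / n%:R :> R.
Proof.
move=> k1 r1 n4 xge; have n0 : 0 < n%:R :> R by rewrite ltr0n (leq_trans _ n4).
have n4R : 4 <= n%:R :> R by rewrite ler_nat.
have En (j : nat) : expR (- (j%:R * ln n%:R)) = n%:R ^- j :> R.
  by rewrite expRN expRM_natl lnK.
have -> : (5 + 2 * (k.+2 * k)%:R) / n%:R =
    4 / n%:R + 1 / n%:R + 2 * (k.+2 * k)%:R / n%:R :> R by field; rewrite gt_eqF.
apply: lerD; first apply: lerD.
- rewrite (En 3%N); set z := n%:R ^- 3.
  have z0 : 0 <= z by rewrite invr_ge0 exprn_ge0 // ltW.
  have zn : z * (2 * n)%:R = 2 / n%:R / n%:R.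
    by rewrite /z natrM; field; rewrite gt_eqF.
  set y := z * (2 * n)%:R in zn.
  have y0 : 0 <= y by rewrite /y mulr_ge0.
  have y2 : y <= 2 / n%:R by rewrite zn ler_pdivrMr // ler_peMr ?divr_ge0 ?(ltW n0) //; lra.
  have y1 : y <= 1 / 2 by apply: le_trans y2 _; rewrite ler_pdivrMr //; lra.
  have le1 : (1 + z) ^+ (2 * n) <= expR y.
    by rewrite /y expRM_natr lerXn2r ?nnegrE ?expR_ge0 ?addr_ge0 // expR_ge1Dx.
  have le2 : expR y * (1 - y) <= 1.
    have := expR_ge1Dx (- y); rewrite expRN -(ler_pM2l (expR_gt0 y)) mulfV ?gt_eqF ?expR_gt0 //.
  have le3 : expR y <= 1 + 2 * y.
    rewrite -(ler_pM2r (_ : 0 < 1 - y)); last by lra.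
    by apply: le_trans le2 _; nra.
  have e4 : 4%:R / n%:R = 2 * (2 / n%:R) :> R by rewrite mulrA -natrM.
  by rewrite e4; lra.
- have e3 : 4 * expR (- 3) <= 1 / 2 :> R.
    have e1 : expR (-1) <= 1 / 2 :> R.
      rewrite expRN div1r lef_pV2 ?posrE ?expR_gt0 //.
      by have := expR_ge1Dx (1 : R); lra.
    have e0 : 0 < expR (-1) :> R by apply: expR_gt0.
    have -> : - 3 = 3%:R * (-1) :> R by ring.
    rewrite expRM_natl; set u := expR (-1) in e1 e0 *.
    have : u * u <= 1 / 2 * (1 / 2) by rewrite ler_pM // ltW.
    rewrite !exprS expr0 mulr1 => uu.
    have : u * (u * u) <= 1 / 2 * (1 / 2 * (1 / 2)) by rewrite ler_pM // ?mulr_ge0 // ltW.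
    lra.
  have -> : expR (- (3 * n%:R)) = expR (-3) ^+ n :> R by rewrite -mulNr expRM_natr.
  rewrite -exprMn; apply: le_trans (_ : (1 / 2) ^+ n <= _).
    by rewrite lerXn2r ?nnegrE ?mulr_ge0 ?expR_ge0.
  rewrite expr_div_n expr1n !div1r lef_pV2 ?posrE ?exprn_gt0 //.
  by rewrite -natrX ler_nat ltnW // ltn_expl.
- have xe : expR (- x) <= n%:R ^- r.+1 by rewrite -En ler_expR lerN2.
  have nC : (n + 'C(n, r.-1))%:R <= 2 * n%:R ^+ r :> R.
    rewrite -natrX -natrM ler_nat mul2n -addnn leq_add //.
      by rewrite -{1}(expn1 n) leq_pexp2l // ?(leq_trans _ n4) // ltnW.
    by apply: leq_trans (bin_le_exp _ _) _; rewrite leq_pexp2l ?leq_pred ?(leq_trans _ n4).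
  apply: le_trans (_ : 2 * n%:R ^+ r * (k.+2 * k)%:R * n%:R ^- r.+1 <= _).
    rewrite ler_pM ?expR_ge0 // ?mulr_ge0 // ler_wpM2r //.
  rewrite [n%:R ^+ r.+1]exprS le_eqVlt; apply/orP; left; apply/eqP.
  have nr0 : n%:R ^+ r != 0 :> R by rewrite gt_eqF ?exprn_gt0.
  move: nr0; set u := n%:R ^+ r => u0; field.
  by rewrite u0 gt_eqF.
Qed.

Lemma index_probability_ge (R : realType) (k r n m L K Q : nat) (p eta gam : R) :
  (1 < k)%N -> (1 < r)%N -> (1 < m)%N -> (4 <= n)%N -> 0 < p < 1 ->
  eta = ((1 / 8) ^+ k.-1) ^+ r.-1 / 8 -> (2 * r <= L)%N -> 8 <= eta * L%:R ->
  (2 * (k.+2 * (m * r.-1 + m * L)) <= n)%N -> (8 * r <= n)%N -> (2 * (r.+1 * r) <= n)%N ->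
  k%:R * (4 ^+ r.-1 * r.-1`!%:R) <= n%:R ^+ r.-1 * p * (1 - p) ->
  0 <= gam -> n%:R <= gam * m%:R -> 6 * gam / eta + k%:R + 1 <= K%:R ->
  ((k + r * k.+1) * K <= Q)%N ->
  k%:R + Q%:R + 6 * ln n%:R < eta * p * m%:R / 2 ->
  Q%:R + 36 * (Q%:R + 3) * gam / eta * K%:R + 3 * (K%:R + 1) * ln n%:R < 8 * p * m%:R ->
  (k * k)%:R <= eta * p * m%:R -> r.+1%:R * ln n%:R <= eta * p * m%:R ->
  1 - (5 + 2 * (k.+2 * k)%:R) / n%:R <=
  random_hypergraph_pr r p (fun H : hypergraph 'I_n =>
      ((n == 0 %[mod gcdn k r])%N ==> (mod_chromatic_index k H == k)) &&
      ((n != 0 %[mod gcdn k r])%N ==>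
         (maxn k r <= mod_chromatic_index k H <= k + r + 1)%N)) <= 1.
Proof.
move=> k1 r1 m1 n4 p01 etaE Lr Leta sz n8 nr kn gam0 Vle Kge Qge c1 c2 c3 c4.
have /andP[p0 p1] := p01; have q0 : 0 <= 1 - p by lra.
have eta0 : 0 < eta by rewrite etaE !divr_gt0 ?exprn_gt0.
have eta1 : eta <= 1.
  have : ((1 / 8 : R) ^+ k.-1) ^+ r.-1 <= 1 by rewrite !exprn_ile1 ?exprn_ge0 //; lra.
  by rewrite etaE; lra.
have lam0 : 0 <= ln n%:R :> R by rewrite ln_ge0 // ler1n (leq_trans _ n4).
rewrite random_hypergraph_prE; apply/andP; split; last first.
  apply: le_trans (_ : expect p (1 - p) (rsets 'I_n r) (fun=> 1) <= _).
    by apply: le_expect => // [|H _]; [exact: ltW | rewrite lern1 leq_b1].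
  by rewrite expect_cst subrKC expr1n mulr1.
set M := (m * r.-1 + m * L)%N in sz.
have nM : (k.+2 * M <= n)%N by apply: leq_trans sz; rewrite leq_pmull.
have lay := interval_layout r1 (ltnW m1) nM.
have cR : #|irest n k r m L| = (n - k.+2 * M)%N by apply: card_itv.
have kR : k%:R <= 'C(#|irest n k r m L| - r, r.-1)%:R * p * (1 - p).
  have fac0 : 0 < 4 ^+ r.-1 * r.-1`!%:R :> R by rewrite mulr_gt0 ?exprn_gt0 // ltr0n fact_gt0.
  rewrite -(ler_pM2r fac0); apply: le_trans kn _.
  rewrite [X in _ <= X](_ : _ = (4 ^+ r.-1 * r.-1`!%:R * 'C(#|irest n k r m L| - r, r.-1)%:R) * p * (1 - p)).
    rewrite !ler_wpM2r ?(ltW p0) // bin_ge // cR; move: sz n8; clear; lia.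
  by ring.
have := not_pseudorandom_prob (ln n%:R) k1 r1 lay p01 kR etaE m1 Lr Leta.
rewrite card_ord => bad.
have := le_trans bad (failure_bound k1 r1 n4 c4); set bad_pr := expect _ _ _ _ => bad_le.
apply: le_trans (_ : 1 - bad_pr <= _); first by lra.
have -> : 1 - bad_pr = expect p (1 - p) (rsets 'I_n r)
    (fun H => 1 + (-1) * (~~ `[< pseudorandom k r m (igroups n r m L) (iblock n r m L) p (ln n%:R) eta H >])%:R).
  by rewrite expectD expectZ expect_cst subrKC expr1n mulr1 mulN1r.
apply: le_expect => // [|H HD]; first exact: ltW.
case: asboolP => [psr|_] /=; last by rewrite mulr1 subrr.
rewrite mulr0 addr0.
have uH : uniform r H.
  by apply/forall_inP => e /(subsetP HD); rewrite inE.
have R0ge : (r.+1 * r <= #|irest n k r m L|)%N.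
  by rewrite cR; move: sz nr; clear; lia.
have Vle' : #|'I_n|%:R <= gam * m%:R by rewrite card_ord.
have := chromatic_index_bounds k1 r1 lay uH psr p0 (ltnW m1) lam0 eta0 eta1 gam0 Vle' Kge Qge c1 c2 c3 R0ge.
by rewrite card_ord => ->.
Qed.

Local Open Scope classical_set_scope.
Local Open Scope ring_scope.

Theorem theorem1 (R : realType) (k r : nat) (hk : (2 <= k)%N) (hr : (2 <= r)%N) :
  exists C : R, 0 < C /\
  forall p : nat -> R,
    (forall n : nat, (1 <= n)%N -> 0 <= p n < 1) ->
    (\forall n \near \oo, C * ln n%:R / n%:R < p n) ->
    (fun n : nat => n%:R ^+ r.-1 * p n * (1 - p n)) @ \oo --> +oo ->
    aas r p (fun n (H : hypergraph 'I_n) =>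
      ((n == 0 %[mod gcdn k r])%N ==> (mod_chromatic_index k H == k)) &&
      ((n != 0 %[mod gcdn k r])%N ==>
         (maxn k r <= mod_chromatic_index k H <= k + r + 1)%N)).

Proof.
pose eta : R := ((1 / 8) ^+ k.-1) ^+ r.-1 / 8.
have eta0 : 0 < eta by rewrite !divr_gt0 ?exprn_gt0.
have truncP (x : R) : 0 <= x -> x <= (Num.truncn x).+1%:R.
  by move=> /truncn_itv/andP[_ /ltW].
pose L := ((Num.truncn (8 / eta)).+1 + 2 * r)%N.
have Leta : 8 <= eta * L%:R.
  rewrite mulrC -ler_pdivrMr //; apply: le_trans (truncP _ _) _.
    by rewrite divr_ge0 // ltW.
  by rewrite ler_nat leq_addr.
(* The k + 2 parts occupy beta m vertices. Taking m = n / (2 beta) rounded down leaves half of the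
   vertices to the reservoir, and m >= n / (4 beta) explains [gam]. *)
pose beta := (k.+2 * (r.-1 + L))%N; have beta0 : (0 < beta)%N by rewrite muln_gt0 addnC.
pose gam : R := (4 * beta)%:R.
have gam0 : 0 < gam by rewrite ltr0n muln_gt0.
pose K := (Num.truncn (6 * gam / eta + k%:R + 1)).+1.
have K_ge : 6 * gam / eta + k%:R + 1 <= K%:R.
  by apply: truncP; rewrite !addr_ge0 // divr_ge0 ?(ltW eta0) // mulr_ge0 // ltW.
pose Q := ((k + r * k.+1) * K)%N.
pose X : R := 36 * (Q%:R + 3) * gam / eta * K%:R.
have X0 : 0 <= X.
  by rewrite mulr_ge0 // divr_ge0 ?(ltW eta0) // !mulr_ge0 ?(ltW gam0) // addr_ge0.
(* The multiple of ln n that eta p m has to exceed: the doubled term is for the bound on eta p m /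
   2, with 7 instead of 6 for strictness, the others for the remaining conditions on eta p m. *)
pose Y : R := 2 * (k%:R + Q%:R + 7) + (r.+1%:R + (k * k)%:R).
have Y0 : 0 <= Y by rewrite !(addr_ge0, mulr_ge0).
pose D : R := Y / eta + (Q%:R + X + 3 * (K%:R + 1) + 1).
have Ye : 0 <= Y / eta by rewrite divr_ge0 // ltW.
have D_gt : Q%:R + X + 3 * (K%:R + 1) + 1 <= D by rewrite lerDr.
have D0 : 0 < D.
  by apply: lt_le_trans D_gt; have := ler0n R Q; have := ler0n R K; lra.
have etaD : Y <= eta * D.
  rewrite mulrDr mulrCA mulfV ?gt_eqF // mulr1 lerDl mulr_ge0 ?(ltW eta0) //.
  by have := ler0n R Q; have := ler0n R K; lra.
(* As n <= gam m, the bound p > gam D ln n / n yields p m > D ln n, and D was chosen for the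
   conditions on p m and on eta p m. *)
exists (gam * D); split; first exact: mulr_gt0.
move=> p p01 pC pinf; apply/cvgrPdist_le => eps eps0.
pose E0 : R := 5 + 2 * (k.+2 * k)%:R.
have pinf' := (cvgryPge _).1 pinf (k%:R * (4 ^+ r.-1 * r.-1`!%:R)).
near=> n.
have nN : (4 + 4 * beta + 8 * r + 2 * (r.+1 * r) <= n)%N.
  by near: n; apply: nbhs_infty_ge.
have kn : k%:R * (4 ^+ r.-1 * r.-1`!%:R) <= n%:R ^+ r.-1 * p n * (1 - p n).
  by near: n; exact: pinf'.
have nE : E0 / eps <= n%:R by near: n; apply: nbhs_infty_ger.
have pCn : gam * D * ln n%:R / n%:R < p n by near: n; exact: pC.
have n4 : (4 <= n)%N by apply: leq_trans nN; rewrite -!addnA leq_addr.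
have n0 : 0 < n%:R :> R by rewrite ltr0n (leq_trans _ n4).
have lam1 : 1 <= ln n%:R :> R.
  rewrite -ler_expR lnK ?posrE //; apply: le_trans (expR1_le4 R) _.
  by rewrite ler_nat.
have pn1 : p n < 1 by have /andP[] := p01 n (leq_trans (isT : (0 < 4)%N) n4).
have pn0 : 0 < p n.
  apply: le_lt_trans pCn; rewrite divr_ge0 ?(ltW n0) // !mulr_ge0 ?(ltW gam0) ?(ltW D0) //.
  by apply: le_trans lam1.
pose m := (n %/ (2 * beta))%N.
have b2 : (0 < 2 * beta)%N by rewrite muln_gt0.
have m1 : (1 < m)%N.
  by rewrite leq_divRL // mulnA; move: nN; clear; lia.
have mb : (m * (2 * beta) <= n)%N by apply: leq_trunc_div.
have nmb : (n <= 4 * beta * m)%N.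
  have := ltn_ceil n b2; rewrite -/m => /ltnW h; apply: leq_trans h _.
  by move: m1; clear; nia.
have sz : (2 * (k.+2 * (m * r.-1 + m * L)) <= n)%N.
  by apply: leq_trans mb; rewrite -mulnDr /beta; clear; nia.
have Vle : n%:R <= gam * m%:R by rewrite -natrM ler_nat.
have Dpm : D * ln n%:R < p n * m%:R.
  rewrite -(ltr_pM2l gam0); apply: lt_le_trans (_ : p n * n%:R <= _).
    by rewrite -ltr_pdivrMr // mulrA.
  by rewrite mulrCA ler_wpM2l // ltW.
have epm : Y * ln n%:R <= eta * p n * m%:R.
  rewrite -mulrA; apply: le_trans (_ : eta * (D * ln n%:R) <= _).
    by rewrite mulrA ler_wpM2r // (le_trans _ lam1).
  by rewrite ler_wpM2l ?ltW.
(* Since ln n >= 1, additive constants are absorbed into multiples of ln n and the conditions become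
   linear. *)
have scale (x : R) : 0 <= x -> x <= x * ln n%:R by move=> x0; rewrite ler_peMr.
have sk := scale _ (ler0n R k); have sQ := scale _ (ler0n R Q).
have skk := scale _ (ler0n R (k * k)); have sX := scale X X0.
have rl : 0 <= r.+1%:R * ln n%:R :> R by rewrite mulr_ge0 // (le_trans _ lam1).
have kl : 0 <= (k * k)%:R * ln n%:R :> R by rewrite mulr_ge0 // (le_trans _ lam1).
have Qk : 0 <= (k%:R + Q%:R) * ln n%:R :> R.
  by rewrite mulr_ge0 ?addr_ge0 // (le_trans _ lam1).
have Yl : Y * ln n%:R = 2 * (k%:R * ln n%:R + Q%:R * ln n%:R + 7 * ln n%:R) +
    (r.+1%:R * ln n%:R + (k * k)%:R * ln n%:R) by rewrite /Y; ring.
have := @index_probability_ge R k r n m L K Q (p n) eta gam hk hr m1 n4.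
rewrite pn0 pn1 => /(_ isT erefl) ge_pr.
have n8 : (8 * r <= n)%N := leq_trans (leq_trans (leq_addl _ _) (leq_addr _ _)) nN.
have nr : (2 * (r.+1 * r) <= n)%N by apply: leq_trans nN; rewrite leq_addl.
have /andP[lo hi] : 1 - E0 / n%:R <= random_hypergraph_pr r (p n)
    (fun H : hypergraph 'I_n =>
      ((n == 0 %[mod gcdn k r])%N ==> (mod_chromatic_index k H == k)) &&
      ((n != 0 %[mod gcdn k r])%N ==>
         (maxn k r <= mod_chromatic_index k H <= k + r + 1)%N)) <= 1.
  apply: (ge_pr _ Leta sz n8 nr kn (ltW gam0) Vle K_ge (leqnn _)).
  - exact: leq_addl.
  - lra.
  - rewrite -/X; have : (Q%:R + X + 3 * (K%:R + 1) + 1) * ln n%:R <= D * ln n%:R.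
      by rewrite ler_wpM2r // (le_trans _ lam1).
    have : 0 < p n * m%:R by rewrite mulr_gt0 // ltr0n ltnW.
    have -> : (Q%:R + X + 3 * (K%:R + 1) + 1) * ln n%:R =
      Q%:R * ln n%:R + X * ln n%:R + 3 * (K%:R + 1) * ln n%:R + ln n%:R by ring.
    lra.
  - lra.
  - lra.
rewrite ger0_norm ?subr_ge0 //.
have : E0 / n%:R <= eps by rewrite ler_pdivrMr // mulrC -ler_pdivrMr.
lra.
Unshelve. all: by end_near.
Qed.
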